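(* Let $d\in\{1,2\}$ and let $0\le u_0\in\mathscr{A}^0(\mathbb{T}^d)$ be such that $\frac{1}{(2\pi)^d}\int_{\mathbb{T}^d}\frac{1}{u_0(x)}\,dx=1$, $$|u_0^{-1}-1|_0<1$$ (in particular $u_0>0.5$), and $\delta(|u_0^{-1}-1|_0)>0$, where $$\delta(z)=6-\frac{3}{(1-z)^4}\left(1+28\frac{z}{1-z}+120\frac{z^2}{(1-z)^2}+120\frac{z^3}{(1-z)^3}\right).$$ Then there exists at least one global weak solution $u$ (in the sense defined in the context) of $$\partial_tu=-u^2\Delta^2(u^3),\qquad u(0,x)=u_0(x),$$ with $$u^{-1}\in C([0,T];L^2(\mathbb{T}^d))\cap L^2(0,T;\mathscr{H}^2(\mathbb{T}^d))\qquad\text{for all }0<T<\infty.$$ Furthermore, $$\|u^{-1}(t)-1\|_{L^\infty}\le|u_0^{-1}-1|_0\,e^{-\delta(|u_0^{-1}-1|_0)t}\qquad\text{for all }t\ge0.$$ In particular, $\limsup_{t\to\infty}\|u(t)\|_{L^\infty}=1$.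
   Context: $\mathbb{T}^d=[-\pi,\pi]^d$ is the $d$-dimensional torus (periodic boundary conditions). Fourier coefficients: $\widehat u(k)=(2\pi)^{-d}\int_{\mathbb{T}^d}u(x)e^{-ix\cdot k}\,dx$, $k\in\mathbb{Z}^d$. For $\alpha\ge0$: $\mathscr{A}^\alpha(\mathbb{T}^d)=\{u\in L^1(\mathbb{T}^d):|u|_\alpha:=\sum_{k\in\mathbb{Z}^d}|k|^\alpha|\widehat u(k)|<\infty\}$ and $\mathscr{H}^\alpha(\mathbb{T}^d)=\{u\in L^2(\mathbb{T}^d):\|u\|_{\mathscr{H}^\alpha}^2:=\sum_{k\in\mathbb{Z}^d}|k|^{2\alpha}|\widehat u(k)|^2<\infty\}$ (with $|0|^0=1$). Here $u^{-1}=1/u$. Weak solution: $u$ is a global weak solution with initial data $u_0$ if $v=u^{-1}-1$ is, for every $T>0$, a weak solution on $[0,T]$ of $\partial_tv=\Delta^2\big((1+v)^{-3}\big)$ with initial data $v_0=u_0^{-1}-1$, that is, $v\in L^\infty(0,T;L^\infty(\mathbb{T}^d))$ and $$\int_{\mathbb{T}^d}\varphi(0,x)v_0(x)\,dx+\int_0^T\int_{\mathbb{T}^d}\Big(\partial_t\varphi(t,x)\,v(t,x)+\frac{\Delta^2\varphi(t,x)}{(1+v(t,x))^3}\Big)\,dx\,dt=0$$ for all $\varphi\in C^\infty([0,T)\times\mathbb{T}^d)$ with compact support in $[0,T)\times\mathbb{T}^d$. *)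

(* Defs.v *)
From HB Require Import structures.
From mathcomp Require Import all_boot all_order all_algebra.
From mathcomp Require Import all_classical all_reals all_analysis.
From mathcomp Require Import complex.

Set Implicit Arguments.
Unset Strict Implicit.
Unset Printing Implicit Defensive.

Import Order.TTheory GRing.Theory Num.Def Num.Theory.
Import numFieldNormedType.Exports.

Local Open Scope classical_set_scope.
Local Open Scope ring_scope.

(* The library puts no sigma-algebra on matrices: use the product one, as it
   does for [n.-tuple T]. *)
Section measurable_rV.
Context {R : realType}.
Variable n : nat.

Let coors : 'I_n -> 'rV[R]_n -> measurableTypeR R := fun i x => x ord0 i.

Let rV_set0 : g_sigma_preimage coors set0.
Proof. exact: sigma_algebra0. Qed.

Let rV_setC A : g_sigma_preimage coors A -> g_sigma_preimage coors (~` A).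
Proof. exact: sigma_algebraC. Qed.

Let rV_bigcup (F : (set 'rV[R]_n)^nat) :
  (forall i, g_sigma_preimage coors (F i)) ->
  g_sigma_preimage coors (\bigcup_i (F i)).
Proof. exact: sigma_algebra_bigcup. Qed.

HB.instance Definition _ :=
  @isMeasurable.Build (measure_tuple_display default_measure_display)
    'rV[R]_n (g_sigma_preimage coors) rV_set0 rV_setC rV_bigcup.

Lemma measurable_rV_coord (i : 'I_n) :
  measurable_fun [set: 'rV[R]_n] (coors i).
Proof.
move=> _ Y mY; rewrite setTI; apply: sub_sigma_algebra => /=.
rewrite -bigcup_seq/=; exists i => /=; first by rewrite mem_index_enum.
by exists Y => //; rewrite setTI.
Qed.

Lemma measurable_fun_rVP d (T : measurableType d) (f : T -> 'rV[R]_n) :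
  (forall i, measurable_fun [set: T] (coors i \o f)) ->
  measurable_fun [set: T] f.
Proof.
move=> mf.
have prefS : g_sigma_preimage (fun i => coors i \o f) `<=` measurable.
  apply: smallest_sub; first exact: sigma_algebra_measurable.
  by rewrite -bigcup_seq/=; apply: bigcup_sub => i _ _ [B mB <-]; exact: mf.
by move=> _ A mA; apply: prefS; rewrite g_sigma_preimage_comp; exists A.
Qed.

End measurable_rV.

Section torus_measure.
Context {R : realType}.

(* The circle T is [-pi, pi]; identified endpoints are a null set. *)
Definition circle_measure :=
  mrestr (@lebesgue_measure R) (measurable_itv `[(- pi)%R, pi]).

HB.instance Definition _ := Measure.on circle_measure.

Let circle_fin : fin_num_fun circle_measure.
Proof.
move=> A mA; rewrite ge0_fin_numE//.
apply: (@le_lt_trans _ _ (lebesgue_measure `[(- pi)%R, pi : R]%classic)).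
  by apply: le_measure; rewrite ?inE//=; exact: measurableI.
by rewrite lebesgue_measure_itv/=; case: ifP => //; rewrite -EFinD ltry.
Qed.

HB.instance Definition _ := Measure_isFinite.Build _ _ _ circle_measure circle_fin.

Definition consrV n (z : measurableTypeR R * 'rV[R]_n) : 'rV[R]_n.+1 :=
  \row_i if unlift ord0 i is Some j then z.2 ord0 j else z.1.

Lemma measurable_consrV n : measurable_fun setT (@consrV n).
Proof.
apply: measurable_fun_rVP => i.
case: (unliftP ord0 i) => [j ->|->].
- rewrite (_ : _ \o _ = (fun x : 'rV[R]_n => x ord0 j) \o snd).
    by apply: measurableT_comp => //; exact: measurable_rV_coord.
  by apply/funext => -[a x] /=; rewrite mxE liftK.
- rewrite (_ : _ \o _ = fst)//.
  by apply/funext => -[a x] /=; rewrite mxE unlift_none.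
Qed.

Section torus_step.
Variables (n : nat) (m : {finite_measure set 'rV[R]_n -> \bar R}).

Definition torus_step := pushforward (circle_measure \x m)%E (@consrV n).

Let torus_step0 : torus_step set0 = 0%E.
Proof. by rewrite /torus_step /pushforward preimage_set0 measure0. Qed.

Let torus_step_ge0 A : (0 <= torus_step A)%E.
Proof. by apply: integral_ge0 => x _; exact: measure_ge0. Qed.

Let torus_step_sigma_additive : semi_sigma_additive torus_step.
Proof.
have mpre A : measurable A -> measurable (@consrV n @^-1` A).
  by move=> mA; rewrite -[X in measurable X]setTI; exact: measurable_consrV.
move=> F mF tF mUF; rewrite /torus_step /pushforward preimage_bigcup.
apply: measure_semi_sigma_additive.
- by move=> k; exact: mpre.
- apply/trivIsetP => /= i j _ _ ij; rewrite -preimage_setI.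
  by move/trivIsetP : tF => /(_ _ _ _ _ ij) ->//; rewrite preimage_set0.
- by rewrite -preimage_bigcup; exact: mpre.
Qed.

HB.instance Definition _ := isMeasure.Build _ _ _ torus_step
  torus_step0 torus_step_ge0 torus_step_sigma_additive.

Let torus_step_fin : fin_num_fun torus_step.
Proof.
move=> A mA; rewrite ge0_fin_numE//.
apply: (@le_lt_trans _ _ ((circle_measure \x m)%E setT)).
  rewrite /torus_step /pushforward le_measure ?inE//=.
  by rewrite -[X in measurable X]setTI; exact: measurable_consrV.
rewrite -setXTT product_measure1E// lte_mul_pinfty//.
  by rewrite fin_num_measure.
by rewrite ltey_eq fin_num_measure.
Qed.

HB.instance Definition _ :=
  Measure_isFinite.Build _ _ _ torus_step torus_step_fin.
End torus_step.

(* Lebesgue measure on [-pi, pi]^d, seen as a measure on R^d: functions on the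
   torus are functions on R^d of which only the restriction to the box matters. *)
Fixpoint torus d : {finite_measure set 'rV[R]_d -> \bar R} :=
  match d with
  | 0%N => \d_(0 : 'rV[R]_0)
  | n.+1 => torus_step (torus n)
  end.

End torus_measure.

Section function_spaces.
Context {R : realType} {d : nat}.
Implicit Types (u : 'rV[R]_d -> R) (k : 'rV[int]_d) (alpha T : R).
Local Open Scope complex_scope.

Definition int_norm k : R := Num.sqrt (\sum_i (k ord0 i)%:~R ^+ 2).

Definition int_dot k (x : 'rV[R]_d) : R := \sum_i (k ord0 i)%:~R * x ord0 i.

(* e^{-i x.k} = cos (k.x) - i sin (k.x), and u is real-valued. *)
Definition fourier_coef u k : R[i] :=
  ((2 * pi) ^- d * \int[torus d]_x (u x * cos (int_dot k x)))%R -i*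
  ((2 * pi) ^- d * \int[torus d]_x (u x * sin (int_dot k x)))%R.

(* [0 `^ 0 = 1], so |0|^0 = 1. *)
Definition wiener_norm alpha u : \bar R :=
  \esum_(k in [set: 'rV[int]_d])
    (int_norm k `^ alpha * Normc.normc (fourier_coef u k))%:E.

Definition wiener alpha : set ('rV[R]_d -> R) :=
  [set u | u \in Lfun (torus d) 1 /\ (wiener_norm alpha u < +oo)%E].

Definition sobolev_norm2 alpha u : \bar R :=
  \esum_(k in [set: 'rV[int]_d])
    (int_norm k `^ (2 * alpha) * Normc.normc (fourier_coef u k) ^+ 2)%:E.

Definition sobolev alpha : set ('rV[R]_d -> R) :=
  [set u | u \in Lfun (torus d) 2%:E /\ (sobolev_norm2 alpha u < +oo)%E].

Definition Linfty_norm u : \bar R := Lnorm (torus d) +oo%E (EFin \o u).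

Implicit Type w : R -> 'rV[R]_d -> R.

(* Functions of time with values in a function space are represented by
   functions of (t, x); measurability in time is joint measurability. *)
Definition measurable_upto T w :=
  measurable_fun (`[0, T]%classic `*` [set: 'rV[R]_d])
    (fun z : measurableTypeR R * 'rV[R]_d => w z.1 z.2).

Definition Linfty_Linfty T : set (R -> 'rV[R]_d -> R) :=
  [set w | measurable_upto T w /\
    exists M : R, {ae @lebesgue_measure R, forall t, 0 < t < T ->
      (Linfty_norm (w t) <= M%:E)%E}].

Definition C_L2 T : set (R -> 'rV[R]_d -> R) :=
  [set w | forall s, 0 <= s <= T ->
    w s \in Lfun (torus d) 2%:E /\
    Lnorm (torus d) 2%:E (EFin \o (w t \- w s))
      @[t --> within `[0, T] (nbhs s)] --> 0%E].

Definition L2_sobolev alpha T : set (R -> 'rV[R]_d -> R) :=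
  [set w | [/\ measurable_upto T w,
    {ae @lebesgue_measure R, forall t, 0 < t < T -> sobolev alpha (w t)} &
    (\int[@lebesgue_measure R]_(t in `]0%R, T[) sobolev_norm2 alpha (w t)
      < +oo)%E]].

End function_spaces.

Section weak_solution.
Context {R : realType}.

Fixpoint Ck (V : normedModType R) (k : nat) (f : V -> R) : Prop :=
  continuous f /\
  if k is j.+1 then
    forall v, (forall x, derivable f x v) /\ Ck j (fun x => 'D_v f x)
  else True.

Definition smooth (V : normedModType R) (f : V -> R) := forall k, Ck k f.

Context {d : nat}.

Definition laplacian (f : 'rV[R]_d -> R) (x : 'rV[R]_d) : R :=
  \sum_i 'D_(delta_mx ord0 i) ('D_(delta_mx ord0 i) f) x.

(* A function in C^oo([0, T) x T^d) is represented by a smooth extension to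
   R x R^d, periodic in space; its values at negative times are irrelevant. *)
Definition test_function (T : R) (phi : R * 'rV[R]_d -> R) :=
  [/\ smooth phi,
      forall t x i, phi (t, x + (2 * pi) *: delta_mx ord0 i) = phi (t, x) &
      exists2 T', T' < T & forall t x, T' <= t -> phi (t, x) = 0].

Definition weak_integrand (phi : R * 'rV[R]_d -> R) (v : R -> 'rV[R]_d -> R)
    (t : R) (x : 'rV[R]_d) : R :=
  derive1 (fun s => phi (s, x)) t * v t x +
  laplacian (laplacian (fun y => phi (t, y))) x / (1 + v t x) ^+ 3.

(* Division by 0 and non-convergent integrals are total in the library, so the
   definition requires 1 + v <> 0 a.e. and both integrals to converge. *)
Record weak_solution (T : R) (v0 : 'rV[R]_d -> R) (v : R -> 'rV[R]_d -> R) := {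
  weak_solution_bounded : Linfty_Linfty T v ;
  weak_solution_neq0 : {ae (@lebesgue_measure R \x torus d)%E,
    forall z, 0 < z.1 < T -> 1 + v z.1 z.2 != 0} ;
  weak_solution_integrable0 : forall phi, test_function T phi ->
    (torus d).-integrable setT (fun x => (phi (0, x) * v0 x)%:E) ;
  weak_solution_integrable : forall phi, test_function T phi ->
    (@lebesgue_measure R \x torus d)%E.-integrable (`[0, T]%classic `*` setT)
      (fun z => (weak_integrand phi v z.1 z.2)%:E) ;
  weak_solution_eq : forall phi, test_function T phi ->
    \int[torus d]_x (phi (0, x) * v0 x) +
    \int[@lebesgue_measure R]_(t in `[0, T])
      (\int[torus d]_x weak_integrand phi v t x) = 0 }.

Definition inv_sub1 (u : 'rV[R]_d -> R) (x : 'rV[R]_d) : R := (u x)^-1 - 1.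

(* For v = u^{-1} - 1, [weak_solution_neq0] says that u <> 0 a.e. *)
Definition global_weak_solution (u0 : 'rV[R]_d -> R) (u : R -> 'rV[R]_d -> R) :=
  forall T, 0 < T ->
    weak_solution T (inv_sub1 u0) (fun t => inv_sub1 (u t)).

End weak_solution.

Definition delta {R : realType} (z : R) : R :=
  6 - 3 / (1 - z) ^+ 4 *
    (1 + 28 * (z / (1 - z)) + 120 * (z ^+ 2 / (1 - z) ^+ 2)
       + 120 * (z ^+ 3 / (1 - z) ^+ 3)).

(* Main.v *)
(* Writing v = 1/u - 1, the equation reads
     v_t = Delta^2 ((1 + v)^-3) = - 3 Delta^2 v + Delta^2 N(v),
     N(y) = (1 + y)^-3 - 1 + 3 y = sum_(n >= 2) (-1)^n 'C(n + 2, 2) y^n.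
   The positivity of delta forces |v0|_0 < 1/32.  On the Fourier side, Duhamel's
   formula is then a contraction for sum_k sup_t |v^(t, k)|, because the gain
   int_0^t |k|^4 e^(- 3 |k|^4 (t - s)) ds <= 1/3 absorbs the loss of derivatives
   and N has a small Lipschitz constant on the ball of radius 1/16 of the Wiener
   algebra.  This yields a solution global in time.  Subadditivity of the weight
   min(|k|, K), together with the interpolation |v|_i <= |v|_0^(1 - i/4) |v|_4^(i/4),
   gives |N(v)|_4 <= (3 - delta(|v|_0)) |v|_4, where delta comes from summing
   sum_n 'C(n + 2, 2) n^4 z^(n - 1).  Hence the dissipation beats the nonlinearity:
     d/dt |v|_0 + delta(|v|_0) |v|_4 <= 0,
   and |v|_4 >= |v|_0 since v has zero mean; exponential decay follows by a
   continuity argument, letting K tend to infinity.  The time integral of |v|_4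
   controls that of the squared H^2 norm. *)

From HB Require Import structures.
Require Import Defs.
From mathcomp Require Import all_boot all_order all_algebra.
From mathcomp Require Import all_classical all_reals all_analysis.
From mathcomp Require Import measurable_realfun ess_sup_inf.
From mathcomp Require Import complex ring lra zify.

Set Implicit Arguments.
Unset Strict Implicit.
Unset Printing Implicit Defensive.

Import Order.TTheory GRing.Theory Num.Theory.
Import numFieldNormedType.Exports.

Local Open Scope classical_set_scope.
Local Open Scope ring_scope.

(** The radii fit together as follows. If the Picard increments halve, data below 1/32 keep all
    iterates below 1/16; there N has Lipschitz constant 3 (1 - r)^-4 - 3 <= 3/2, and the Duhamel
    gain 1/3 turns this into the ratio 1/2. The obstacle to decay is that the fixed point only has
    sum_k sup_t |v^(t, k)| finite, so |v|_4 is not known to be finite. Cutting the weight off at K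
    makes every quantity finite and continuous in time, and keeps nonnegativity and subadditivity,
    all that the bound on N(v) asks of a weight; its constants do not depend on K. The modulus of a
    coefficient is not differentiable where it vanishes, so the energy inequality is obtained in
    integrated form, by comparing each mode with a scalar Duhamel solution. The datum is given up to
    null sets: the evolution starts from the sum of the Fourier series of 1/u0 - 1. Uniqueness of
    Fourier coefficients of integrable functions on the torus identifies this sum with the datum
    almost everywhere; it also lets N(v) be replaced by its Fourier series in the weak
    formulation. *)

Lemma cvg_big_sum {R : realType} {T I : Type} {F : set_system T} {FF : Filter F}
    (r : seq I) (f : I -> T -> R) (l : I -> R) :
  (forall i, f i x @[x --> F] --> l i) ->
  \sum_(i <- r) f i x @[x --> F] --> \sum_(i <- r) l i.
Proof.
move=> fl; elim: r => [|i r IH].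
  by rewrite big_nil; under eq_fun do rewrite big_nil; exact: cvg_cst.
by rewrite big_cons; under eq_fun do rewrite big_cons; apply: cvgD.
Qed.

(** * Sums over countable types *)

Section countable_sums.
Context {R : realType} {G : countType}.
Implicit Types (f g : G -> R) (a b : G -> \bar R).

(** [pickle_inv], unlike [unpickle], answers only at the code of an element, so each point of [G] is
    counted once and the other indices contribute 0. Signed families are thus summed as ordinary
    series, nonnegative ones as unordered sums in the extended reals. *)
Definition enum_fun (f : G -> R) (n : nat) : R := oapp f 0 (pickle_inv n).

Definition gsum f : R := limn (series (enum_fun f)).

Definition gnorm f : \bar R := \esum_(k in [set: G]) `|f k|%:E.

Definition gsummable f := (gnorm f < +oo)%E.

Lemma esum_enum a : (forall k, 0 <= a k)%E ->
  (\esum_(k in [set: G]) a k = \sum_(n <oo) oapp a 0 (pickle_inv n))%E.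
Proof.
move=> a0; rewrite nneseries_esumT; last by move=> n; case: pickle_inv => //=.
rewrite (esumID [set n | pickle_inv n != None :> option G]); last first.
  by move=> n _; case: pickle_inv => /=.
rewrite [X in (_ + X)%E]esum1 ?adde0; last first.
  by move=> n [_ /=]; case: pickle_inv => //= k /negP; rewrite negbK.
rewrite setTI (_ : [set n | _] = pickle @` [set: G]); last first.
  apply/seteqP; split => n /=.
    by have := @pickle_invK G n; case: pickle_inv => //= k <- _; exists k.
  by move=> [k _ <-]; rewrite pickleK_inv.
rewrite esum_image; last by move=> x y _ _; exact: (pcan_inj pickleK).
by apply: eq_esum => k _; rewrite pickleK_inv.
Qed.

Lemma gsummableP f : gsummable f <-> cvgn [normed series (enum_fun f)].
Proof.
rewrite /gsummable /gnorm esum_enum; last by move=> k; rewrite lee_fin.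
have -> : (\sum_(n <oo) oapp (fun k => `|f k|%:E) 0 (pickle_inv n) =
   \sum_(n <oo) (`|enum_fun f n|%:E))%E.
  apply: eq_eseriesr => n _; rewrite /enum_fun; case: pickle_inv => //=.
  by rewrite normr0.
split => [fy|/cvg_ex[l fl]].
  by apply: (@nnseries_is_cvg _ (fun n => `|enum_fun f n|)) => //.
suff -> : (\sum_(0 <= n <oo) `|enum_fun f n|%:E = l%:E)%E by rewrite ltry.
apply/cvg_lim => //; apply: (@cvg_trans _ (EFin \o [normed series (enum_fun f)] @ \oo)).
  rewrite (_ : EFin \o _ = (fun n => \sum_(0 <= i < n) `|enum_fun f i|%:E)%E) //.
  by apply/funext => n /=; rewrite /series /= sumEFin.
by apply: cvg_EFin; [exact: nearW|exact: fl].
Qed.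

Lemma gsummable_cvg f : gsummable f -> cvgn (series (enum_fun f)).
Proof. by move=> /gsummableP; exact: normed_cvg. Qed.

Lemma enum_funD f g : enum_fun (f \+ g) = enum_fun f + enum_fun g.
Proof.
apply/funext => n; rewrite /enum_fun fctE; case: pickle_inv => //=.
by rewrite addr0.
Qed.

Lemma enum_funZ c f : enum_fun (fun k => c * f k) = c *: enum_fun f.
Proof.
apply/funext => n; rewrite /enum_fun fctE; case: pickle_inv => //=.
by rewrite scaler0.
Qed.

Lemma gsumD f g : gsummable f -> gsummable g ->
  gsum (f \+ g) = gsum f + gsum g.
Proof.
by move=> /gsummable_cvg sf /gsummable_cvg sg; rewrite /gsum enum_funD lim_seriesD.
Qed.

Lemma gsumZ c f : gsummable f -> gsum (fun k => c * f k) = c * gsum f.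
Proof. by move=> /gsummable_cvg sf; rewrite /gsum enum_funZ lim_seriesZ. Qed.

Lemma eq_gsum f g : f =1 g -> gsum f = gsum g.
Proof. by move=> /funext ->. Qed.

Lemma gsumN f : gsummable f -> gsum (fun k => - f k) = - gsum f.
Proof.
move=> sf; rewrite -mulN1r -gsumZ//; apply: eq_gsum => k.
by rewrite mulN1r.
Qed.

Lemma le_gnorm f g : (forall k, `|f k| <= `|g k|) -> (gnorm f <= gnorm g)%E.
Proof. by move=> fg; apply: le_esum => k _; rewrite lee_fin. Qed.

Lemma le_gsummable f g : (forall k, `|f k| <= `|g k|) ->
  gsummable g -> gsummable f.
Proof. by move=> /le_gnorm; exact: le_lt_trans. Qed.

Lemma gsummableD f g : gsummable f -> gsummable g -> gsummable (f \+ g).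
Proof.
move=> sf sg; apply: (@le_lt_trans _ _ (gnorm f + gnorm g)%E); last first.
  by rewrite lte_add_pinfty.
rewrite /gnorm -esumD; [|by move=> k _; rewrite lee_fin..].
by apply: le_esum => k _; rewrite -EFinD lee_fin; exact: ler_normD.
Qed.

Lemma esumZl c a : (forall k, 0 <= a k)%E -> 0 <= c ->
  (\esum_(k in [set: G]) (c%:E * a k) = c%:E * \esum_(k in [set: G]) a k)%E.
Proof.
move=> a0 c0; rewrite !esum_enum//; last by move=> k; rewrite mule_ge0.
rewrite -nneseriesZl; last by move=> n _; case: pickle_inv => /=.
by apply: eq_eseriesr => n _; case: pickle_inv => //=; rewrite mule0.
Qed.

Lemma gsummableZ c f : gsummable f -> gsummable (fun k => c * f k).
Proof.
move=> sf; rewrite /gsummable /gnorm.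
under eq_esum do rewrite normrM EFinM.
rewrite esumZl//; first by rewrite lte_mul_pinfty// ge0_fin_numE.
Qed.

Lemma gsum_esum f : gsummable f -> (forall k, 0 <= f k) ->
  ((gsum f)%:E = \esum_(k in [set: G]) (f k)%:E)%E.
Proof.
move=> sf f0; rewrite esum_enum; last by move=> k; rewrite lee_fin.
rewrite /gsum -EFin_lim; last exact: gsummable_cvg.
congr (lim (_ @ \oo)); apply/funext => n /=; rewrite /series/= -sumEFin.
by apply: eq_bigr => i _; rewrite /enum_fun; case: pickle_inv.
Qed.

Lemma gnormE f : (forall k, 0 <= f k) ->
  gnorm f = (\esum_(k in [set: G]) (f k)%:E)%E.
Proof. by move=> f0; apply: eq_esum => k _; rewrite ger0_norm. Qed.

Lemma enum_fun_norm f : (fun n => `|enum_fun f n|) = enum_fun (fun k => `|f k|).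
Proof.
by apply/funext => n; rewrite /enum_fun; case: pickle_inv => //=; rewrite normr0.
Qed.

Lemma gsummable_norm f : gsummable f -> gsummable (fun k => `|f k|).
Proof. by apply: le_gsummable => k; rewrite normr_id. Qed.

Lemma le_norm_gsum f : gsummable f -> `|gsum f| <= gsum (fun k => `|f k|).
Proof.
move=> sf; rewrite /gsum -enum_fun_norm; apply: lim_series_norm.
by move/gsummableP : sf.
Qed.

Lemma le_gsum f g : gsummable f -> gsummable g -> (forall k, f k <= g k) ->
  gsum f <= gsum g.
Proof.
move=> /gsummable_cvg sf /gsummable_cvg sg fg; apply: lim_series_le => //.
by move=> n; rewrite /enum_fun; case: pickle_inv => /=.
Qed.

Lemma gsum_single k0 c : gsum (fun k => if k == k0 then c else 0) = c.
Proof.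
apply/cvg_lim => //.
apply: (@cvg_near_cst _ _ _ _ _ _); exists (pickle k0).+1 => // n /= kn.
rewrite /series/= (bigD1_seq (pickle k0)) ?iota_uniq ?mem_iota//=; last first.
  by rewrite add0n subn0.
rewrite /enum_fun pickleK_inv /= eqxx big1 ?addr0// => i ik.
have := @pickle_invK G i; case: pickle_inv => //= k ki.
by case: eqP => // kk; move: ik; rewrite -ki kk eqxx.
Qed.

Lemma gsummable_single k0 c : gsummable (fun k => if k == k0 then c else 0).
Proof.
rewrite /gsummable /gnorm (esumID [set k0]); last by move=> k _; rewrite lee_fin.
rewrite [X in (_ + X)%E]esum1 ?adde0; last first.
  by move=> k [_ /eqP/negbTE /= ->]; rewrite normr0.
by rewrite setTI esum_set1 ?lee_fin// ltry.
Qed.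

(* Tannery's theorem *)
Lemma gsum_cvg {T : Type} (F : set_system T) {FF : Filter F}
    (f : G -> T -> R) (l A : G -> R) :
  gsummable A -> (forall k x, `|f k x| <= A k) ->
  (forall k, f k x @[x --> F] --> l k) ->
  gsum (f ^~ x) @[x --> F] --> gsum l.
Proof.
move=> sA fA fl.
have [FP|nF] := pselect (ProperFilter F); last first.
  have F0 : F set0.
    by apply: contrapT => nF0; apply: nF; split.
  by move=> P _; rewrite /nbhs/=; exact: (@filterS _ F FF set0 (_ @^-1` P)).
have lA k : `|l k| <= A k.
  have hl := @cvg_norm _ _ _ F FF _ _ (fl k).
  rewrite -(cvg_lim (@Rhausdorff R) hl); apply: limr_le; first exact: cvgP hl.
  by apply: nearW => x; exact: fA.
have A0 k : 0 <= A k by rewrite (le_trans _ (lA k)).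
have sf x : gsummable (f ^~ x).
  by apply: le_gsummable sA => k; rewrite (ger0_norm (A0 k)).
have sl : gsummable l.
  by apply: le_gsummable sA => k; rewrite (ger0_norm (A0 k)).
have tail (g : G -> R) N : gsummable g -> (forall k, `|g k| <= A k) ->
    `|gsum g - series (enum_fun g) N| <=
    gsum A - series (enum_fun A) N.
  move=> sg gA.
  have gc := gsummable_cvg sg; have Ac := gsummable_cvg sA.
  have h1 : `|series (enum_fun g) n - series (enum_fun g) N| @[n --> \oo] -->
      `|gsum g - series (enum_fun g) N|.
    by apply: cvg_norm; apply: cvgB; [exact: gc|exact: cvg_cst].
  have h2 : series (enum_fun A) n - series (enum_fun A) N @[n --> \oo] -->
      gsum A - series (enum_fun A) N.
    by apply: cvgB; [exact: Ac|exact: cvg_cst].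
  rewrite -(cvg_lim _ h1)// -(cvg_lim _ h2)//.
  apply: ler_lim; [exact: cvgP h1|exact: cvgP h2|].
  exists N => // n /= Nn; rewrite !sub_series Nn.
  apply: le_trans (ler_norm_sum _ _ _) _; apply: ler_sum => i _.
  by rewrite /enum_fun; case: pickle_inv => //=; rewrite normr0.
apply/cvgrPdist_lt => e e0.
have e3 : 0 < e / 3 by rewrite divr_gt0.
have Ac := gsummable_cvg sA.
have /cvgrPdist_lt/(_ _ e3)[N _ /(_ N (leqnn N)) HN] := Ac.
have {}HN : gsum A - series (enum_fun A) N < e / 3.
  exact: le_lt_trans (ler_norm _) HN.
have : series (enum_fun (f ^~ x)) N @[x --> F] --> series (enum_fun l) N.
  rewrite /series/=; apply: cvg_big_sum => i.
  by rewrite /enum_fun; case: pickle_inv => /= [k|]; [exact: fl|exact: cvg_cst].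
move=> /cvgrPdist_lt/(_ _ e3); apply: filterS => x fx.
have h1 := tail _ N sl lA.
have h2 := tail _ N (sf x) (fA ^~ x).
rewrite (_ : gsum l - gsum (f ^~ x) = (gsum l - series (enum_fun l) N) +
  (series (enum_fun l) N - series (enum_fun (f ^~ x)) N) -
  (gsum (f ^~ x) - series (enum_fun (f ^~ x)) N)); last by ring.
apply: le_lt_trans (ler_normB _ _) _.
apply: (@le_lt_trans _ _ (`|gsum l - series (enum_fun l) N| +
  `|series (enum_fun l) N - series (enum_fun (f ^~ x)) N| +
  `|gsum (f ^~ x) - series (enum_fun (f ^~ x)) N|)).
  by rewrite lerD2r ler_normD.
lra.
Qed.

End countable_sums.

(** * Integration over the torus *)

Section bounded_measurable.
Context d (T : measurableType d) {R : realType}.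
Implicit Types f g : T -> R.

(** Boundedness is asked everywhere rather than almost everywhere: the class is then stable under
    products, powers and sections, and for finite measures it gives integrability and Fubini with no
    further side condition. *)
Definition bm f := measurable_fun [set: T] f /\ exists M : R, forall x, `|f x| <= M.

Lemma bm_cst c : bm (cst c).
Proof. by split; [exact: measurable_cst|exists `|c|]. Qed.

Lemma bmD f g : bm f -> bm g -> bm (f \+ g).
Proof.
move=> [mf [M fM]] [mg [N gN]]; split; first exact: measurable_funD.
by exists (M + N) => x /=; apply: le_trans (ler_normD _ _) _; exact: lerD.
Qed.

Lemma bmN f : bm f -> bm (fun x => - f x).
Proof.
move=> [mf [M fM]]; split; first exact: measurableT_comp.
by exists M => x; rewrite normrN.
Qed.

Lemma bmB f g : bm f -> bm g -> bm (f \- g).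
Proof. by move=> bf bg; apply: bmD => //; exact: bmN. Qed.

Lemma bmM f g : bm f -> bm g -> bm (f \* g).
Proof.
move=> [mf [M fM]] [mg [N gN]]; split; first exact: measurable_funM.
by exists (M * N) => x /=; rewrite normrM; exact: ler_pM.
Qed.

Lemma bmZ c f : bm f -> bm (fun x => c * f x).
Proof. by move=> bf; exact: (bmM (bm_cst c) bf). Qed.

Lemma bmX f n : bm f -> bm (fun x => f x ^+ n).
Proof.
move=> bf; elim: n => [|n IH]; first exact: bm_cst.
rewrite (_ : (fun x => _) = f \* (fun x => f x ^+ n)); first exact: bmM.
by apply/funext => x; rewrite exprS.
Qed.

Lemma bm_sum (I : Type) (r : seq I) (F : I -> T -> R) :
  (forall i, bm (F i)) -> bm (fun x => \sum_(i <- r) F i x).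
Proof.
move=> bF; elim: r => [|i r IH].
  rewrite (_ : (fun x => _) = cst 0); first exact: bm_cst.
  by apply/funext => x; rewrite big_nil.
rewrite (_ : (fun x => _) = F i \+ (fun x => \sum_(i <- r) F i x)).
  exact: bmD.
by apply/funext => x; rewrite big_cons.
Qed.

End bounded_measurable.

Section finite_integral.
Context d (T : measurableType d) {R : realType}.
Variable mu : {finite_measure set T -> \bar R}.
Implicit Types f g : T -> R.

Definition itg f := mu.-integrable [set: T] (EFin \o f).

Lemma bm_itg f : bm f -> itg f.
Proof.
move=> [mf [M fM]]; apply: measurable_bounded_integrable => //.
  by rewrite ltey_eq fin_num_measure.
exists M; split; first exact: num_real.
by move=> y My x _; exact: le_trans (fM x) (ltW My).
Qed.

Lemma itg_meas f : itg f -> measurable_fun setT f.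
Proof. by move=> /integrableP[/measurable_EFinP]. Qed.

Lemma itgD f g : itg f -> itg g -> itg (f \+ g).
Proof. by move=> itf itg; apply: eq_integrable (integrableD _ itf itg). Qed.

Lemma itgB f g : itg f -> itg g -> itg (f \- g).
Proof. by move=> itf itg; apply: eq_integrable (integrableB _ itf itg). Qed.

Lemma itgM f g : itg f -> bm g -> itg (f \* g).
Proof.
move=> itf [mg [M gM]].
apply: (eq_integrable measurableT (fun x => (f x)%:E * (g x)%:E)%E) => //.
apply: integrableMl => //; exists M; split; first exact: num_real.
by move=> y My x _; exact: le_trans (gM x) (ltW My).
Qed.

Lemma RintD f g : itg f -> itg g ->
  \int[mu]_x (f x + g x) = \int[mu]_x f x + \int[mu]_x g x.
Proof. by move=> itf itg; rewrite RintegralD. Qed.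

Lemma RintB f g : itg f -> itg g ->
  \int[mu]_x (f x - g x) = \int[mu]_x f x - \int[mu]_x g x.
Proof. by move=> itf itg; rewrite RintegralB. Qed.

Lemma RintZ c f : itg f -> \int[mu]_x (c * f x) = c * \int[mu]_x f x.
Proof. by move=> itf; rewrite RintegralZl. Qed.

Lemma le_Rint f g : itg f -> itg g -> (forall x, f x <= g x) ->
  \int[mu]_x f x <= \int[mu]_x g x.
Proof. by move=> itf itg fg; apply: le_Rintegral. Qed.

Lemma norm_Rint f : itg f -> `|\int[mu]_x f x| <= \int[mu]_x `|f x|.
Proof. by move=> itf; apply: le_normr_Rintegral. Qed.

Lemma norm_Rint_le f M : measurable_fun setT f -> (forall x, `|f x| <= M) ->
  `|\int[mu]_x f x| <= M * fine (mu setT).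
Proof.
move=> mf fM; have bf : bm f by split => //; exists M.
apply: le_trans (norm_Rint (bm_itg bf)) _.
rewrite -Rintegral_cst//; apply: le_Rint => //.
- by apply: bm_itg; split; [exact: measurableT_comp|exists M => x; rewrite normr_id].
- exact: bm_itg (bm_cst _ _).
Qed.

Lemma Rint_dominated (f_ : nat -> T -> R) f (g : T -> R) :
  (forall n, measurable_fun setT (f_ n)) -> itg g ->
  (forall n x, `|f_ n x| <= g x) -> (forall x, f_ n x @[n --> \oo] --> f x) ->
  \int[mu]_x f_ n x @[n --> \oo] --> \int[mu]_x f x.
Proof.
move=> mf_ itg_g fg ff.
have mf : measurable_fun setT f.
  by apply: (@measurable_fun_cvg _ _ _ _ f_) => // x _; exact: ff.
have ffE x : (EFin \o f_^~ x) n @[n --> \oo] --> (f x)%:E.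
  by apply: cvg_EFin; [exact: nearW|exact: ff].
have mE (h : T -> R) : measurable_fun setT h -> measurable_fun setT (EFin \o h).
  by move=> mh; exact/measurable_EFinP.
have [itf _ h] := @dominated_convergence _ _ _ mu setT measurableT
  (fun n => EFin \o f_ n) (EFin \o f) (EFin \o g)
  (fun n => mE _ (mf_ n)) (mE _ mf)
  (aeW _ (fun x _ => ffE x)) itg_g (aeW _ (fun x n _ => fg n x)).
rewrite /Rintegral; apply: fine_cvg => /=.
by rewrite fineK//; exact: integrable_fin_num.
Qed.

End finite_integral.

Section fubini_bounded.
Context d1 d2 (T1 : measurableType d1) (T2 : measurableType d2) {R : realType}.
Variables (m1 : {finite_measure set T1 -> \bar R})
          (m2 : {finite_measure set T2 -> \bar R}).
Implicit Types f : T1 * T2 -> R.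

Lemma finite_prod_itg f : bm f -> (m1 \x m2)%E.-integrable setT (EFin \o f).
Proof.
move=> [mf [M fM]]; apply: measurable_bounded_integrable => //.
  apply: (@le_lt_trans _ _ ((m1 \x m2)%E (setT `*` setT))).
    by rewrite setXTT.
  rewrite product_measure1E// lte_mul_pinfty//.
    by rewrite fin_num_measure.
  by rewrite ltey_eq fin_num_measure.
exists M; split; first exact: num_real.
by move=> y My x _; exact: le_trans (fM x) (ltW My).
Qed.

Lemma bm_section1 f x : bm f -> bm (fun y => f (x, y)).
Proof.
move=> [mf [M fM]]; split; last by exists M.
exact: measurableT_comp.
Qed.

Lemma bm_section2 f y : bm f -> bm (fun x => f (x, y)).
Proof.
move=> [mf [M fM]]; split; last by exists M.
exact: measurableT_comp.
Qed.

Let inner1 f : bm f ->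
  (fun x => (\int[m2]_y f (x, y))%:E) = (fun x => \int[m2]_y (f (x, y))%:E)%E.
Proof.
move=> bf; apply/funext => x; rewrite /Rintegral fineK//.
by apply: integrable_fin_num => //; apply: bm_itg; exact: bm_section1.
Qed.

Let inner2 f : bm f ->
  (fun y => (\int[m1]_x f (x, y))%:E) = (fun y => \int[m1]_x (f (x, y))%:E)%E.
Proof.
move=> bf; apply/funext => x; rewrite /Rintegral fineK//.
by apply: integrable_fin_num => //; apply: bm_itg; exact: bm_section2.
Qed.

Lemma Rint_prod1 f : bm f ->
  fine (\int[(m1 \x m2)%E]_z (f z)%:E)%E = \int[m1]_x (\int[m2]_y f (x, y)).
Proof.
move=> bf; rewrite -(integral12_prod_meas1 (finite_prod_itg bf))/=.
by rewrite /fubini_F/= [in RHS]/Rintegral (inner1 bf).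
Qed.

Lemma Rint_prod2 f : bm f ->
  fine (\int[(m1 \x m2)%E]_z (f z)%:E)%E = \int[m2]_y (\int[m1]_x f (x, y)).
Proof.
move=> bf; rewrite -(integral21_prod_meas1 (finite_prod_itg bf))/=.
by rewrite /fubini_G/= [in RHS]/Rintegral (inner2 bf).
Qed.

Lemma Rint_swap f : bm f ->
  \int[m1]_x (\int[m2]_y f (x, y)) = \int[m2]_y (\int[m1]_x f (x, y)).
Proof. by move=> bf; rewrite -Rint_prod1// Rint_prod2. Qed.

Lemma bm_Rint1 f : bm f -> bm (fun x => \int[m2]_y f (x, y)).
Proof.
move=> bf; split.
  apply/measurable_EFinP; rewrite /comp (inner1 bf).
  exact: (measurable_fubini_F (finite_prod_itg bf)).
have [mf [M fM]] := bf.
exists (M * fine (m2 setT)) => x; apply: norm_Rint_le => //.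
by have [] := bm_section1 x bf.
Qed.

End fubini_bounded.

Section integral_restriction.
Context d (T : measurableType d) {R : realType}.
Variables (mu : {measure set T -> \bar R}) (D : set T) (mD : measurable D).
Local Open Scope ereal_scope.

(** The complement of [D] is null for the restricted measure, and on subsets of [D] the two measures
    agree. *)
Lemma ge0_integral_mrestr (f : T -> \bar R) : measurable_fun setT f ->
  (forall x, 0 <= f x) ->
  \int[mrestr mu mD]_x f x = \int[mu]_(x in D) f x.
Proof.
move=> mf f0.
rewrite (ge0_negligible_integral (measurableC mD) measurableT) //; last first.
- by rewrite /= /mrestr setICl measure0.
rewrite setTD setCK; apply: eq_measure_integral => A mA AD.
by rewrite /= /mrestr (setIidl AD).
Qed.

Lemma integral_mrestr (f : T -> \bar R) : measurable_fun setT f ->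
  \int[mrestr mu mD]_x f x = \int[mu]_(x in D) f x.
Proof.
move=> mf; rewrite [LHS]integralE [RHS]integralE !ge0_integral_mrestr//.
  exact: measurable_funeneg.
exact: measurable_funepos.
Qed.

End integral_restriction.

Section torus_integral.
Context {R : realType}.
Local Notation mu := lebesgue_measure.
Local Notation circle := (@circle_measure R).

Lemma Rint_circle (f : R -> R) : measurable_fun [set: measurableTypeR R] f ->
  \int[circle]_x f x = \int[mu]_(x in `[- pi, pi]) f x.
Proof.
move=> mf; congr fine; apply: integral_mrestr.
exact/measurable_EFinP.
Qed.

Lemma pi2_gt0 : 0 < 2 * pi :> R.
Proof. by rewrite mulr_gt0// pi_gt0. Qed.

Lemma Npi_lt_pi : - pi < pi :> R.
Proof. by have := pi_gt0 R; lra. Qed.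

Lemma circleT : circle setT = (2 * pi)%:E.
Proof.
rewrite /circle_measure /mrestr setTI lebesgue_measure_itv/= lte_fin Npi_lt_pi.
by rewrite -EFinB; congr EFin; ring.
Qed.

Lemma torusT d : torus d setT = ((2 * pi) ^+ d)%:E :> \bar R.
Proof.
elim: d => [|d IH]; first by rewrite /= diracE in_setT expr0.
rewrite /= /torus_step /pushforward preimage_setT -setXTT product_measure1E//.
by rewrite exprS EFinM; congr (_ * _)%E; [exact: circleT|exact: IH].
Qed.

Lemma bm_consrV n (f : 'rV[R]_n.+1 -> R) : bm f -> bm (f \o @consrV R n).
Proof.
move=> [mf [M fM]]; split; last by exists M => x; exact: fM.
by apply: measurableT_comp => //; exact: measurable_consrV.
Qed.

Lemma integral_torusS n (f : 'rV[R]_n.+1 -> \bar R) :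
  measurable_fun setT f ->
  (\int[torus n.+1]_x f x =
   \int[(circle \x torus n)]_z f (consrV z))%E.
Proof.
move=> mf.
have ge0 (g : 'rV[R]_n.+1 -> \bar R) : measurable_fun setT g ->
    (forall x, 0 <= g x)%E -> (\int[torus n.+1]_x g x =
   \int[(circle \x torus n)]_z g (consrV z))%E.
  move=> mg g0.
  have := @ge0_integral_pushforward _ _ _ _ R _ (@measurable_consrV R n)
    (circle \x torus n)%E setT g measurableT mg (fun x _ => g0 x).
  rewrite preimage_setT => E; apply: etrans E.
  by apply: eq_measure_integral => [|? ? ? _]; [exact: measurable_consrV|].
rewrite [LHS]integralE [RHS]integralE !ge0//; first 1 last.
- exact: measurable_funeneg.
- exact: measurable_funepos.
by congr (_ - _)%E; apply: eq_integral => z _; rewrite ?funeposE ?funenegE.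
Qed.

Lemma Rint_torusS n (f : 'rV[R]_n.+1 -> R) : bm f ->
  \int[torus n.+1]_x f x =
  \int[circle]_a (\int[torus n]_x f (consrV (a, x))).
Proof.
move=> bf; rewrite -(Rint_prod1 _ _ (bm_consrV bf)).
rewrite {1}/Rintegral integral_torusS//; apply/measurable_EFinP.
by have [] := bf.
Qed.

Lemma Rint_torusS' n (f : 'rV[R]_n.+1 -> R) : bm f ->
  \int[torus n.+1]_x f x =
  \int[torus n]_x (\int[circle]_a f (consrV (a, x))).
Proof.
move=> bf; rewrite Rint_torusS//.
exact: (Rint_swap _ _ (bm_consrV bf)).
Qed.

End torus_integral.

(** * Integrals of sines and cosines over one period *)

Section calculus.
Context {R : realType}.
Local Notation mu := (@lebesgue_measure R).

Lemma Rint_FTC2 (F f : R -> R) (a b : R) : a <= b -> continuous F -> continuous f ->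
  (forall x, a < x < b -> derivable F x 1 /\ 'D_1 F x = f x) ->
  \int[mu]_(x in `[a, b]) f x = F b - F a.
Proof.
rewrite le_eqVlt => /predU1P[<- _ _ _|ab cF cf dF].
  by rewrite subrr set_itv1 Rintegral_set1.
rewrite /Rintegral (@continuous_FTC2 _ _ F) //.
- exact: continuous_subspaceT.
- split.
  + by move=> x; rewrite in_itv/= => xab; have [] := dF x xab.
  + by apply: cvg_at_right_filter; exact: cF.
  + by apply: cvg_at_left_filter; exact: cF.
- by move=> x; rewrite in_itv/= => xab; rewrite derive1E; have [] := dF x xab.
Qed.

Lemma sin_intpi (m : int) : sin (m%:~R * pi) = 0 :> R.
Proof.
have nat_pi (n : nat) : sin (n%:R * pi) = 0 :> R.
  have := alternatingn (@sinDpi R) n 0; rewrite add0r sin0 mulr0 => <-.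
  by rewrite mulr_natl.
case: m => n; first exact: nat_pi.
by rewrite NegzE mulrNz mulNr sinN nat_pi oppr0.
Qed.

Lemma continuous_scale (m : R) : continuous (fun a : R => m * a).
Proof. by move=> x; apply: cvgM; [exact: cvg_cst|exact: cvg_id]. Qed.

Lemma continuous_cos_scale (m : R) : continuous (fun a : R => cos (m * a)).
Proof.
by move=> x; apply: continuous_comp; [exact: continuous_scale|exact: continuous_cos].
Qed.

Lemma continuous_sin_scale (m : R) : continuous (fun a : R => sin (m * a)).
Proof.
by move=> x; apply: continuous_comp; [exact: continuous_scale|exact: continuous_sin].
Qed.

Lemma Rint_cos_int (m : int) :
  \int[mu]_(a in `[- pi, pi]) cos (m%:~R * a) = if m == 0 then 2 * pi else 0.
Proof.
case: eqP => [->|/eqP m0].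
  under eq_Rintegral do rewrite mul0r cos0.
  rewrite (@Rint_FTC2 id (cst 1)); [ring|exact/ltW/Npi_lt_pi|..].
  - by move=> x; exact: cvg_id.
  - exact: cst_continuous.
  - by move=> x _; split; [exact: derivable_id|exact: derive_id].
have m0' : m%:~R != 0 :> R by rewrite intr_eq0.
rewrite (@Rint_FTC2 (fun a => m%:~R^-1 * sin (m%:~R * a))).
- by rewrite mulrN sinN sin_intpi; ring.
- exact/ltW/Npi_lt_pi.
- by move=> x; apply: cvgM; [exact: cvg_cst|exact: continuous_sin_scale].
- exact: continuous_cos_scale.
- move=> x _; have h : is_derive x (1 : R) (fun a => m%:~R^-1 * sin (m%:~R * a))
    (cos (m%:~R * x)).
    by apply: is_derive_eq; rewrite /GRing.scale/=; field.
  by split; [exact: ex_derive|exact: derive_val].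
Qed.

Lemma Rint_sin_int (m : int) :
  \int[mu]_(a in `[- pi, pi]) sin (m%:~R * a) = 0.
Proof.
have [->|m0] := eqVneq m 0.
  by under eq_Rintegral do rewrite mul0r sin0; rewrite /Rintegral integral0.
have m0' : m%:~R != 0 :> R by rewrite intr_eq0.
rewrite (@Rint_FTC2 (fun a => - (m%:~R^-1 * cos (m%:~R * a)))).
- by rewrite mulrN cosN; ring.
- exact/ltW/Npi_lt_pi.
- by move=> x; apply: cvgN; apply: cvgM; [exact: cvg_cst|exact: continuous_cos_scale].
- exact: continuous_sin_scale.
- move=> x _; have h : is_derive x (1 : R)
      (fun a => - (m%:~R^-1 * cos (m%:~R * a))) (sin (m%:~R * x)).
    by apply: is_derive_eq; rewrite /GRing.scale/=; field.
  by split; [exact: ex_derive|exact: derive_val].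
Qed.

End calculus.

(** * Measurability of continuous functions of several variables *)

Section grid_measurability.
Context {R : realType}.

(** The sigma-algebra on row vectors is generated by coordinates, not by open sets. Rounding the
    argument to a grid makes the function factor through a countable type, hence measurable whatever
    [f] is, and continuity recovers [f] as the grid is refined. *)
Lemma measurable_grid_limit d (T : measurableType d) (K : countType)
    (h : nat -> T -> K) (g : nat -> K -> T) (f : T -> R) :
  (forall n k, measurable (h n @^-1` [set k])) ->
  (forall x, f (g n (h n x)) @[n --> \oo] --> f x) ->
  measurable_fun setT f.
Proof.
move=> mh fl; apply: (@measurable_fun_cvg _ _ _ _ (fun n x => f (g n (h n x)))).
  move=> n _ Y mY; rewrite setTI.
  have -> : (fun x => f (g n (h n x))) @^-1` Y =
      \bigcup_(k in [set k | Y (f (g n k))]) (h n @^-1` [set k]).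
    apply/seteqP; split => x /=; first by move=> Yx; exists (h n x).
    by move=> [k /= Yk hk]; rewrite hk.
  rewrite bigcup_mkcond; apply: countable_bigcupT_measurable => [|k].
    exact: countableP.
  by case: ifP.
by move=> x _; exact: fl.
Qed.

Definition floor_grid d (n : nat) (x : 'rV[R]_d) : 'rV[int]_d :=
  \row_i Num.floor (n.+1%:R * x ord0 i).

Definition grid_point d (n : nat) (k : 'rV[int]_d) : 'rV[R]_d :=
  \row_i ((k ord0 i)%:~R / n.+1%:R).

Lemma measurable_floor (n : nat) (m : int) :
  measurable [set y : measurableTypeR R | Num.floor (n.+1%:R * y) = m].
Proof.
rewrite (_ : [set y | _] = `[m%:~R / n.+1%:R, (m + 1)%:~R / n.+1%:R[%classic).
  exact: measurable_itv.
apply/seteqP; split => y /=; rewrite in_itv/= ler_pdivrMr// ltr_pdivlMr//.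
  by move=> /eqP; rewrite floor_eq mulrC.
by rewrite mulrC => h; apply/eqP; rewrite floor_eq.
Qed.

Lemma measurable_floor_grid d (n : nat) (k : 'rV[int]_d) :
  measurable (@floor_grid d n @^-1` [set k]).
Proof.
have -> : @floor_grid d n @^-1` [set k] =
    \bigcap_(i in [set: 'I_d]) ((fun x : 'rV[R]_d => x ord0 i) @^-1`
      [set y | Num.floor (n.+1%:R * y) = k ord0 i]).
  apply/seteqP; split => x /=.
    by move=> <- i _ /=; rewrite mxE.
  by move=> h; apply/rowP => i; rewrite mxE; exact: h.
apply: fin_bigcap_measurable => // i _.
rewrite -[X in measurable X]setTI.
by apply: measurable_rV_coord => //; exact: measurable_floor.
Qed.

Lemma grid_dist (n : nat) (y : R) :
  `|y - (Num.floor (n.+1%:R * y))%:~R / n.+1%:R| <= n.+1%:R^-1.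
Proof.
have /andP[h1 h2] := floor_itv (n.+1%:R * y).
have n0 : 0 < n.+1%:R :> R by rewrite ltr0n.
move: h1 h2; rewrite intrD; move: (Num.floor _)%:~R => q h1 h2.
rewrite -(ler_pM2l n0) -{1}(gtr0_norm n0) -normrM mulfV ?gt_eqF//.
rewrite (_ : _ * _ = n.+1%:R * y - q); last by field; rewrite gt_eqF.
by rewrite ger0_norm ?subr_ge0//; lra.
Qed.

Lemma grid_point_cvg d (x : 'rV[R]_d) :
  grid_point n (floor_grid n x) @[n --> \oo] --> x.
Proof.
apply/cvgrPdist_le => e e0.
have : n.+1%:R^-1 @[n --> \oo] --> (0 : R) by exact: cvg_harmonic.
move=> /cvgrPdist_le /(_ e e0); apply: filterS => n.
rewrite sub0r normrN ger0_norm ?invr_ge0// => ne.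
rewrite [leLHS]mx_normrE; apply/bigmax_leP; split => [|i _]; first exact: ltW.
rewrite !mxE ord1; apply: le_trans ne.
exact: grid_dist.
Qed.

Lemma continuous_rV_measurable d (f : 'rV[R]_d -> R) :
  continuous f -> measurable_fun setT f.
Proof.
move=> cf; apply: (@measurable_grid_limit _ _ _ (@floor_grid d) (@grid_point d)).
  exact: measurable_floor_grid.
move=> x; apply: (@cvg_comp _ _ _ (fun n => grid_point n (floor_grid n x)) f _
  (nbhs x)); [exact: grid_point_cvg|exact: cf].
Qed.

Lemma continuous_prod_measurable d (f : R * 'rV[R]_d -> R) :
  continuous f ->
  measurable_fun [set: measurableTypeR R * 'rV[R]_d] f.
Proof.
move=> cf; apply: (@measurable_grid_limit _ (measurableTypeR R * 'rV[R]_d)%type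
  (int * 'rV[int]_d)%type
  (fun n z => (Num.floor (n.+1%:R * (z.1 : R)), floor_grid n z.2))
  (fun n k => (k.1%:~R / n.+1%:R, grid_point n k.2))).
  move=> n [a b].
  rewrite (_ : _ @^-1` _ =
    [set y | Num.floor (n.+1%:R * y) = a] `*` (@floor_grid d n @^-1` [set b])).
    by apply: measurableX; [exact: measurable_floor|exact: measurable_floor_grid].
  by apply/seteqP; split => -[y z] /=; [move=> [-> ->]|move=> [-> ->]].
suff H (y : R) (z : 'rV[R]_d) :
    f ((Num.floor (n.+1%:R * y))%:~R / n.+1%:R, grid_point n (floor_grid n z))
    @[n --> \oo] --> f (y, z) by move=> [y z]; exact: H.
apply: (@cvg_comp _ _ _ (fun n => ((Num.floor (n.+1%:R * y))%:~R / n.+1%:R,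
    grid_point n (floor_grid n z))) f _ (nbhs (y, z))); last exact: cf.
suff h1 : (Num.floor (n.+1%:R * y))%:~R / n.+1%:R @[n --> \oo] --> y.
  exact: (cvg_pair h1 (@grid_point_cvg _ z)).
apply/cvgrPdist_le => e e0.
have : n.+1%:R^-1 @[n --> \oo] --> (0 : R) by exact: cvg_harmonic.
move=> /cvgrPdist_le /(_ e e0); apply: filterS => n.
rewrite sub0r normrN ger0_norm ?invr_ge0// => ne.
exact: le_trans (grid_dist n y) ne.
Qed.

End grid_measurability.

Section integral_of_gsum.
Context {R : realType} {G : countType} d (T : measurableType d).
Variable mu : {finite_measure set T -> \bar R}.

Lemma measurable_gsum (F : G -> T -> R) : (forall k, measurable_fun setT (F k)) ->
  (forall x, gsummable (F ^~ x)) -> measurable_fun setT (fun x => gsum (F ^~ x)).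
Proof.
move=> mF sF.
apply: (@measurable_fun_cvg _ _ _ _ (fun n x => series (enum_fun (F ^~ x)) n)).
  move=> n; rewrite /series/=; apply: measurable_sum => i.
  by rewrite /enum_fun; case: pickle_inv => /=.
by move=> x _; exact: gsummable_cvg.
Qed.

Lemma le_series_gsum (A : G -> R) n : gsummable A -> (forall k, 0 <= A k) ->
  series (enum_fun A) n <= gsum A.
Proof.
move=> sA A0; apply: nondecreasing_cvgn_le; last exact: gsummable_cvg.
apply: nondecreasing_series => i _ _.
by rewrite /enum_fun; case: pickle_inv => /=.
Qed.

(** Dominated convergence for the partial sums, with [gsum A] times |h| as dominating function. The
    factor [h] may be unbounded, which allows testing a series against a merely integrable
    function. *)
Lemma Rint_gsum (F : G -> T -> R) (A : G -> R) (h : T -> R) :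
  (forall k, measurable_fun setT (F k)) -> itg mu h ->
  gsummable A -> (forall k x, `|F k x| <= A k) ->
  \int[mu]_x (gsum (F ^~ x) * h x) = gsum (fun k => \int[mu]_x (F k x * h x)).
Proof.
move=> mF ith sA FA.
have A0 k : 0 <= A k by apply: le_trans (FA k point).
have sF x : gsummable (F ^~ x).
  by apply: le_gsummable sA => k; rewrite (ger0_norm (A0 k)).
have bF k : bm (F k) by split => //; exists (A k).
have itFh k : itg mu (fun x => F k x * h x).
  apply: (@eq_integrable _ _ _ mu setT measurableT (EFin \o (h \* F k))).
    by move=> x _ /=; rewrite mulrC.
  exact: itgM.
pose S n x := series (enum_fun (F ^~ x)) n * h x.
have SE n : \int[mu]_x S n x = series (enum_fun (fun k => \int[mu]_x (F k x * h x))) n.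
  have SE' x : S n x = \sum_(0 <= i < n) (enum_fun (F ^~ x) i * h x).
    by rewrite /S /series/= mulr_suml.
  under eq_Rintegral do rewrite SE'.
  rewrite /series/=; elim: n {SE'} => [|n IH].
    rewrite big_nil; under eq_Rintegral do rewrite big_nil.
    by rewrite /Rintegral integral0.
  rewrite big_nat_recr//= -IH; under eq_Rintegral do rewrite big_nat_recr//=.
  have iti i : itg mu (fun x => enum_fun (F^~ x) i * h x).
    rewrite /enum_fun; case: pickle_inv => [k|] /=; first exact: itFh.
    under eq_fun do rewrite mul0r.
    exact: integrable0.
  rewrite RintD.
  - congr (_ + _); rewrite /enum_fun; case: pickle_inv => //=.
    by under eq_Rintegral do rewrite mul0r; rewrite /Rintegral integral0.
  - elim: n {IH} => [|n IH].
      under eq_fun do rewrite big_nil; exact: integrable0.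
    under eq_fun do rewrite big_nat_recr//=; exact: itgD.
  - exact: iti.
apply/esym; rewrite /gsum; apply/cvg_lim; first exact: Rhausdorff.
rewrite (_ : series _ = fun n => \int[mu]_x S n x); last by apply/funext.
apply: (@Rint_dominated _ _ _ _ _ _ (fun x => gsum A * `|h x|)).
- move=> n; apply: measurable_funM; last exact: itg_meas ith.
  rewrite /series/=; apply: measurable_sum => i.
  by rewrite /enum_fun; case: pickle_inv => /=.
- have : itg mu (fun x => `|h x|) by exact: integrable_norm.
  by move=> /(@itgM _ _ _ _ _ _)/(_ (bm_cst _ (gsum A))); apply: eq_integrable => //= x _; rewrite mulrC.
- move=> n x; rewrite normrM ler_wpM2r//.
  apply: le_trans (le_series_gsum n sA A0).
  rewrite /series/=; apply: le_trans (ler_norm_sum _ _ _) _.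
  apply: ler_sum => i _; rewrite /enum_fun; case: pickle_inv => //=.
  by rewrite normr0.
- by move=> x; apply: cvgM; [exact: gsummable_cvg|exact: cvg_cst].
Qed.

End integral_of_gsum.

(** * Fourier coefficients and the Wiener algebra *)

Section plane_norm.
Context {R : realType}.

(** The modulus of a complex number kept as a real pair: a Fourier coefficient of a real function is
    handled through its cosine and sine parts. *)
Definition nrm2 (x y : R) : R := Num.sqrt (x ^+ 2 + y ^+ 2).

Lemma nrm2_ge0 x y : 0 <= nrm2 x y. Proof. exact: sqrtr_ge0. Qed.

Lemma sqr_nrm2 x y : nrm2 x y ^+ 2 = x ^+ 2 + y ^+ 2.
Proof. by rewrite sqr_sqrtr// addr_ge0// sqr_ge0. Qed.

Lemma le_nrm2 a b x y : a ^+ 2 + b ^+ 2 = 1 -> a * x + b * y <= nrm2 x y.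
Proof.
move=> ab; apply: (le_trans (ler_norm _)).
rewrite -(ler_pXn2r (n := 2))// ?nnegrE ?nrm2_ge0// sqr_nrm2 real_normK ?num_real//.
(* Lagrange's identity: this square is exactly the gap between the two sides. *)
by have := sqr_ge0 (a * y - b * x); nra.
Qed.

(** The modulus is attained along a unit vector, so an estimate for all real combinations a x + b y
    is an estimate for the modulus. Triangle, convolution and Duhamel inequalities are all reduced
    to linear ones in this way. *)
Lemma nrm2_dual x y :
  exists a b, a ^+ 2 + b ^+ 2 = 1 /\ nrm2 x y = a * x + b * y.
Proof.
have [n0|n0] := eqVneq (nrm2 x y) 0.
  have := sqr_nrm2 x y; rewrite n0 expr0n/= => /esym/eqP.
  rewrite paddr_eq0 ?sqr_ge0// !sqrf_eq0 => /andP[/eqP -> /eqP ->].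
  by exists 1, 0; split; ring.
exists (x / nrm2 x y), (y / nrm2 x y); split.
  by rewrite !exprMn !exprVn -mulrDl -sqr_nrm2 mulfV// sqrf_eq0.
rewrite mulrAC [y / _ * y]mulrAC -mulrDl -!expr2 -sqr_nrm2 expr2 mulfK//.
Qed.

Lemma nrm2_leP x y B :
  (forall a b, a ^+ 2 + b ^+ 2 = 1 -> a * x + b * y <= B) -> nrm2 x y <= B.
Proof. by move=> h; have [a [b [ab ->]]] := nrm2_dual x y; exact: h. Qed.

Lemma nrm2D x y z w : nrm2 (x + z) (y + w) <= nrm2 x y + nrm2 z w.
Proof.
apply: nrm2_leP => a b ab; rewrite !mulrDr addrACA.
by apply: lerD; exact: le_nrm2.
Qed.

Lemma nrm2Z c x y : nrm2 (c * x) (c * y) = `|c| * nrm2 x y.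
Proof.
rewrite /nrm2 !exprMn -mulrDr sqrtrM ?sqr_ge0// sqrtr_sqr //.
Qed.

Lemma nrm2N x y : nrm2 (- x) (- y) = nrm2 x y.
Proof. by rewrite /nrm2 !sqrrN. Qed.

Lemma nrm2_00 : nrm2 0 0 = 0.
Proof. by rewrite /nrm2 expr0n/= addr0 sqrtr0. Qed.

Lemma le_nrm2l x y : `|x| <= nrm2 x y.
Proof.
rewrite -(ler_pXn2r (n := 2))// ?nnegrE ?nrm2_ge0// sqr_nrm2 real_normK ?num_real//.
by rewrite lerDl sqr_ge0.
Qed.

Lemma le_nrm2r x y : `|y| <= nrm2 x y.
Proof.
rewrite -(ler_pXn2r (n := 2))// ?nnegrE ?nrm2_ge0// sqr_nrm2 real_normK ?num_real//.
by rewrite lerDr sqr_ge0.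
Qed.

Lemma nrm2_le_abs x y : nrm2 x y <= `|x| + `|y|.
Proof.
rewrite -[x]addr0 -[y in nrm2 _ y]add0r; apply: le_trans (nrm2D _ _ _ _) _.
rewrite addr0 /nrm2 expr0n/= addr0 add0r !sqrtr_sqr//.
Qed.

Lemma nrm2_cvg {T : Type} (F : set_system T) {FF : Filter F} (f g : T -> R) x y :
  f t @[t --> F] --> x -> g t @[t --> F] --> y ->
  nrm2 (f t) (g t) @[t --> F] --> nrm2 x y.
Proof.
move=> fx gy; apply: (@cvg_comp _ _ _ (fun t => f t ^+ 2 + g t ^+ 2) Num.sqrt _
  (nbhs (x ^+ 2 + y ^+ 2))); last exact: sqrt_continuous.
by under eq_fun do rewrite !expr2; apply: cvgD; apply: cvgM.
Qed.

End plane_norm.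

Section int_dot.
Context {R : realType} {d : nat}.
Implicit Types (k l : 'rV[int]_d) (x : 'rV[R]_d).

Lemma int_dotD k l x : int_dot (k + l) x = int_dot k x + int_dot l x.
Proof.
rewrite /int_dot -big_split/=; apply: eq_bigr => i _.
by rewrite mxE intrD mulrDl.
Qed.

Lemma int_dotN k x : int_dot (- k) x = - int_dot k x.
Proof.
rewrite /int_dot -sumrN; apply: eq_bigr => i _.
by rewrite mxE mulrNz mulNr.
Qed.

Lemma int_dot0 x : int_dot 0 x = 0.
Proof. by rewrite /int_dot big1// => i _; rewrite mxE mul0r. Qed.

Lemma measurable_int_dot k : measurable_fun setT (@int_dot R d k).
Proof.
apply: measurable_sum => i; apply: measurable_funM => //.
exact: measurable_rV_coord.
Qed.

Lemma bm_cos k : bm (fun x => cos (int_dot k x)).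
Proof.
split; last by exists 1 => x; exact: cos_max.
apply: (measurableT_comp (f := @cos R)); last exact: measurable_int_dot.
by apply: continuous_measurable_fun => x; exact: continuous_cos.
Qed.

Lemma bm_sin k : bm (fun x => sin (int_dot k x)).
Proof.
split; last by exists 1 => x; exact: sin_max.
apply: (measurableT_comp (f := @sin R)); last exact: measurable_int_dot.
by apply: continuous_measurable_fun => x; exact: continuous_sin.
Qed.

End int_dot.

Lemma int_dot_consrV {R : realType} n (k : 'rV[int]_n.+1) (a : R) (x : 'rV[R]_n) :
  int_dot k (consrV (a, x)) =
  (k ord0 ord0)%:~R * a + int_dot (\row_j k ord0 (lift ord0 j)) x.
Proof.
rewrite /int_dot big_ord_recl mxE unlift_none; congr (_ + _).
by apply: eq_bigr => i _; rewrite !mxE liftK.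
Qed.

(** * Averages and orthogonality of the trigonometric system *)

Section average.
Context {R : realType}.

Definition avg {d} (f : 'rV[R]_d -> R) : R := (2 * pi) ^- d * \int[torus d]_x f x.

Lemma volume_gt0 d : 0 < (2 * pi : R) ^+ d.
Proof. by rewrite exprn_gt0// pi2_gt0. Qed.

Lemma eq_avg d (f g : 'rV[R]_d -> R) : f =1 g -> avg f = avg g.
Proof. by move=> /funext ->. Qed.

Lemma avg_cst d (c : R) : avg (fun _ : 'rV[R]_d => c) = c.
Proof.
rewrite /avg Rintegral_cst//= [X in fine X](_ : _ = ((2 * pi) ^+ d)%:E); last exact: torusT.
by rewrite /= mulrCA mulVf ?mulr1// gt_eqF ?volume_gt0.
Qed.

(** Induction on the dimension: the addition formulas separate the first coordinate from the others,
    and its integral over the circle vanishes unless its frequency is 0. Cosine and sine go together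
    because each addition formula involves both. *)
Lemma avg_trig d (k : 'rV[int]_d) :
  avg (fun x => cos (int_dot k x)) = (k == 0)%:R /\
  avg (fun x => sin (int_dot k x)) = 0.
Proof.
elim: d k => [|d IH] k.
  have -> : k = 0 by apply/rowP; case.
  rewrite eqxx; split.
    by under eq_avg do rewrite int_dot0 cos0; rewrite avg_cst.
  by under eq_avg do rewrite int_dot0 sin0; rewrite avg_cst.
pose k0 := k ord0 ord0; pose k' : 'rV[int]_d := \row_j k ord0 (lift ord0 j).
have [IHc IHs] := IH k'.
have unavg (f : 'rV[R]_d -> R) : \int[torus d]_x f x = (2 * pi) ^+ d * avg f.
  by rewrite /avg mulrA mulfV ?mul1r// gt_eqF ?volume_gt0.
have kE : (k == 0) = (k0 == 0) && (k' == 0).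
  apply/eqP/andP => [kz|[/eqP h0 /eqP h1]].
    rewrite /k0 /k' kz mxE eqxx; split => //.
    by apply/eqP/rowP => i; rewrite !mxE.
  apply/rowP => i; rewrite mxE; case: (unliftP ord0 i) => [j ->|-> //].
  by have /rowP/(_ j) := h1; rewrite !mxE.
have mcos (m : int) : measurable_fun [set: measurableTypeR R] (fun a : R => cos (m%:~R * a)).
  by apply: continuous_measurable_fun => x; exact: continuous_cos_scale.
have msin (m : int) : measurable_fun [set: measurableTypeR R] (fun a : R => sin (m%:~R * a)).
  by apply: continuous_measurable_fun => x; exact: continuous_sin_scale.
have bcos (m : int) : bm (fun a : measurableTypeR R => cos (m%:~R * (a : R)) : R).
  by split => //; exists 1 => x; exact: cos_max.
have bsin (m : int) : bm (fun a : measurableTypeR R => sin (m%:~R * (a : R)) : R).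
  by split => //; exists 1 => x; exact: sin_max.
split; rewrite /avg Rint_torusS; [|exact: bm_cos| |exact: bm_sin].
  have E (a : R) : \int[torus d]_x cos (int_dot k (consrV (a, x))) =
      ((2 * pi) ^+ d * (k' == 0)%:R) * cos (k0%:~R * a).
    under eq_Rintegral do rewrite int_dot_consrV cosD.
    rewrite RintB; last 2 first.
      by apply: bm_itg; apply: bmZ; exact: bm_cos.
      by apply: bm_itg; apply: bmZ; exact: bm_sin.
    rewrite !RintZ; [|apply: bm_itg; exact: bm_sin|apply: bm_itg; exact: bm_cos].
    by rewrite !unavg IHc IHs mulr0 mulr0 subr0 mulrC.
  under eq_Rintegral do rewrite E.
  rewrite RintZ; last exact/bm_itg/bcos.
  rewrite Rint_circle// Rint_cos_int kE.
  have p0 := gt_eqF (@pi_gt0 R); have := gt_eqF (volume_gt0 d) => v0.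
  case: (k0 == 0); case: (k' == 0) => /=; rewrite ?mulr0 ?mul0r ?mulr0// mulr1 exprSr.
  by rewrite mulVf// mulf_neq0 ?v0// mulf_neq0// ?p0.
have E (a : R) : \int[torus d]_x sin (int_dot k (consrV (a, x))) =
      ((2 * pi) ^+ d * (k' == 0)%:R) * sin (k0%:~R * a).
  under eq_Rintegral do rewrite int_dot_consrV sinD.
  rewrite RintD; last 2 first.
    by apply: bm_itg; apply: bmZ; exact: bm_cos.
    by apply: bm_itg; apply: bmZ; exact: bm_sin.
  rewrite !RintZ; [|apply: bm_itg; exact: bm_sin|apply: bm_itg; exact: bm_cos].
  by rewrite !unavg IHc IHs mulr0 mulr0 addr0 mulrC.
under eq_Rintegral do rewrite E.
rewrite RintZ; last exact/bm_itg/bsin.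
by rewrite Rint_circle// Rint_sin_int mulr0 mulr0.
Qed.

End average.

(** * Fourier coefficients, Fourier series and products *)

Section fourier.
Context {R : realType} {d : nat}.
Implicit Types (k l : 'rV[int]_d) (x : 'rV[R]_d) (u v f g : 'rV[R]_d -> R).
Local Notation itg := (@itg _ _ R (torus d)).

Lemma avgD u v : itg u -> itg v -> avg (fun x => u x + v x) = avg u + avg v.
Proof. by move=> iu iv; rewrite /avg RintD// mulrDr. Qed.

Lemma avgB u v : itg u -> itg v -> avg (fun x => u x - v x) = avg u - avg v.
Proof. by move=> iu iv; rewrite /avg RintB// mulrBr. Qed.

Lemma avgZ c u : itg u -> avg (fun x => c * u x) = c * avg u.
Proof. by move=> iu; rewrite /avg RintZ// mulrCA. Qed.

Lemma le_avg u v : itg u -> itg v -> (forall x, u x <= v x) -> avg u <= avg v.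
Proof.
move=> iu iv uv; rewrite /avg ler_pM2l ?invr_gt0 ?volume_gt0//.
exact: le_Rint.
Qed.

Lemma norm_avg u : itg u -> `|avg u| <= avg (fun x => `|u x|).
Proof.
move=> iu; rewrite /avg normrM ger0_norm ?invr_ge0 ?(ltW (volume_gt0 d))//.
by rewrite ler_wpM2l ?invr_ge0 ?(ltW (volume_gt0 d))//; exact: norm_Rint.
Qed.

Lemma norm_avg_le u M : measurable_fun setT u -> (forall x, `|u x| <= M) ->
  `|avg u| <= M.
Proof.
move=> mu uM.
have bu : bm u by split => //; exists M.
apply: le_trans (norm_avg (bm_itg _ bu)) _.
rewrite -[leRHS](avg_cst d); apply: le_avg => //; last exact/bm_itg/bm_cst.
by apply: bm_itg; split; [exact: measurableT_comp|exists M => x; rewrite normr_id].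
Qed.

Lemma avg_dominated (f_ : nat -> 'rV[R]_d -> R) f g :
  (forall n, measurable_fun setT (f_ n)) -> itg g ->
  (forall n x, `|f_ n x| <= g x) -> (forall x, f_ n x @[n --> \oo] --> f x) ->
  avg (f_ n) @[n --> \oo] --> avg f.
Proof.
move=> mf ig fg ff; apply: cvgM; first exact: cvg_cst.
exact: Rint_dominated ig fg ff.
Qed.

Definition ccoef u k : R := avg (fun x => u x * cos (int_dot k x)).
Definition scoef u k : R := avg (fun x => u x * sin (int_dot k x)).
Definition amp u k : R := nrm2 (ccoef u k) (scoef u k).

Lemma normc_fourier_coef u k : Normc.normc (fourier_coef u k) = amp u k.
Proof. by rewrite /amp /nrm2 /ccoef /scoef /avg /= sqrrN. Qed.

Lemma amp_ge0 u k : 0 <= amp u k. Proof. exact: nrm2_ge0. Qed.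

Lemma ccoefN u k : ccoef u (- k) = ccoef u k.
Proof. by apply: eq_avg => x; rewrite int_dotN cosN. Qed.

Lemma itg_sin u k : itg u -> itg (fun x => u x * sin (int_dot k x)).
Proof. by move=> iu; exact: (itgM iu (bm_sin k)). Qed.

Lemma scoefN u k : itg u -> scoef u (- k) = - scoef u k.
Proof.
move=> iu; rewrite /scoef -mulN1r -avgZ; last exact: itg_sin.
by apply: eq_avg => x; rewrite int_dotN sinN mulrN mulN1r.
Qed.

Lemma ampN u k : itg u -> amp u (- k) = amp u k.
Proof. by move=> iu; rewrite /amp ccoefN scoefN// /nrm2 sqrrN. Qed.

Lemma itg_cos u k : itg u -> itg (fun x => u x * cos (int_dot k x)).
Proof. by move=> iu; exact: (itgM iu (bm_cos k)). Qed.

Lemma ccoefD u v k : itg u -> itg v -> ccoef (u \+ v) k = ccoef u k + ccoef v k.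
Proof.
move=> iu iv; rewrite /ccoef -avgD; [|exact: itg_cos..].
by apply: eq_avg => x; rewrite /= mulrDl.
Qed.

Lemma scoefD u v k : itg u -> itg v -> scoef (u \+ v) k = scoef u k + scoef v k.
Proof.
move=> iu iv; rewrite /scoef -avgD; [|exact: itg_sin..].
by apply: eq_avg => x; rewrite /= mulrDl.
Qed.

Lemma ccoefZ c u k : itg u -> ccoef (fun x => c * u x) k = c * ccoef u k.
Proof.
move=> iu; rewrite /ccoef -avgZ; last exact: itg_cos.
by apply: eq_avg => x; rewrite /= mulrA.
Qed.

Lemma scoefZ c u k : itg u -> scoef (fun x => c * u x) k = c * scoef u k.
Proof.
move=> iu; rewrite /scoef -avgZ; last exact: itg_sin.
by apply: eq_avg => x; rewrite /= mulrA.
Qed.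

Lemma itgZ c u : itg u -> itg (fun x => c * u x).
Proof.
move=> iu; apply: (@eq_integrable _ _ _ _ setT measurableT (EFin \o (u \* cst c))).
  by move=> x _ /=; rewrite mulrC.
exact: itgM iu (bm_cst _ c).
Qed.

Lemma ccoefB u v k : itg u -> itg v -> ccoef (u \- v) k = ccoef u k - ccoef v k.
Proof.
move=> iu iv; rewrite -mulN1r -ccoefZ// -ccoefD//; last exact: itgZ.
by apply: eq_avg => x; rewrite /= mulN1r.
Qed.

Lemma scoefB u v k : itg u -> itg v -> scoef (u \- v) k = scoef u k - scoef v k.
Proof.
move=> iu iv; rewrite -mulN1r -scoefZ// -scoefD//; last exact: itgZ.
by apply: eq_avg => x; rewrite /= mulN1r.
Qed.

Lemma ampD u v k : itg u -> itg v -> amp (u \+ v) k <= amp u k + amp v k.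
Proof. by move=> iu iv; rewrite /amp ccoefD// scoefD//; exact: nrm2D. Qed.

Lemma ampZ c u k : itg u -> amp (fun x => c * u x) k = `|c| * amp u k.
Proof. by move=> iu; rewrite /amp ccoefZ// scoefZ// nrm2Z. Qed.

Lemma amp_le_L1 u k : itg u -> amp u k <= avg (fun x => `|u x|) *+ 2.
Proof.
move=> iu; apply: le_trans (nrm2_le_abs _ _) _; rewrite mulr2n.
have iau : itg (fun x => `|u x|) by exact: integrable_norm.
apply: lerD.
  apply: le_trans (norm_avg (itg_cos k iu)) _; apply: le_avg => //.
    by apply: integrable_norm; exact: itg_cos.
  by move=> x; rewrite normrM ler_piMr// cos_max.
apply: le_trans (norm_avg (itg_sin k iu)) _; apply: le_avg => //.
  by apply: integrable_norm; exact: itg_sin.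
by move=> x; rewrite normrM ler_piMr// sin_max.
Qed.

Lemma le_trig_term (c s t : R) : `|c * cos t + s * sin t| <= nrm2 c s.
Proof.
rewrite ler_norml; have h := cos2Dsin2 t; apply/andP; split.
  rewrite lerNl opprD -!mulrN (mulrC c) (mulrC s).
  by apply: le_nrm2; rewrite !sqrrN.
by rewrite (mulrC c) (mulrC s); exact: le_nrm2.
Qed.

Lemma coef_cvg (f_ : nat -> 'rV[R]_d -> R) f M k :
  (forall n, measurable_fun setT (f_ n)) -> (forall n x, `|f_ n x| <= M) ->
  (forall x, f_ n x @[n --> \oo] --> f x) ->
  ccoef (f_ n) k @[n --> \oo] --> ccoef f k /\
  scoef (f_ n) k @[n --> \oo] --> scoef f k.
Proof.
move=> mf fM ff.
have iM : itg (cst M) by exact: bm_itg (bm_cst _ _).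
split.
  apply: (avg_dominated _ iM) => [n|n x|x].
  - by apply: measurable_funM => //; case: (bm_cos (R := R) k).
  - by rewrite normrM -[M]mulr1; apply: ler_pM => //; exact: cos_max.
  - by apply: cvgM; [exact: ff|exact: cvg_cst].
apply: (avg_dominated _ iM) => [n|n x|x].
- by apply: measurable_funM => //; case: (bm_sin (R := R) k).
- by rewrite normrM -[M]mulr1; apply: ler_pM => //; exact: sin_max.
- by apply: cvgM; [exact: ff|exact: cvg_cst].
Qed.

Lemma amp_cvg (f_ : nat -> 'rV[R]_d -> R) f M k :
  (forall n, measurable_fun setT (f_ n)) -> (forall n x, `|f_ n x| <= M) ->
  (forall x, f_ n x @[n --> \oo] --> f x) ->
  amp (f_ n) k @[n --> \oo] --> amp f k.
Proof.
move=> mf fM ff; have [h1 h2] := coef_cvg k mf fM ff.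
exact: nrm2_cvg h1 h2.
Qed.

(** The term at [k] is the real part of (c k - i s k) e^(i k.x). The sum runs over the whole
    lattice, so [k] and [- k] both contribute and no factor 2 appears. *)
Definition trig (c s : 'rV[int]_d -> R) x : R :=
  gsum (fun k => c k * cos (int_dot k x) + s k * sin (int_dot k x)).

(** Equality with the Fourier series is required at every point, so that pointwise bounds and limits
    need no exceptional set. *)
Definition wien u := gsummable (amp u) /\ u = trig (ccoef u) (scoef u).

Lemma bm_trig_term c s k :
  bm (fun x => c * cos (int_dot k x) + s * sin (int_dot k x) : R).
Proof. by apply: bmD; apply: bmZ; [exact: bm_cos|exact: bm_sin]. Qed.

Section trig.
Variables (c s : 'rV[int]_d -> R).
Hypothesis sm : gsummable (fun k => nrm2 (c k) (s k)).

Lemma trig_summable x :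
  gsummable (fun k => c k * cos (int_dot k x) + s k * sin (int_dot k x)).
Proof.
apply: le_gsummable sm => k; rewrite [leRHS]ger0_norm ?nrm2_ge0//.
exact: le_trig_term.
Qed.

Lemma norm_trig_le x : `|trig c s x| <= gsum (fun k => nrm2 (c k) (s k)).
Proof.
apply: le_trans (le_norm_gsum (trig_summable x)) _; apply: le_gsum => //.
  exact: gsummable_norm (trig_summable x).
by move=> k; exact: le_trig_term.
Qed.

Lemma bm_trig : bm (trig c s).
Proof.
split; last by exists (gsum (fun k => nrm2 (c k) (s k))) => x; exact: norm_trig_le.
apply: (@measurable_gsum _ _ _ _
  (fun k x => c k * cos (int_dot k x) + s k * sin (int_dot k x))).
  by move=> k; case: (bm_trig_term (c k) (s k) k).
exact: trig_summable.
Qed.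

Lemma trig_Rint_summable h : itg h -> gsummable (fun k =>
  \int[torus d]_x ((c k * cos (int_dot k x) + s k * sin (int_dot k x)) * h x)).
Proof.
move=> ih; pose M := \int[torus d]_x `|h x|.
apply: (@le_gsummable _ _ _ (fun k => M * nrm2 (c k) (s k))); last exact: gsummableZ.
move=> k; have ithk : itg (fun x => (c k * cos (int_dot k x) + s k * sin (int_dot k x)) * h x).
  apply: (@eq_integrable _ _ _ _ setT measurableT (EFin \o (h \*
    (fun x => c k * cos (int_dot k x) + s k * sin (int_dot k x))))).
    by move=> x _ /=; rewrite mulrC.
  exact: itgM ih (bm_trig_term _ _ _).
have iah : itg (fun x => `|h x|) by exact: integrable_norm.
apply: le_trans (norm_Rint ithk) _; apply: le_trans (ler_norm _).
rewrite mulrC -RintZ//; apply: le_Rint; last first.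
- by move=> x; rewrite normrM ler_wpM2r//; exact: le_trig_term.
- exact: itgZ.
- exact: integrable_norm.
Qed.

Lemma trig_avg_summable h : itg h -> gsummable (fun k =>
  avg (fun x => (c k * cos (int_dot k x) + s k * sin (int_dot k x)) * h x)).
Proof. by move=> ih; apply: gsummableZ; exact: trig_Rint_summable. Qed.

Lemma avg_trigM h : itg h ->
  avg (fun x => trig c s x * h x) =
  gsum (fun k => avg (fun x => (c k * cos (int_dot k x) + s k * sin (int_dot k x)) * h x)).
Proof.
move=> ih; rewrite /avg /trig.
rewrite (@Rint_gsum _ _ _ _ _
  (fun k x => c k * cos (int_dot k x) + s k * sin (int_dot k x)) _ h _ ih sm).
- by rewrite -gsumZ//; exact: trig_Rint_summable.
- by move=> k; case: (bm_trig_term (c k) (s k) k).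
- by move=> k x; exact: le_trig_term.
Qed.

Hypothesis cN : forall k, c (- k) = c k.
Hypothesis sN : forall k, s (- k) = - s k.

Let avgc k := (avg_trig (R := R) k).1.
Let avgs k := (avg_trig (R := R) k).2.
Let ic k : itg (fun x => cos (int_dot k x)) := bm_itg _ (bm_cos k).
Let is_ k : itg (fun x => sin (int_dot k x)) := bm_itg _ (bm_sin k).

(** Product-to-sum formulas leave the frequencies [k] and [- k] with weight 1/2 each; the parity of
    the coefficients merges them, with e = 1 for cosines and e = -1 for sines. At k = 0 the two
    indicators add up and the formula still holds. *)
Let sum_dirac (t : 'rV[int]_d -> R) k (e : R) :
  gsum (fun l => 2^-1 * (t l * ((l == k)%:R + e * (l == - k)%:R))) =
  2^-1 * (t k + e * t (- k)).
Proof.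
have E l : 2^-1 * (t l * ((l == k)%:R + e * (l == - k)%:R)) =
    (if l == k then 2^-1 * t k else 0) + (if l == - k then 2^-1 * (e * t (- k)) else 0).
  by case: (eqVneq l k) => [->|_]; case: (eqVneq _ (- k)) => [<-|_] /=; ring.
rewrite (eq_gsum E) gsumD; [|exact: gsummable_single..].
by rewrite !gsum_single; ring.
Qed.

Lemma ccoef_trig k : ccoef (trig c s) k = c k.
Proof.
rewrite /ccoef avg_trigM//.
have E l : avg (fun x => (c l * cos (int_dot l x) + s l * sin (int_dot l x)) *
    cos (int_dot k x)) = 2^-1 * (c l * ((l == k)%:R + 1 * (l == - k)%:R)).
  rewrite (_ : avg _ = avg (fun x => (2^-1 * c l) * (cos (int_dot (l - k) x) +
     cos (int_dot (l + k) x)) +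
     (2^-1 * s l) * (sin (int_dot (l - k) x) + sin (int_dot (l + k) x)))); last first.
    apply: eq_avg => x; rewrite !int_dotD int_dotN !cosD !sinD cosN sinN.
    by field.
  rewrite avgD; [|exact: (itgZ _ (itgD (ic _) (ic _)))|
    exact: (itgZ _ (itgD (is_ _) (is_ _)))].
  rewrite !avgZ; [|exact: (itgD (is_ _) (is_ _))|exact: (itgD (ic _) (ic _))].
  rewrite !avgD// !avgc !avgs subr_eq0 addr_eq0; ring.
by rewrite (eq_gsum E) sum_dirac cN; field.
Qed.

Lemma scoef_trig k : scoef (trig c s) k = s k.
Proof.
rewrite /scoef avg_trigM//.
have E l : avg (fun x => (c l * cos (int_dot l x) + s l * sin (int_dot l x)) *
    sin (int_dot k x)) = 2^-1 * (s l * ((l == k)%:R + (-1) * (l == - k)%:R)).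
  rewrite (_ : avg _ = avg (fun x => (2^-1 * s l) * (cos (int_dot (l - k) x) -
     cos (int_dot (l + k) x)) +
     (2^-1 * c l) * (sin (int_dot (l + k) x) - sin (int_dot (l - k) x)))); last first.
    apply: eq_avg => x; rewrite !int_dotD int_dotN !cosD !sinD cosN sinN.
    by field.
  rewrite avgD; [|exact: (itgZ _ (itgB (ic _) (ic _)))|
    exact: (itgZ _ (itgB (is_ _) (is_ _)))].
  rewrite !avgZ; [|exact: (itgB (is_ _) (is_ _))|exact: (itgB (ic _) (ic _))].
  rewrite !avgB// !avgc !avgs subr_eq0 addr_eq0; ring.
by rewrite (eq_gsum E) sum_dirac sN; field.
Qed.

Lemma wien_trig : wien (trig c s).
Proof.
have ec : ccoef (trig c s) = c by apply/funext => k; exact: ccoef_trig.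
have es : scoef (trig c s) = s by apply/funext => k; exact: scoef_trig.
split; last by rewrite ec es.
by rewrite (_ : amp _ = fun k => nrm2 (c k) (s k))// /amp ec es.
Qed.

End trig.

Lemma wien_bm u : wien u -> bm u.
Proof. by move=> [su ->]; exact: bm_trig. Qed.

Lemma wien_itg u : wien u -> itg u.
Proof. by move=> /wien_bm /bm_itg. Qed.

Lemma wien_norm_le u x : wien u -> `|u x| <= gsum (amp u).
Proof. by move=> [su uE]; rewrite {1}uE; exact: norm_trig_le. Qed.

Lemma nrm2_CS (p q x y : R) : p * x + q * y <= nrm2 p q * nrm2 x y.
Proof.
have [n0|n0] := eqVneq (nrm2 p q) 0.
  have := sqr_nrm2 p q; rewrite n0 expr0n/= => /esym/eqP.
  rewrite paddr_eq0 ?sqr_ge0// !sqrf_eq0 => /andP[/eqP -> /eqP ->].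
  by rewrite !mul0r addr0.
have np : 0 < nrm2 p q by rewrite lt_def n0 nrm2_ge0.
rewrite (_ : p * x + q * y = nrm2 p q * (p / nrm2 p q * x + q / nrm2 p q * y)).
  rewrite ler_pM2l//; apply: le_nrm2.
  by rewrite !exprMn !exprVn -mulrDl -sqr_nrm2 mulfV// sqrf_eq0.
by field.
Qed.

Lemma esum_opp (a : 'rV[int]_d -> \bar R) :
  (\esum_(l in [set: 'rV[int]_d]) a (- l)%R = \esum_(l in [set: 'rV[int]_d]) a l)%E.
Proof.
rewrite [RHS](@reindex_esum R _ _ setT setT (fun l : 'rV[int]_d => - l))//.
Qed.

(** A unit vector dual to the coefficient of the product turns its modulus into a real average,
    linear in [f], where the series of [f] can be inserted. Only [f] is expanded and [g] is merely
    integrable, so powers of a Wiener function can be treated without first being shown to be sums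
    of Fourier series. *)
Lemma amp_mul f g k : wien f -> itg g ->
  ((amp (f \* g) k)%:E <= \esum_(l in [set: 'rV[int]_d]) (amp f l * amp g (k - l))%:E)%E.
Proof.
move=> wf ig; have [sf fE] := wf.
have ifg : itg (f \* g).
  apply: (@eq_integrable _ _ _ _ setT measurableT (EFin \o (g \* f))).
    by move=> x _ /=; rewrite mulrC.
  exact: itgM ig (wien_bm wf).
have [a [b [ab abE]]] := nrm2_dual (ccoef (f \* g) k) (scoef (f \* g) k).
pose e x := g x * (a * cos (int_dot k x) + b * sin (int_dot k x)).
have ie : itg e by apply: itgM ig (bm_trig_term _ _ _).
have ampE : amp (f \* g) k = avg (fun x => f x * e x).
  rewrite /amp abE -!avgZ ?itg_cos ?itg_sin// -avgD; last 2 first.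
  - by apply: itgZ; exact: itg_cos.
  - by apply: itgZ; exact: itg_sin.
  by apply: eq_avg => x; rewrite /e /=; ring.
pose M := avg (fun x => `|g x|) *+ 2.
have gM l : amp g l <= M by exact: amp_le_L1.
pose A l := amp f l * amp g (k - l); pose A' l := amp f l * amp g (k + l).
have A0 l : 0 <= A l by rewrite mulr_ge0 ?amp_ge0.
have A'0 l : 0 <= A' l by rewrite mulr_ge0 ?amp_ge0.
have M0 : 0 <= M := le_trans (amp_ge0 g 0) (gM 0).
have sA : gsummable A.
  apply: (@le_gsummable _ _ _ (fun l => M * amp f l)); last exact: gsummableZ.
  move=> l; rewrite !ger0_norm//; last by rewrite mulr_ge0 ?amp_ge0.
  by rewrite /A mulrC ler_wpM2r ?amp_ge0.
have sA' : gsummable A'.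
  apply: (@le_gsummable _ _ _ (fun l => M * amp f l)); last exact: gsummableZ.
  move=> l; rewrite !ger0_norm//; last by rewrite mulr_ge0 ?amp_ge0.
  by rewrite /A' mulrC ler_wpM2r ?amp_ge0.
(* A product of two waves has the frequencies k - l and k + l; the two resulting sums coincide after
   changing [l] into [- l]. *)
have AA' : gsum A' = gsum A.
  apply: EFin_inj; apply: (etrans (gsum_esum sA' A'0)).
  apply: (etrans _ (esym (gsum_esum sA A0))).
  apply: (etrans _ (esum_opp (fun l => (A l)%:E))); apply: eq_esum => l _.
  by rewrite /A /A' ampN ?opprK//; exact: wien_itg.
have termE l : avg (fun x => (ccoef f l * cos (int_dot l x) + scoef f l * sin (int_dot l x)) * e x)
    <= 2^-1 * (A l + A' l).
  set c := ccoef f l; set s := scoef f l.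
  rewrite (_ : avg _ = avg (fun x =>
    (2^-1 * (c * a + s * b)) * (g x * cos (int_dot (k - l) x)) +
    (2^-1 * (c * b - s * a)) * (g x * sin (int_dot (k - l) x)) +
    ((2^-1 * (c * a - s * b)) * (g x * cos (int_dot (k + l) x)) +
    (2^-1 * (c * b + s * a)) * (g x * sin (int_dot (k + l) x))))); last first.
    apply: eq_avg => x; rewrite /e !int_dotD int_dotN !cosD !sinD cosN sinN.
    by field.
  have i1 t m : itg (fun x => t * (g x * cos (int_dot m x))).
    by apply: itgZ; exact: itg_cos.
  have i2 t m : itg (fun x => t * (g x * sin (int_dot m x))).
    by apply: itgZ; exact: itg_sin.
  rewrite (avgD (itgD (i1 _ _) (i2 _ _)) (itgD (i1 _ _) (i2 _ _))).
  rewrite !(avgD (i1 _ _) (i2 _ _)) !(avgZ _ (itg_cos _ ig)) !(avgZ _ (itg_sin _ ig)).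
  rewrite -/(ccoef g (k - l)) -/(scoef g (k - l)) -/(ccoef g (k + l)) -/(scoef g (k + l)).
  (* Combining (c, s) with the unit vector (a, b) is a plane isometry, so the modulus is
     unchanged. *)
  have n1 : nrm2 (c * a + s * b) (c * b - s * a) = amp f l.
    rewrite /amp /nrm2 -/c -/s; congr Num.sqrt.
    by rewrite -[RHS]mulr1 -ab; ring.
  have n2 : nrm2 (c * a - s * b) (c * b + s * a) = amp f l.
    rewrite /amp /nrm2 -/c -/s; congr Num.sqrt.
    by rewrite -[RHS]mulr1 -ab; ring.
  have := nrm2_CS (c * a + s * b) (c * b - s * a) (ccoef g (k - l)) (scoef g (k - l)).
  have := nrm2_CS (c * a - s * b) (c * b + s * a) (ccoef g (k + l)) (scoef g (k + l)).
  rewrite n1 n2 -/(amp g (k - l)) -/(amp g (k + l)) /A /A'.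
  move: (amp f l) (amp g (k - l)) (amp g (k + l)) (ccoef g (k - l))
    (scoef g (k - l)) (ccoef g (k + l)) (scoef g (k + l)) => z1 z2 z3 z4 z5 z6 z7.
  by clear; clearbody c s; lra.
have sAA : gsummable (fun l => 2^-1 * (A l + A' l)).
  by apply: gsummableZ; exact: gsummableD.
have -> : (\esum_(l in [set: 'rV[int]_d]) (amp f l * amp g (k - l))%:E =
   (gsum (fun l => 2^-1 * (A l + A' l)))%:E)%E.
  rewrite (gsumZ _ (gsummableD sA sA')) (gsumD sA sA') AA'.
  by apply: (etrans (esym (gsum_esum sA A0))); congr EFin; field.
rewrite ampE lee_fin {1}fE (avg_trigM sf ie); apply: (le_gsum _ sAA termE).
exact: (trig_avg_summable sf ie).
Qed.

End fourier.

(** * Uniqueness of Fourier coefficients and inversion *)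

Section step_polynomials.
Context {R : realType}.
Implicit Types y : R.

(** Polynomials known from elementary proofs of the Stone-Weierstrass theorem: on [0, 1] they
    converge to a step at y = 1/2, because the exponent 2^n opposes y^n, so that the behaviour of (2
    y)^n decides. *)
Definition step_poly n y : R := (1 - y ^+ n) ^+ (2 ^ n).

Lemma step_poly01 n y : 0 <= y <= 1 -> 0 <= step_poly n y <= 1.
Proof.
move=> /andP[y0 y1]; have h : 0 <= 1 - y ^+ n <= 1.
  by rewrite subr_ge0 exprn_ile1//= gerBl exprn_ge0.
by case/andP: h => h1 h2; rewrite exprn_ge0//= exprn_ile1.
Qed.

Lemma bernoulli (t : R) n : -1 <= t -> 1 + n%:R * t <= (1 + t) ^+ n.
Proof.
move=> t1; elim: n => [|n IH]; first by rewrite mul0r addr0 expr0.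
rewrite exprS; apply: (@le_trans _ _ ((1 + t) * (1 + n%:R * t))).
  by rewrite -natr1; have := sqr_ge0 t; have := ler0n R n; nra.
by rewrite ler_wpM2l//; lra.
Qed.

Lemma step_poly_cvg1 y : 0 <= y < 2^-1 -> step_poly n y @[n --> \oo] --> (1 : R).
Proof.
move=> /andP[y0 y2].
have y1 : y <= 1 by lra.
apply: (@squeeze_cvgr _ _ _ _ (fun n => 1 - (2 * y) ^+ n) (cst 1)).
- apply: nearW => n; have /andP[_ ->] := step_poly01 n (introT andP (conj y0 y1)).
  rewrite andbT /step_poly -[_ - y ^+ n]/(1 + (- y ^+ n)).
  apply: le_trans (bernoulli _ _); first by rewrite natrX exprMn mulrN.
  by rewrite lerN2 exprn_ile1.
- rewrite -[X in _ --> X]subr0; apply: cvgB; first exact: cvg_cst.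
  by apply: cvg_expr; rewrite ger0_norm; lra.
- exact: cvg_cst.
Qed.

Lemma step_poly_cvg0 y : 2^-1 < y <= 1 -> step_poly n y @[n --> \oo] --> (0 : R).
Proof.
move=> /andP[y2 y1].
have y0 : 0 <= y by lra.
have y20 : 0 < 2 * y by lra.
apply: (@squeeze_cvgr _ _ _ _ (cst 0) (fun n => (2 * y)^-1 ^+ n)).
- apply: nearW => n; have /andP[-> _] := step_poly01 n (introT andP (conj y0 y1)).
  rewrite /= /step_poly exprVn -div1r ler_pdivlMr ?exprn_gt0// exprMn.
  have yn0 : 0 <= y ^+ n by rewrite exprn_ge0.
  have yn1 : y ^+ n <= 1 by rewrite exprn_ile1.
  (* Bernoulli bounds the power of 1 + y^n from below; since (1 - y^n) (1 + y^n) <= 1, this bounds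
     the power of 1 - y^n from above. *)
  have h1 : 2 ^+ n * y ^+ n <= (1 + y ^+ n) ^+ (2 ^ n).
    apply: le_trans (@bernoulli (y ^+ n) (2 ^ n) _); first by rewrite natrX lerDr.
    by rewrite (le_trans _ yn0)// lerN10.
  apply: (@le_trans _ _ ((1 - y ^+ n) ^+ (2 ^ n) * (1 + y ^+ n) ^+ (2 ^ n))).
    by rewrite ler_wpM2l// exprn_ge0// subr_ge0.
  rewrite -exprMn exprn_ile1//; last by nra.
  by rewrite mulr_ge0//; lra.
- exact: cvg_cst.
- apply: cvg_expr; rewrite ger0_norm ?invr_ge0; last lra.
  by rewrite invf_lt1//; lra.
Qed.

End step_polynomials.

(** * Uniqueness of Fourier coefficients on the circle *)

Section circle_uniqueness.
Context {R : realType}.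
Local Notation mu := (@lebesgue_measure R).
Local Notation circle := (@circle_measure R).
Variable g : R -> R.
Hypothesis ig : itg circle g.
Hypothesis gc : forall m : int, \int[circle]_a (g a * cos (m%:~R * a)) = 0.
Hypothesis gs : forall m : int, \int[circle]_a (g a * sin (m%:~R * a)) = 0.

(** Asking for all frequencies at once makes the class stable under multiplication by [cos] and
    [sin], since products of waves are sums of waves. All trigonometric polynomials are then reached
    by linear combinations and products. *)
Let annihilated (p : R -> R) := bm (p : measurableTypeR R -> R) /\ forall m : int,
  \int[circle]_a (g a * (p a * cos (m%:~R * a))) = 0 /\
  \int[circle]_a (g a * (p a * sin (m%:~R * a))) = 0.

Let bcos (m : R) : bm (fun a : measurableTypeR R => cos (m * (a : R)) : R).
Proof.
split; last by exists 1 => x; exact: cos_max.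
by apply: continuous_measurable_fun => x; exact: continuous_cos_scale.
Qed.

Let bsin (m : R) : bm (fun a : measurableTypeR R => sin (m * (a : R)) : R).
Proof.
split; last by exists 1 => x; exact: sin_max.
by apply: continuous_measurable_fun => x; exact: continuous_sin_scale.
Qed.

Let igM p : bm (p : measurableTypeR R -> R) -> itg circle (fun a => g a * p a).
Proof. by move=> bp; exact: itgM ig bp. Qed.

Let ann_lin p q c : annihilated p -> annihilated q -> annihilated (fun a => p a + c * q a).
Proof.
move=> [bp Tp] [bq Tq]; split; first by apply: bmD => //; exact: bmZ.
move=> m; have [pc ps] := Tp m; have [qc qs] := Tq m; split.
  rewrite (_ : \int[_]_a _ = \int[circle]_a (g a * (p a * cos (m%:~R * a)) +
     c * (g a * (q a * cos (m%:~R * a))))); last by apply: eq_Rintegral => a _; ring.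
  rewrite RintD ?RintZ ?pc ?qc ?mulr0 ?addr0//.
  - exact: igM (bmM bq (bcos _)).
  - exact: igM (bmM bp (bcos _)).
  - by under eq_fun do rewrite mulrCA; exact: igM (bmZ _ (bmM bq (bcos _))).
rewrite (_ : \int[_]_a _ = \int[circle]_a (g a * (p a * sin (m%:~R * a)) +
   c * (g a * (q a * sin (m%:~R * a))))); last by apply: eq_Rintegral => a _; ring.
rewrite RintD ?RintZ ?ps ?qs ?mulr0 ?addr0//.
- exact: igM (bmM bq (bsin _)).
- exact: igM (bmM bp (bsin _)).
- by under eq_fun do rewrite mulrCA; exact: igM (bmZ _ (bmM bq (bsin _))).
Qed.

Let ann_cos p : annihilated p -> annihilated (fun a => p a * cos a).
Proof.
move=> [bp Tp]; split.
  have -> : (fun a => p a * cos a) = p \* (fun a => cos (1 * a)).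
    by apply/funext => a /=; rewrite mul1r.
  by apply: bmM => //; exact: bcos.
move=> m; have [c1 s1] := Tp (m + 1); have [c2 s2] := Tp (m - 1); split.
  rewrite (_ : \int[_]_a _ = \int[circle]_a (2^-1 * (g a * (p a * cos ((m + 1)%:~R * a))) +
     2^-1 * (g a * (p a * cos ((m - 1)%:~R * a))))); last first.
    apply: eq_Rintegral => a _.
    by rewrite !intrD mulrN1z !mulrDl mulN1r mul1r !cosD cosN sinN; field.
  rewrite RintD ?RintZ ?c1 ?c2 ?mulr0 ?addr0//; first last.
  - by under eq_fun do rewrite mulrCA; exact: igM (bmZ _ (bmM bp (bcos _))).
  - by under eq_fun do rewrite mulrCA; exact: igM (bmZ _ (bmM bp (bcos _))).
  - exact: igM (bmM bp (bcos _)).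
  - exact: igM (bmM bp (bcos _)).
rewrite (_ : \int[_]_a _ = \int[circle]_a (2^-1 * (g a * (p a * sin ((m + 1)%:~R * a))) +
     2^-1 * (g a * (p a * sin ((m - 1)%:~R * a))))); last first.
  apply: eq_Rintegral => a _.
  by rewrite !intrD mulrN1z !mulrDl mulN1r mul1r !sinD cosN sinN; field.
rewrite RintD ?RintZ ?s1 ?s2 ?mulr0 ?addr0//; first last.
- by under eq_fun do rewrite mulrCA; exact: igM (bmZ _ (bmM bp (bsin _))).
- by under eq_fun do rewrite mulrCA; exact: igM (bmZ _ (bmM bp (bsin _))).
- exact: igM (bmM bp (bsin _)).
- exact: igM (bmM bp (bsin _)).
Qed.

Let ann_sin p : annihilated p -> annihilated (fun a => p a * sin a).
Proof.
move=> [bp Tp]; split.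
  have -> : (fun a => p a * sin a) = p \* (fun a => sin (1 * a)).
    by apply/funext => a /=; rewrite mul1r.
  by apply: bmM => //; exact: bsin.
move=> m; have [c1 s1] := Tp (m + 1); have [c2 s2] := Tp (m - 1); split.
  rewrite (_ : \int[_]_a _ = \int[circle]_a (2^-1 * (g a * (p a * sin ((m + 1)%:~R * a))) +
     - 2^-1 * (g a * (p a * sin ((m - 1)%:~R * a))))); last first.
    apply: eq_Rintegral => a _.
    by rewrite !intrD mulrN1z !mulrDl mulN1r mul1r !sinD cosN sinN; field.
  rewrite RintD ?RintZ ?s1 ?s2 ?mulr0 ?addr0//; first last.
  - by under eq_fun do rewrite mulrCA; exact: igM (bmZ _ (bmM bp (bsin _))).
  - by under eq_fun do rewrite mulrCA; exact: igM (bmZ _ (bmM bp (bsin _))).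
  - exact: igM (bmM bp (bsin _)).
  - exact: igM (bmM bp (bsin _)).
rewrite (_ : \int[_]_a _ = \int[circle]_a (2^-1 * (g a * (p a * cos ((m - 1)%:~R * a))) +
     - 2^-1 * (g a * (p a * cos ((m + 1)%:~R * a))))); last first.
  apply: eq_Rintegral => a _.
  by rewrite !intrD mulrN1z !mulrDl mulN1r mul1r !cosD cosN sinN; field.
rewrite RintD ?RintZ ?c1 ?c2 ?mulr0 ?addr0//; first last.
- by under eq_fun do rewrite mulrCA; exact: igM (bmZ _ (bmM bp (bcos _))).
- by under eq_fun do rewrite mulrCA; exact: igM (bmZ _ (bmM bp (bcos _))).
- exact: igM (bmM bp (bcos _)).
- exact: igM (bmM bp (bcos _)).
Qed.

Let ann1 : annihilated (cst 1).
Proof.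
split; first exact: bm_cst.
move=> m; split; [rewrite -[RHS](gc m)|rewrite -[RHS](gs m)];
  by apply: eq_Rintegral => a _; rewrite mul1r.
Qed.

Let ann0 : annihilated (cst 0).
Proof.
rewrite (_ : cst 0 = fun a => cst 1 a + (-1) * cst 1 a); first exact: ann_lin ann1 ann1.
by apply/funext => a /=; ring.
Qed.

Let annZ p c : annihilated p -> annihilated (fun a => c * p a).
Proof.
move=> Tp; rewrite (_ : (fun _ => _) = fun a => cst 0 a + c * p a).
  exact: ann_lin ann0 Tp.
by apply/funext => a /=; rewrite add0r.
Qed.

(* closed under multiplication by [c + s cos a + t sin a] *)
Let arc_coord (e h a : R) : R := 2^-1 + (cos h - cos (a - e)) / 4.

Let ann_arc e h p : annihilated p -> annihilated (fun a => p a * arc_coord e h a).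
Proof.
move=> Tp; rewrite (_ : (fun _ => _) = fun a => (2^-1 + cos h / 4) * p a +
    1 * ((- cos e / 4) * (p a * cos a) + (- sin e / 4) * (p a * sin a))).
  apply: ann_lin; first exact: annZ.
  apply: ann_lin; [exact/annZ/ann_cos|exact: ann_sin].
by apply/funext => a; rewrite /arc_coord cosB; field.
Qed.

Let ann_arcX e h n p : annihilated p -> annihilated (fun a => p a * arc_coord e h a ^+ n).
Proof.
move=> Tp; elim: n => [|n IH].
  by rewrite (_ : (fun _ => _) = p)//; apply/funext => a; rewrite expr0 mulr1.
rewrite (_ : (fun _ => _) = fun a => (p a * arc_coord e h a ^+ n) * arc_coord e h a).
  exact: ann_arc.
by apply/funext => a; rewrite exprSr mulrA.
Qed.

Let ann_step e h n : annihilated (fun a => step_poly n (arc_coord e h a)).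
Proof.
rewrite /step_poly; elim: (2 ^ n)%N => [|N IH]; first exact: ann1.
rewrite (_ : (fun _ => _) = fun a => (1 - arc_coord e h a ^+ n) ^+ N +
  (-1) * ((1 - arc_coord e h a ^+ n) ^+ N * arc_coord e h a ^+ n)).
  by apply: ann_lin => //; exact: ann_arcX.
by apply/funext => a; rewrite exprS; ring.
Qed.

Let arc_coord01 e h a : 0 <= arc_coord e h a <= 1.
Proof.
rewrite /arc_coord.
have := cos_le1 h; have := cos_geN1 h; have := cos_le1 (a - e).
by have := cos_geN1 (a - e); lra.
Qed.

Let cos_lt (h t : R) : 0 <= h <= pi -> h < t < 2 * pi - h -> cos t < cos h.
Proof.
move=> /andP[h0 h1] /andP[ht th].
have [tp|pt] := lerP t pi.
  by rewrite ltr_cos// in_itv/= ?h0// tp andbT; lra.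
rewrite -(cosN t) -cosD2pi mulr2n.
by rewrite ltr_cos// ?in_itv/=; lra.
Qed.

Let cos_gt (h t : R) : h <= pi -> `|t| < h -> cos h < cos t.
Proof.
move=> h1 th; have n0 := normr_ge0 t; rewrite -(cos_norm t).
by rewrite ltr_cos// in_itv/=; lra.
Qed.

(** The arc from - pi to x has centre [e] and half-width [h]. Inside it [arc_coord] is below 1/2 and
    outside it is above, so the step polynomials in [arc_coord] converge to the indicator of the
    arc, and dominated convergence applies. *)
Lemma arc_integral0 (x : R) : - pi <= x <= pi ->
  \int[circle]_a (g a * ((a : R) <= x)%R%:R) = 0.
Proof.
move=> /andP[x1 x2].
pose e := (x - pi) / 2; pose h := (x + pi) / 2.
have h0 : 0 <= h <= pi by rewrite /h; lra.
pose q n a := g a * step_poly n (arc_coord e h a).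
have q0 n : \int[circle]_a q n a = 0.
  have [_ /(_ 0)[<- _]] := ann_step e h n.
  by apply: eq_Rintegral => a _; rewrite mul0r cos0 mulr1.
have mind : bm (fun a : measurableTypeR R => ((a : R) <= x)%R%:R : R).
  split; last by exists 1 => a; rewrite ger0_norm ?ler0n// lern1 leq_b1.
  rewrite (_ : (fun a => _) = \1_(`]-oo, x])); first exact: measurable_indic.
  by apply/funext => a; rewrite indicE mem_setE in_itv.
have ae_q : {ae circle, forall a, setT a -> (EFin \o q ^~ a) n @[n --> \oo] -->
   (g a * (a <= x)%R%:R)%:E}.
  (* At the ends of the arc and of the period [arc_coord] may equal 1/2, where the step polynomials
     are not controlled; three points form a null set. *)
  pose E : set (measurableTypeR R) := [set - pi] `|` [set x] `|` [set pi].
  pose D : set (measurableTypeR R) := `[- pi, pi]%classic.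
  have NE : (circle (E `|` ~` D) = 0)%E.
    rewrite /circle_measure /mrestr setIUl setICl setU0.
    apply: countable_lebesgue_measure0.
    apply: sub_countable (subset_card_le (@subIsetl _ _ _)) _.
    by apply: finite_set_countable; rewrite /E !finite_setU; split; [split|];
      exact: finite_set1.
  exists (E `|` ~` D); split => //.
    apply: measurableU; last by apply: measurableC; exact: measurable_itv.
    by apply: measurableU => //; exact: measurableU.
  move=> a /= /not_implyP[_ na]; apply: contrapT => /not_orP[/not_orP[/not_orP[a1 a2] a3]].
  move=> /contrapT; rewrite /D /= in_itv/= => /andP[a4 a5].
  apply: na; apply: cvg_EFin; first exact: nearW.
  apply: cvgM; first exact: cvg_cst.
  have a1' : - pi < a by rewrite lt_neqAle a4 andbT; apply/eqP => h'; exact: a1.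
  have a3' : a < pi by rewrite lt_neqAle a5 andbT; apply/eqP.
  have [ax|xa] := lerP a x.
    have ax' : a < x by rewrite lt_neqAle ax andbT; apply/eqP.
    apply: step_poly_cvg1; have /andP[-> _] := arc_coord01 e h a.
    suff : cos h < cos (a - e) by rewrite /arc_coord; lra.
    by apply: cos_gt; [rewrite /h|rewrite ltr_norml /e /h]; lra.
  apply: step_poly_cvg0; have /andP[_ ->] := arc_coord01 e h a.
  suff : cos (a - e) < cos h by rewrite /arc_coord; lra.
  by apply: cos_lt => //; rewrite /e /h; lra.
have mE (k : R -> R) : measurable_fun [set: measurableTypeR R] k ->
    measurable_fun [set: measurableTypeR R] (EFin \o k).
  by move=> mk; exact/measurable_EFinP.
have bq n : bm (fun a : measurableTypeR R => step_poly n (arc_coord e h a)).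
  by have [] := ann_step e h n.
have fg : {ae circle, forall a n, setT a ->
    (`|(EFin \o q n) a| <= (abse \o (EFin \o g)) a)%E}.
  apply: aeW => a n _; rewrite lee_fin /q normrM ler_piMr//.
  have /andP[s0 s1] := step_poly01 n (arc_coord01 e h a).
  by rewrite ger0_norm.
have [_ _] := @dominated_convergence _ _ _ circle setT measurableT
  (fun n => EFin \o q n) (EFin \o (fun a => g a * (a <= x)%R%:R)) (abse \o (EFin \o g))
  (fun n => mE _ (itg_meas (igM (bq n)))) (mE _ (itg_meas (igM mind)))
  ae_q (integrable_abse ig) fg.
rewrite (_ : [sequence _]_n = cst 0%E); last first.
  apply/funext => n /=; rewrite -[RHS]/(0%:E) -(q0 n) /Rintegral fineK//.
  by apply: integrable_fin_num => //; exact: igM (bq n).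
by move=> /cvg_lim; rewrite lim_cst// /Rintegral => <-.
Qed.

(** The primitive of [g], extended by 0 outside [- pi, pi], vanishes identically, and almost
    everywhere its derivative is [g]. *)
Lemma circle_uniq : {ae circle, forall a, g a = 0}.
Proof.
pose D : set (measurableTypeR R) := `[- pi, pi]%classic.
have mD : measurable D by exact: measurable_itv.
have mg : measurable_fun [set: measurableTypeR R] g by exact: itg_meas ig.
pose G := g \_ D.
have mG : measurable_fun [set: measurableTypeR R] G.
  by apply/(measurable_restrictT _ mD); exact: measurable_funTS.
have iG : mu.-integrable [set: measurableTypeR R] (EFin \o G).
  rewrite /G -restrict_EFin; apply/(integrable_mkcond _ mD)/integrableP; split.
    by apply/measurable_EFinP; exact: measurable_funTS.
  have /integrableP[_] := ig; rewrite integral_mrestr//.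
  by apply: measurableT_comp => //; exact/measurable_EFinP.
have F0 x : \int[mu]_(a in `]-oo, x]) G a = 0.
  have E (y : R) : \int[mu]_(a in `]-oo, y]) G a =
      \int[circle]_a (g a * ((a : R) <= y)%R%:R).
    rewrite Rint_circle; last first.
      apply: measurable_funM => //.
      rewrite (_ : (fun a => _) = \1_(`]-oo, y])); first exact: measurable_indic.
      by apply/funext => a; rewrite indicE mem_setE in_itv.
    rewrite Rintegral_mkcond [RHS]Rintegral_mkcond; apply: eq_Rintegral => a _.
    rewrite /G !patchE !mem_setE !in_itv/=.
    by case: (a <= y); case: (_ && _); rewrite ?mulr1 ?mulr0.
  have [x1|x1] := ltP x (- pi).
    rewrite Rintegral_mkcond (_ : _ \_ _ = cst 0); first by rewrite /Rintegral integral0.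
    apply/funext => a; rewrite /G !patchE !mem_setE !in_itv/=.
    case: ifP => // ax; case: ifP => // /andP[a1 _].
    by have := le_lt_trans (le_trans a1 ax) x1; rewrite ltxx.
  have [x2|x2] := leP x pi; first by rewrite E arc_integral0// x1 x2.
  (* Beyond pi the indicator is 1 on the whole circle and the integral is the coefficient of
     frequency 0. *)
  rewrite E -[RHS](gc 0) !Rint_circle.
  - apply: eq_Rintegral => a; rewrite inE/= in_itv/= => /andP[_ a2].
    by rewrite (le_trans a2 (ltW x2)) mul0r cos0.
  - apply: measurable_funM => //.
    by apply: continuous_measurable_fun => z; exact: continuous_cos_scale.
  - apply: measurable_funM => //.
    rewrite (_ : (fun a => _) = \1_(`]-oo, x])); first exact: measurable_indic.
    by apply/funext => a; rewrite indicE mem_setE in_itv.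
have lG : locally_integrable [set: R] G by exact: open_integrable_locally openT iG.
have iGy y : mu.-integrable `]-oo, y] (EFin \o G) by exact: integrableS iG.
have := @FTC1Ny R G iGy lG.
move=> [N [mN N0 HN]].
have G0 a : ~ N a -> G a = 0.
  move=> Na; have : ~ (~ (derivable (fun x : R => \int[mu]_(t in `]-oo, x]) G t) a 1 /\
    derive1 (fun x : R => \int[mu]_(t in `]-oo, x]) G t) a = G a)).
    by move=> h; apply: Na; exact: HN.
  move=> /contrapT[_ <-].
  rewrite (_ : (fun x => _) = cst 0); last by apply/funext.
  by rewrite derive1_cst.
exists (N `|` ~` D); split.
- by apply: measurableU => //; exact: measurableC.
- rewrite /circle_measure /mrestr setIUl setICl setU0.
  apply: (subset_measure0 _ _ _ N0) => //; first exact: measurableI.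
- move=> a /= ga; have [Na|Na] := pselect (N a); [by left|right => Da].
  by apply: ga; have := G0 a Na; rewrite /G patchE mem_set.
Qed.

End circle_uniqueness.

(** * Uniqueness of Fourier coefficients on the torus *)

Section torus_uniqueness.
Context {R : realType}.
Local Notation circle := (@circle_measure R).

(** For an unbounded [f] the slices are integrable only for almost every [a], so the real inner
    integral agrees with Fubini's extended one almost everywhere only. *)
Lemma Rint_torusS_itg n (f : 'rV[R]_n.+1 -> R) : itg (torus n.+1) f ->
  [/\ {ae circle, forall a, itg (torus n) (fun x => f (consrV (a, x)))},
      itg circle (fun a => \int[torus n]_x f (consrV (a, x))) &
      \int[torus n.+1]_x f x = \int[circle]_a (\int[torus n]_x f (consrV (a, x)))].
Proof.
move=> itf; have mf := itg_meas itf.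
have mfc : measurable_fun setT (EFin \o (f \o @consrV R n)).
  by apply/measurable_EFinP/measurableT_comp => //; exact: measurable_consrV.
have ifc : (circle \x torus n)%E.-integrable setT (EFin \o (f \o @consrV R n)).
  apply/integrableP; split => //.
  have /integrableP[_] := itf; rewrite integral_torusS//.
  by apply: measurableT_comp => //; exact/measurable_EFinP.
have h1 := ae_integrable1 ifc.
have mF := measurable_fubini_F ifc; have iF := integrable_fubini_F ifc.
have FE : {ae circle, forall a, setT a ->
    fubini_F (torus n) (EFin \o (f \o @consrV R n)) a =
    (\int[torus n]_x f (consrV (a, x)))%:E}.
  apply: filterS h1 => a ia _; rewrite /Rintegral fineK//.
  exact: integrable_fin_num.
have mG : measurable_fun setT (fun a => (\int[torus n]_x f (consrV (a, x)))%:E).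
  have := measurableT_comp (@fine_measurable R setT measurableT) mF.
  by move=> /measurable_EFinP.
split => //.
- apply/integrableP; split => //; have /integrableP[_] := iF.
  rewrite (ae_eq_integral (abse \o (EFin \o (fun a => \int[torus n]_x f (consrV (a, x))))))//.
  - exact: measurableT_comp.
  - exact: measurableT_comp.
  - exact: ae_eq_abse.
- rewrite {1}/Rintegral integral_torusS; last exact/measurable_EFinP.
  rewrite -(integral12_prod_meas1 ifc) /Rintegral; congr fine.
  by apply: ae_eq_integral => //; exact: FE.
Qed.

Lemma ae_eq_Rint d (T : measurableType d) (mu : {finite_measure set T -> \bar R})
    (f g : T -> R) : measurable_fun setT f -> measurable_fun setT g ->
  {ae mu, forall x, f x = g x} -> \int[mu]_x f x = \int[mu]_x g x.
Proof.
move=> mf mg fg; rewrite /Rintegral; congr fine; apply: ae_eq_integral => //.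
- exact/measurable_EFinP.
- exact/measurable_EFinP.
- by apply: filterS fg => x -> _.
Qed.

Definition consZ n (m : int) (k : 'rV[int]_n) : 'rV[int]_n.+1 :=
  \row_i if unlift ord0 i is Some j then k ord0 j else m.

Lemma int_dot_consZ n m (k : 'rV[int]_n) (a : R) (x : 'rV[R]_n) :
  int_dot (consZ m k) (consrV (a, x)) = m%:~R * a + int_dot k x.
Proof.
rewrite int_dot_consrV mxE unlift_none; congr (_ + int_dot _ _).
by apply/rowP => j; rewrite !mxE liftK.
Qed.

Lemma addB_eq0 (x y : R) : x - y = 0 -> x + y = 0 -> x = 0 /\ y = 0.
Proof. by move=> h1 h2; split; lra. Qed.

(** Induction on the dimension. The Fourier coefficients of the slices, as functions of the first
    coordinate, have vanishing coefficients on the circle and hence vanish almost everywhere; the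
    induction hypothesis then kills almost every slice, and Tonelli concludes. *)
Lemma torus_uniq d (f : 'rV[R]_d -> R) : itg (torus d) f ->
  (forall k, \int[torus d]_x (f x * cos (int_dot k x)) = 0) ->
  (forall k, \int[torus d]_x (f x * sin (int_dot k x)) = 0) ->
  {ae torus d, forall x, f x = 0}.
Proof.
elim: d f => [|n IH] f itf fc fs.
  apply: aeW => x; have := fc 0.
  under eq_Rintegral do rewrite int_dot0 cos0 mulr1.
  rewrite /Rintegral /= integral_dirac//; last by apply/measurable_EFinP; exact: itg_meas itf.
  rewrite diracE in_setT mul1e /= => <-; congr f.
  by apply/rowP; case.
have mf := itg_meas itf.
pose F a x := f (consrV (a, x)).
pose P k (a : measurableTypeR R) := \int[torus n]_x (F a x * cos (int_dot k x)).
pose Q k (a : measurableTypeR R) := \int[torus n]_x (F a x * sin (int_dot k x)).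
have [aeF _ _] := Rint_torusS_itg itf.
have iP k : itg circle (P k).
  have [_ + _] := Rint_torusS_itg (itg_cos (consZ 0 k) itf).
  apply: eq_integrable => // a _ /=; congr EFin.
  by apply: eq_Rintegral => x _; rewrite int_dot_consZ mul0r add0r.
have iQ k : itg circle (Q k).
  have [_ + _] := Rint_torusS_itg (itg_sin (consZ 0 k) itf).
  apply: eq_integrable => // a _ /=; congr EFin.
  by apply: eq_Rintegral => x _; rewrite int_dot_consZ mul0r add0r.
have bcos (m : int) : bm (fun a : measurableTypeR R => cos (m%:~R * (a : R)) : R).
  split; last by exists 1 => x; exact: cos_max.
  by apply: continuous_measurable_fun => x; exact: continuous_cos_scale.
have bsin (m : int) : bm (fun a : measurableTypeR R => sin (m%:~R * (a : R)) : R).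
  split; last by exists 1 => x; exact: sin_max.
  by apply: continuous_measurable_fun => x; exact: continuous_sin_scale.
have iPc k m : itg circle (fun a => P k a * cos (m%:~R * a)) by exact: itgM (iP k) (bcos m).
have iPs k m : itg circle (fun a => P k a * sin (m%:~R * a)) by exact: itgM (iP k) (bsin m).
have iQc k m : itg circle (fun a => Q k a * cos (m%:~R * a)) by exact: itgM (iQ k) (bcos m).
have iQs k m : itg circle (fun a => Q k a * sin (m%:~R * a)) by exact: itgM (iQ k) (bsin m).
(* The addition formulas give only a difference, and below a sum, of the integrals with [P] and [Q];
   replacing [m] by [- m] flips one sign and separates them. *)
have Ec k m : \int[circle]_a (P k a * cos (m%:~R * a)) -
    \int[circle]_a (Q k a * sin (m%:~R * a)) = 0.
  rewrite -RintB// -[RHS](fc (consZ m k)).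
  have [_ iI ->] := Rint_torusS_itg (itg_cos (consZ m k) itf).
  apply: ae_eq_Rint; [exact: itg_meas (itgB (iPc k m) (iQs k m))|exact: itg_meas iI|].
  apply: filterS aeF => a ia.
  under [RHS]eq_Rintegral do rewrite int_dot_consZ cosD.
  rewrite /P /Q -!RintegralZr//; [|exact: itg_sin|exact: itg_cos].
  rewrite -RintB; [|by under eq_fun do rewrite mulrC; exact/itgZ/itg_cos|
                    by under eq_fun do rewrite mulrC; exact/itgZ/itg_sin].
  by apply: eq_Rintegral => x _; rewrite /F; ring.
have Es k m : \int[circle]_a (P k a * sin (m%:~R * a)) +
    \int[circle]_a (Q k a * cos (m%:~R * a)) = 0.
  rewrite -RintD// -[RHS](fs (consZ m k)).
  have [_ iI ->] := Rint_torusS_itg (itg_sin (consZ m k) itf).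
  apply: ae_eq_Rint; [exact: itg_meas (itgD (iPs k m) (iQc k m))|exact: itg_meas iI|].
  apply: filterS aeF => a ia.
  under [RHS]eq_Rintegral do rewrite int_dot_consZ sinD.
  rewrite /P /Q -!RintegralZr//; [|exact: itg_sin|exact: itg_cos].
  rewrite -RintD; [|by under eq_fun do rewrite mulrC; exact/itgZ/itg_cos|
                    by under eq_fun do rewrite mulrC; exact/itgZ/itg_sin].
  by apply: eq_Rintegral => x _; rewrite /F; ring.
have cN (p : R -> R) m : \int[circle]_a (p a * cos ((- m)%:~R * a)) =
    \int[circle]_a (p a * cos (m%:~R * a)).
  by apply: eq_Rintegral => a _; rewrite mulrNz mulNr cosN.
have sN (p : R -> R) m : itg circle (fun a => p a * sin (m%:~R * a)) ->
    \int[circle]_a (p a * sin ((- m)%:~R * a)) =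
    - \int[circle]_a (p a * sin (m%:~R * a)).
  move=> ip; have := RintZ (-1) ip; rewrite mulN1r => <-; apply: eq_Rintegral => a _.
  by rewrite mulrNz mulNr sinN mulN1r mulrN.
have P0 k : {ae circle, forall a, P k a = 0}.
  apply: circle_uniq; first exact: iP.
    move=> m; have := Ec k (- m); rewrite cN sN// opprK => h.
    by have [] := addB_eq0 (Ec k m) h.
  move=> m; have := Es k (- m); rewrite cN sN// addrC => h.
  by have [] := addB_eq0 h (etrans (addrC _ _) (Es k m)).
have Q0 k : {ae circle, forall a, Q k a = 0}.
  apply: circle_uniq; first exact: iQ.
    move=> m; have := Es k (- m); rewrite cN sN// addrC => h.
    by have [] := addB_eq0 h (etrans (addrC _ _) (Es k m)).
  move=> m; have := Ec k (- m); rewrite cN sN// opprK => h.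
  by have [] := addB_eq0 (Ec k m) h.
(* Frequencies are countable, so a single null set of slices serves for all of them. *)
have PQ0 : {ae circle, forall a, forall i : nat,
    oapp (fun k : 'rV[int]_n => P k a = 0 /\ Q k a = 0) True (pickle_inv i)}.
  apply: ae_foralln => i; case: pickle_inv => [k|] /=; last exact: aeW.
  by apply: filterS2 (P0 k) (Q0 k) => a -> ->.
have F0 : {ae circle, forall a, {ae torus n, forall x, F a x = 0}}.
  apply: filterS2 aeF PQ0 => a ia Ha; apply: IH => // k.
    by have := Ha (pickle k); rewrite pickleK_inv/= => -[].
  by have := Ha (pickle k); rewrite pickleK_inv/= => -[].
have mabs : measurable_fun setT (fun x => `|f x|%:E).
  by apply/measurable_EFinP; exact: measurableT_comp.
have mFc : measurable_fun setT (f \o @consrV R n).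
  by apply: measurableT_comp => //; exact: measurable_consrV.
have : (\int[torus n.+1]_x `|(EFin \o f) x| = 0)%E.
  rewrite integral_torusS// fubini_tonelli1//=; last first.
    by apply/measurable_EFinP; exact: measurableT_comp.
  rewrite -[RHS](integral0 circle setT); apply: ae_eq_integral => //.
    apply: measurable_fun_fubini_tonelli_F => //.
    by apply/measurable_EFinP; exact: measurableT_comp.
  apply: filterS F0 => a Fa _; rewrite /fubini_F.
  rewrite -[RHS](integral0 (torus n) setT); apply: ae_eq_integral => //.
    apply/measurable_EFinP; apply: measurableT_comp => //.
    exact: (measurableT_comp mFc).
  by apply: filterS Fa => x; rewrite /F => -> _ /=; rewrite normr0.
move/ae_eq_integral_abs => /(_ measurableT)/(_ (proj2 (measurable_EFinP _ _) mf)).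
by apply: filterS => x /(_ I)[].
Qed.

End torus_uniqueness.

Section inversion.
Context {R : realType} {d : nat}.

(** The function and the sum of its Fourier series are integrable with the same coefficients. The
    parity needed to read coefficients off the series holds because [f] is real. *)
Lemma Fourier_inversion (f : 'rV[R]_d -> R) : itg (torus d) f ->
  gsummable (amp f) ->
  {ae torus d, forall x, f x = trig (ccoef f) (scoef f) x}.
Proof.
move=> itf sf.
have sf' : gsummable (fun k => nrm2 (ccoef f k) (scoef f k)) by exact: sf.
have it : itg (torus d) (trig (ccoef f) (scoef f)) by exact/bm_itg/bm_trig.
have avg0 (h : 'rV[R]_d -> R) : avg h = 0 -> \int[torus d]_x h x = 0.
  by move=> /eqP; rewrite /avg mulf_eq0 invr_eq0 gt_eqF ?volume_gt0//= => /eqP.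
have : {ae torus d, forall x, (f \- trig (ccoef f) (scoef f)) x = 0}.
  have cN l : ccoef f (- l) = ccoef f l by exact: ccoefN.
  have sN l : scoef f (- l) = - scoef f l by exact: scoefN.
  apply: torus_uniq => [|k|k]; first exact: itgB.
    by apply: avg0; rewrite -/(ccoef _ k) ccoefB// ccoef_trig// subrr.
  by apply: avg0; rewrite -/(scoef _ k) scoefB// scoef_trig// subrr.
by apply: filterS => x /eqP; rewrite subr_eq0 => /eqP.
Qed.

End inversion.

(** * Moment estimates for the nonlinearity *)

Section binomial_series.
Context {R : realType}.
Implicit Types (y z : R) (a N : nat).

Definition bin_sum a y N : R := \sum_(n < N) 'C(n + a, a)%:R * y ^+ n.

(** Pascal's rule: multiplication by 1 - y lowers [a] by one, up to a boundary term. Iterating gives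
    both the limit (1 - y)^-(a + 1) and, for y in [0, 1), a bound on every partial sum. *)
Lemma bin_sumS a y N :
  (1 - y) * bin_sum a.+1 y N = bin_sum a y N - 'C(N + a, a.+1)%:R * y ^+ N.
Proof.
rewrite /bin_sum; elim: N => [|N IH].
  by rewrite !big_ord0 mulr0 bin_small ?add0n// mul0r subr0.
rewrite !big_ord_recr/= mulrDr IH (_ : N.+1 + a = N + a.+1)%N; last by rewrite addSnnS.
by rewrite (addnS N a) binS natrD exprS; ring.
Qed.

Lemma bin_sum0 y N : (1 - y) * bin_sum 0 y N = 1 - y ^+ N.
Proof.
rewrite /bin_sum; elim: N => [|N IH]; first by rewrite big_ord0 expr0 subrr mulr0.
by rewrite big_ord_recr/= mulrDr IH bin0 exprS; ring.
Qed.

Lemma bin_sum_le a y N : 0 <= y < 1 -> bin_sum a y N <= (1 - y) ^- a.+1.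
Proof.
move=> /andP[y0 y1]; have y10 : 0 < 1 - y by rewrite subr_gt0.
elim: a => [|a IH].
  by rewrite expr1 -(ler_pM2l y10) bin_sum0 mulfV ?gt_eqF// gerBl exprn_ge0.
rewrite -(ler_pM2l y10) bin_sumS exprS invfM mulrA mulfV ?gt_eqF// mul1r.
by apply: le_trans IH; rewrite gerBl mulr_ge0 ?exprn_ge0.
Qed.

Lemma bin_term_cvg0 a y : `|y| < 1 ->
  'C(n + a, a)%:R * y ^+ n @[n --> \oo] --> (0 : R).
Proof.
move=> y1.
have h : cvgn (series (fun n => 'C(n + a, a)%:R * `|y| ^+ n)).
  apply: nondecreasing_is_cvgn.
    by apply: nondecreasing_series => i _ _; rewrite mulr_ge0 ?exprn_ge0.
  exists ((1 - `|y|) ^- a.+1) => _ [N _ <-].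
  by rewrite /series/= big_mkord; apply: bin_sum_le; rewrite normr_ge0.
have /cvgrPdist_lt hh := cvg_series_cvg_0 h.
apply/cvgrPdist_lt => e /hh; apply: filterS => n.
by rewrite !sub0r !normrN !normrM !normrX normr_id.
Qed.

Lemma bin_sum_cvg a y : `|y| < 1 -> bin_sum a y N @[N --> \oo] --> (1 - y) ^- a.+1.
Proof.
move=> y1; have y10 : 1 - y != 0.
  by rewrite subr_eq0 eq_sym; apply: contraTN y1 => /eqP ->; rewrite normr1 ltxx.
elim: a => [|a IH].
  rewrite (_ : bin_sum 0 y = fun N => (1 - y ^+ N) / (1 - y)); last first.
    by apply/funext => N; rewrite -bin_sum0 mulrAC mulfV// mul1r.
  rewrite expr1 -[X in _ --> X]mul1r; apply: cvgM; last exact: cvg_cst.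
  rewrite -[X in _ --> X]subr0; apply: cvgB; first exact: cvg_cst.
  exact: cvg_expr.
rewrite (_ : bin_sum a.+1 y = fun N => (bin_sum a y N - 'C(N + a, a.+1)%:R * y ^+ N) / (1 - y)).
  rewrite exprSr invfM; apply: cvgM; last exact: cvg_cst.
  rewrite -[X in _ --> X]subr0; apply: cvgB; first exact: IH.
  rewrite -(cvg_shiftS (fun N => 'C(N + a, a.+1)%:R * y ^+ N))/=.
  rewrite (_ : (fun n => _) = fun n => y * ('C(n + a.+1, a.+1)%:R * y ^+ n)).
    have : y * ('C(n + a.+1, a.+1)%:R * y ^+ n) @[n --> \oo] --> y * 0.
      by apply: cvgM; [exact: cvg_cst|exact: bin_term_cvg0].
    by rewrite mulr0.
  by apply/funext => n; rewrite addSnnS exprS; ring.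
by apply/funext => N; rewrite -bin_sumS mulrAC mulfV// mul1r.
Qed.

Definition pcoef n : R := 'C(n + 2, 2)%:R.

Lemma pcoef_mul n : pcoef n.+1 * n.+1%:R = 3 * 'C(n + 3, 3)%:R.
Proof.
rewrite /pcoef -!natrM; congr _%:R; rewrite mulnC.
by have := mul_bin_left (n + 3) 2; rewrite addSnnS => ->; congr (_ * _)%N; lia.
Qed.

Lemma bin_shift_sum_le b z M : 0 <= z < 1 ->
  \sum_(m < M) 'C(m + 3, 3 + b)%:R * z ^+ m <= z ^+ b * (1 - z) ^- (4 + b).
Proof.
move=> /andP[z0 z1].
apply: (@le_trans _ _ (\sum_(m < b + M) 'C(m + 3, 3 + b)%:R * z ^+ m)).
  rewrite (addnC b M) big_split_ord/= lerDl sumr_ge0// => i _.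
  by rewrite mulr_ge0 ?exprn_ge0.
rewrite big_split_ord/= big1 ?add0r; last first.
  by move=> i _; rewrite bin_small ?mul0r//; have := ltn_ord i; lia.
rewrite (eq_bigr (fun i : 'I_M => z ^+ b * ('C(i + (3 + b), 3 + b)%:R * z ^+ i))).
  rewrite -mulr_sumr ler_wpM2l ?exprn_ge0//.
  by have := @bin_sum_le (3 + b) z M; rewrite z0 z1; apply.
move=> i _; rewrite exprD (_ : b + i + 3 = i + (3 + b))%N; last lia.
by ring.
Qed.

(** A polynomial weight in [m] is summed by expanding it in falling factorials; these turn 'C(m + 3,
    3) into higher binomials, whose generating series are explicit. *)
Lemma falling_bin (m : nat) :
  [/\ (m%:R * 'C(m + 3, 3)%:R = 4 * 'C(m + 3, 4)%:R :> R),
      ((m%:R * (m%:R - 1)) * 'C(m + 3, 3)%:R = 20 * 'C(m + 3, 5)%:R :> R) &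
      ((m%:R * (m%:R - 1) * (m%:R - 2)) * 'C(m + 3, 3)%:R = 120 * 'C(m + 3, 6)%:R :> R)].
Proof.
have e4 : (m * 'C(m + 3, 3) = 4 * 'C(m + 3, 4))%N.
  by rewrite (mul_bin_left (m + 3) 3); congr (_ * _)%N; lia.
have e5 : ((m - 1) * 'C(m + 3, 4) = 5 * 'C(m + 3, 5))%N.
  by rewrite (mul_bin_left (m + 3) 4); congr (_ * _)%N; lia.
have e6 : ((m - 2) * 'C(m + 3, 5) = 6 * 'C(m + 3, 6))%N.
  by rewrite (mul_bin_left (m + 3) 5); congr (_ * _)%N; lia.
have r4 : m%:R * 'C(m + 3, 3)%:R = 4 * 'C(m + 3, 4)%:R :> R by rewrite -!natrM e4.
have r5 : (m%:R - 1) * 'C(m + 3, 4)%:R = 5 * 'C(m + 3, 5)%:R :> R.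
  case: m e5 {e4 e6 r4} => [_|m e5]; first by rewrite !bin_small// !mulr0.
  by rewrite -natrM -e5 natrM natrB.
have r6 : (m%:R - 2) * 'C(m + 3, 5)%:R = 6 * 'C(m + 3, 6)%:R :> R.
  case: m e6 {e4 e5 r4 r5} => [|[|m]] e6; [by rewrite !bin_small// !mulr0..|].
  by rewrite -natrM -e6 natrM natrB.
split => //; first by rewrite mulrAC r4 -mulrA [_ * (_ - 1)]mulrC r5; ring.
rewrite (_ : _ * _ = (m%:R - 2) * ((m%:R - 1) * (m%:R * 'C(m + 3, 3)%:R))); last by ring.
rewrite r4 (_ : _ * _ = 4 * ((m%:R - 2) * ((m%:R - 1) * 'C(m + 3, 4)%:R))); last by ring.
rewrite r5 (_ : _ * _ = 20 * ((m%:R - 2) * 'C(m + 3, 5)%:R)); last by ring.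
by rewrite r6; ring.
Qed.

Lemma delta_series z M : 0 <= z < 1 ->
  \sum_(m < M) pcoef m.+1 * m.+1%:R ^+ 4 * z ^+ m <= 6 - delta z.
Proof.
move=> z01; have /andP[z0 z1] := z01.
(* By [pcoef_mul] one factor m + 1 is absorbed into 3 'C(m + 3, 3). The rest is (m + 1)^3 = 1 + 7 m
   + 6 m (m - 1) + m (m - 1) (m - 2), whence 84 = 3.7.4, 360 = 3.6.20 and 360 = 3.120; dividing by 3
   gives the constants 28, 120, 120 of [delta]. *)
rewrite (eq_bigr (fun m : 'I_M => 3 * ('C(m + 3, 3 + 0)%:R * z ^+ m) +
    84 * ('C(m + 3, 3 + 1)%:R * z ^+ m) + 360 * ('C(m + 3, 3 + 2)%:R * z ^+ m) +
    360 * ('C(m + 3, 3 + 3)%:R * z ^+ m))); last first.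
  move=> m _; have [r4 r5 r6] := falling_bin m.
  rewrite exprS mulrA pcoef_mul.
  rewrite (_ : 84 = 21 * 4); last by ring.
  rewrite (_ : 360 = 18 * 20); last by ring.
  rewrite {2}(_ : 18 * 20 = 3 * 120); last by ring.
  rewrite -!(mulrA _ _ (_ * _)) !(mulrA (_ : R) _ (z ^+ m)) -r4 -r5 -r6 -natr1.
  by ring.
rewrite !big_split/= -!mulr_sumr.
have h b := bin_shift_sum_le b M z01.
apply: (@le_trans _ _ (3 * (z ^+ 0 * (1 - z) ^- 4) + 84 * (z ^+ 1 * (1 - z) ^- 5) +
  360 * (z ^+ 2 * (1 - z) ^- 6) + 360 * (z ^+ 3 * (1 - z) ^- 7))).
  apply: lerD; [apply: lerD; [apply: lerD|]|]; (apply: ler_wpM2l; first exact: ler0n).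
  - exact: (h 0%N).
  - exact: (h 1%N).
  - exact: (h 2%N).
  - exact: (h 3%N).
rewrite le_eqVlt; apply/orP; left; apply/eqP; rewrite /delta.
by field; rewrite subr_eq0 gt_eqF.
Qed.

End binomial_series.

(** * Unordered sums and convolutions on the lattice *)

Section esum_complements.
Context {R : realType}.
Local Open Scope ereal_scope.

Lemma esum_swap (G H : choiceType) (a : G -> H -> \bar R) :
  (forall k l, 0 <= a k l) ->
  \esum_(k in [set: G]) \esum_(l in [set: H]) a k l =
  \esum_(l in [set: H]) \esum_(k in [set: G]) a k l.
Proof.
move=> a0; rewrite !esum_esum//.
rewrite (@reindex_esum R _ _ ([set: H] `*`` (fun=> [set: G]))
  ([set: G] `*`` (fun=> [set: H])) (fun x => (x.2, x.1)))//.
split; [by []|by move=> [x y] [x' y'] _ _ [-> ->]|].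
by move=> [x y] _; exists (y, x).
Qed.

Lemma le_esumZ (G : choiceType) (x : \bar R) (a : G -> \bar R) :
  0 <= x -> (forall k, 0 <= a k) ->
  \esum_(k in [set: G]) (x * a k) <= x * \esum_(k in [set: G]) a k.
Proof.
move=> x0 a0; apply: ge_ereal_sup => _ [X [fX _]] <-.
rewrite -ge0_mule_fsumr//; apply: lee_wpmul2l => //.
by apply: ereal_sup_ubound; exists X.
Qed.

(** Lower semicontinuity, as in Fatou's lemma: finite partial sums pass to the limit and the bound
    is inherited by their supremum. It transfers estimates from polynomial truncations to N and from
    iterates to their limit. *)
Lemma esum_lsc (G : choiceType) (a_ : nat -> G -> R) (a : G -> R) (B : \bar R) :
  (forall k, a_ n k @[n --> \oo] --> a k) ->
  (forall n, \esum_(k in [set: G]) (a_ n k)%:E <= B) ->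
  \esum_(k in [set: G]) (a k)%:E <= B.
Proof.
move=> aa aB; apply: ge_ereal_sup => _ [X [fX _]] <-.
rewrite fsbig_finite//= sumEFin; set s := finmap.enum_fset _.
case: B aB => [b| |] aB; last 2 first.
- by rewrite leey.
- have h : 0 <= \esum_(k in [set: G]) (a_ 0%N k)%:E.
    by apply: ereal_sup_ubound; exists set0; [exact: fsets_set0|rewrite fsbig_set0].
  by have := le_trans h (aB 0%N).
rewrite lee_fin.
have cv : (\sum_(k <- s) a_ n k)%R @[n --> \oo] --> (\sum_(k <- s) a k)%R.
  exact: cvg_big_sum.
rewrite -(cvg_lim (@Rhausdorff R) cv); apply: limr_le; first exact: cvgP cv.
apply: nearW => n; rewrite -lee_fin; apply: le_trans (aB n).
apply: ereal_sup_ubound; exists X => //.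
by rewrite fsbig_finite//= sumEFin.
Qed.

Context {d : nat}.
Local Notation G := 'rV[int]_d.
Implicit Types A B : G -> \bar R.

Definition econv A B (k : G) : \bar R := \esum_(l in [set: G]) (A l * B (k - l)%R).

Lemma econv_ge0 A B k : (forall k, 0 <= A k) -> (forall k, 0 <= B k) -> 0 <= econv A B k.
Proof. by move=> A0 B0; apply: esum_ge0 => l _; rewrite mule_ge0. Qed.

(** Tonelli and a translation in [k] reduce the left side to a double sum over the two arguments;
    when the weight of a sum splits into products, the double sum factorises. The weight 1 gives
    submultiplicativity, a power of a subadditive weight gives the moment estimates. *)
Lemma econv_weight (I : choiceType) (r : seq I) (w : G -> R) (p q : I -> G -> R) A B :
  (forall k, 0 <= w k)%R -> (forall i k, 0 <= p i k)%R -> (forall i k, 0 <= q i k)%R ->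
  (forall k, 0 <= A k) -> (forall k, 0 <= B k) ->
  (forall k l, w (k + l) <= \sum_(i <- r) p i l * q i k)%R ->
  \esum_(k in [set: G]) ((w k)%:E * econv A B k) <=
  \sum_(i <- r) ((\esum_(k in [set: G]) ((p i k)%:E * A k)) *
                 (\esum_(k in [set: G]) ((q i k)%:E * B k))).
Proof.
move=> w0 p0 q0 A0 B0 wpq.
have wE k : (w k)%:E * econv A B k =
    \esum_(l in [set: G]) ((w k)%:E * (A l * B (k - l)%R)).
  by rewrite esumZl// => l; rewrite mule_ge0.
under eq_esum do rewrite wE.
rewrite esum_swap; last by move=> k l; rewrite !mule_ge0// lee_fin.
have shiftE l : \esum_(k in [set: G]) ((w k)%:E * (A l * B (k - l)%R)) =
    \esum_(k in [set: G]) ((w (k + l)%R)%:E * (A l * B k)).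
  rewrite (@reindex_esum R G G setT setT (fun k => (k + l)%R)).
    by apply: eq_esum => k _; rewrite addrK.
  split; [by []|by move=> x y _ _; exact: addIr|].
  by move=> y _; exists (y - l)%R => //; rewrite subrK.
under eq_esum do rewrite shiftE.
apply: (@le_trans _ _ (\esum_(l in [set: G]) \esum_(k in [set: G])
   \sum_(i <- r) (((p i l)%:E * A l) * ((q i k)%:E * B k)))).
  apply: le_esum => l _; apply: le_esum => k _.
  apply: (@le_trans _ _ ((\sum_(i <- r) p i l * q i k)%:E * (A l * B k))).
    by apply: lee_wpmul2r; [rewrite mule_ge0|rewrite lee_fin].
  rewrite -sumEFin ge0_sume_distrl; last by move=> i _; rewrite lee_fin mulr_ge0.
  by apply: lee_sum => i _; rewrite EFinM muleACA.
have sumE l : \esum_(k in [set: G]) \sum_(i <- r) (((p i l)%:E * A l) * ((q i k)%:E * B k)) =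
    \sum_(i <- r) \esum_(k in [set: G]) (((p i l)%:E * A l) * ((q i k)%:E * B k)).
  by apply: esum_sum => k i _ _; rewrite !mule_ge0// lee_fin.
under eq_esum do rewrite sumE.
rewrite esum_sum; last first.
  by move=> l i _ _; apply: esum_ge0 => k _; rewrite !mule_ge0// lee_fin.
apply: lee_sum => i _.
apply: (@le_trans _ _ (\esum_(l in [set: G]) (((p i l)%:E * A l) *
    \esum_(k in [set: G]) ((q i k)%:E * B k)))).
  apply: le_esum => l _; apply: le_esumZ; first by rewrite mule_ge0// lee_fin.
  by move=> k; rewrite mule_ge0// lee_fin.
under eq_esum do rewrite muleC.
rewrite [leRHS]muleC; apply: le_esumZ; last by move=> k; rewrite mule_ge0// lee_fin.
by apply: esum_ge0 => k _; rewrite mule_ge0// lee_fin.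
Qed.

Lemma econv_norm A B : (forall k, 0 <= A k) -> (forall k, 0 <= B k) ->
  \esum_(k in [set: G]) econv A B k <=
  (\esum_(k in [set: G]) A k) * (\esum_(k in [set: G]) B k).
Proof.
move=> A0 B0.
have E (X : G -> \bar R) :
    \esum_(k in [set: G]) (1%:E * X k) = \esum_(k in [set: G]) X k.
  by apply: eq_esum => k _; rewrite mul1e.
rewrite -(E (econv A B)).
apply: le_trans (@econv_weight _ [:: tt] (fun=> 1%R) (fun _ _ => 1%R)
  (fun _ _ => 1%R) A B _ _ _ A0 B0 _) _ => //.
  by move=> k l; rewrite big_seq1 mul1r.
by rewrite big_seq1 !E.
Qed.

End esum_complements.

(** * Moments of convolutions *)

Section moments.
Context {R : realType} {d : nat}.
Local Notation G := 'rV[int]_d.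
Variable m : G -> R.
Hypothesis m0 : forall k, 0 <= m k.
Hypothesis mD : forall k l, m (k + l) <= m k + m l.
Implicit Types A B : G -> \bar R.

Definition moment j A : \bar R := (\esum_(k in [set: G]) ((m k ^+ j)%:E * A k))%E.

Lemma le_moment j A B : (forall k, A k <= B k)%E -> (moment j A <= moment j B)%E.
Proof.
move=> AB; apply: le_esum => k _; apply: lee_wpmul2l => //.
by rewrite lee_fin exprn_ge0.
Qed.

(** Up to order 4, the moments are at most those of a mass [a] concentrated where the weight equals
    [b]. *)
Definition homogeneous A (a b : R) := forall j, (j < 5)%N -> (moment j A <= (a * b ^+ j)%:E)%E.

(** Masses multiply and weights add: subadditivity bounds the weight of a sum, and the binomial
    theorem for its j-th power reassembles into (b + b')^j. *)
Lemma homogeneous_econv A B a b a' b' :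
  (forall k, 0 <= A k)%E -> (forall k, 0 <= B k)%E -> 0 <= a -> 0 <= b -> 0 <= a' -> 0 <= b' ->
  homogeneous A a b -> homogeneous B a' b' ->
  homogeneous (econv A B) (a * a') (b + b').
Proof.
move=> A0 B0 a0 b0 a'0 b'0 hA hB j j5.
apply: le_trans (@econv_weight _ _ _ (index_enum 'I_j.+1) (fun k => m k ^+ j)
  (fun i k => m k ^+ (j - i)) (fun i k => 'C(j, i)%:R * m k ^+ i) A B _ _ _ A0 B0 _) _.
- by move=> k; rewrite exprn_ge0.
- by move=> i k; rewrite exprn_ge0.
- by move=> i k; rewrite mulr_ge0// exprn_ge0.
- move=> k l; apply: (@le_trans _ _ ((m l + m k) ^+ j)).
    by rewrite lerXn2r ?nnegrE ?addr_ge0// addrC.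
  by rewrite exprDn; apply: ler_sum => i _; rewrite -mulr_natl; nra.
apply: (@le_trans _ _ (\sum_(i < j.+1) ((a * b ^+ (j - i)) *
    ('C(j, i)%:R * (a' * b' ^+ i)))%:E)%E).
  apply: lee_sum => i _; rewrite EFinM; apply: lee_pmul.
  - by apply: esum_ge0 => k _; rewrite mule_ge0// lee_fin exprn_ge0.
  - by apply: esum_ge0 => k _; rewrite mule_ge0// lee_fin mulr_ge0// exprn_ge0.
  - by apply: hA; rewrite ltnS in j5 *; exact: leq_trans (leq_subr _ _) j5.
  - under eq_esum do rewrite EFinM -muleA.
    rewrite esumZl//; last by move=> k; rewrite mule_ge0// lee_fin exprn_ge0.
    rewrite EFinM; apply: lee_wpmul2l; first by rewrite lee_fin.
    by apply: hB; apply: leq_ltn_trans j5; rewrite -ltnS.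
rewrite sumEFin lee_fin exprDn mulr_sumr; apply: ler_sum => i _.
by rewrite le_eqVlt -mulr_natl; apply/orP; left; apply/eqP; ring.
Qed.

Lemma young4 (x y : R) j : 0 <= x -> 0 < y -> (j < 5)%N ->
  x ^+ j <= (j%:R / 4 * y ^+ j / y ^+ 4) * x ^+ 4 + ((4 - j%:R) / 4) * y ^+ j.
Proof.
move=> x0 y0.
suff h j' (i : nat) : (i + j' = 4)%N ->
    4 * (x ^+ j' * y ^+ i) <= j'%:R * x ^+ 4 + i%:R * y ^+ 4 ->
    x ^+ j' <= (j'%:R / 4 * y ^+ j' / y ^+ 4) * x ^+ 4 + ((4 - j'%:R) / 4) * y ^+ j'.
  case: j => [|[|[|[|[|//]]]]] _.
  - apply: (h _ 4%N) => //; rewrite expr0; lra.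
  - apply: (h _ 3%N) => //.
    (* Factorisation of Young's inequality: x^4 + 3 y^4 - 4 x y^3 = (x - y)^2 (x^2 + 2 x y + 3 y^2).
       The case j = 3 is symmetric. *)
    have := mulr_ge0 (sqr_ge0 (x - y)) (_ : 0 <= x ^+ 2 + 2 * x * y + 3 * y ^+ 2).
    by move=> /(_ ltac:(nra)); lra.
  - apply: (h _ 2%N) => //; have := sqr_ge0 (x ^+ 2 - y ^+ 2); nra.
  - apply: (h _ 1%N) => //.
    have := mulr_ge0 (sqr_ge0 (x - y)) (_ : 0 <= 3 * x ^+ 2 + 2 * x * y + y ^+ 2).
    by move=> /(_ ltac:(nra)); lra.
  - apply: (h _ 0%N) => //; rewrite expr0; lra.
move=> ij hh.
have yi : 0 < y ^+ i by rewrite exprn_gt0.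
rewrite -(ler_pM2r yi) -(ler_pM2l (_ : 0 < 4))//.
apply: le_trans hh _; rewrite le_eqVlt; apply/orP; left; apply/eqP.
have -> : y ^+ 4 = y ^+ i * y ^+ j' by rewrite -exprD ij.
have -> : i%:R = 4 - j'%:R :> R by rewrite -[4]/(4%:R) -ij natrD addrK.
by field; rewrite !gt_eqF// exprn_gt0.
Qed.

(** Interpolation in linearised form: Young's inequality at the fixed point rho bounds m^j by a
    combination of m^4 and 1, which can be summed against [A]; with mass z and fourth moment z rho^4
    the right side is exactly z rho^j. *)
Lemma homogeneous_interp A z rho : (forall k, 0 <= A k)%E -> 0 <= z -> 0 < rho ->
  (\esum_(k in [set: G]) A k <= z%:E)%E -> (moment 4 A <= (z * rho ^+ 4)%:E)%E ->
  homogeneous A z rho.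
Proof.
move=> A0 z0 rho0 hA h4 j j5.
set c1 := (j%:R / 4 * rho ^+ j / rho ^+ 4); set c2 := ((4 - j%:R) / 4) * rho ^+ j.
have j4 : j%:R <= 4 :> R by rewrite ler_nat.
have c10 : 0 <= c1 by rewrite /c1 !mulr_ge0 ?invr_ge0 ?exprn_ge0// ltW.
have c20 : 0 <= c2 by rewrite /c2 !mulr_ge0 ?invr_ge0 ?exprn_ge0 ?subr_ge0// ltW.
apply: (@le_trans _ _ (\esum_(k in [set: G]) (c1%:E * ((m k ^+ 4)%:E * A k) + c2%:E * A k))%E).
  apply: le_esum => k _; have mk4 : 0 <= m k ^+ 4 by rewrite exprn_ge0.
  rewrite muleA -EFinM -ge0_muleDl; [|by rewrite lee_fin mulr_ge0|by rewrite lee_fin].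
  by apply: lee_wpmul2r => //; rewrite -EFinD lee_fin; exact: young4.
rewrite esumD; [|by move=> k _; rewrite !mule_ge0// lee_fin ?exprn_ge0..].
rewrite !esumZl//; last by move=> k; rewrite mule_ge0// lee_fin exprn_ge0.
apply: (@le_trans _ _ (c1%:E * (z * rho ^+ 4)%:E + c2%:E * z%:E)%E).
  by apply: leeD; apply: lee_wpmul2l => //; rewrite lee_fin.
rewrite -!EFinM -EFinD lee_fin le_eqVlt; apply/orP; left; apply/eqP.
by rewrite /c1 /c2; field; rewrite gt_eqF.
Qed.

End moments.

(** * The nonlinearity on Fourier coefficients *)

Section nonlinearity.
Context {R : realType} {d : nat}.
Local Notation G := 'rV[int]_d.
Local Notation F := ('rV[R]_d -> R).
Local Notation itg := (@itg _ _ R (torus d)).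
Implicit Types (f g : F) (A D : G -> \bar R).

Definition eamp f (k : G) : \bar R := (amp f k)%:E.

Lemma eamp_ge0 f k : (0 <= eamp f k)%E.
Proof. by rewrite lee_fin amp_ge0. Qed.

Lemma esum_eamp f : gsummable (amp f) ->
  (\esum_(k in [set: G]) eamp f k = (gsum (amp f))%:E)%E.
Proof. by move=> sf; rewrite gsum_esum// => k; exact: amp_ge0. Qed.

Lemma eamp_econv f g A D k : wien f -> itg g ->
  (forall k, eamp f k <= A k)%E -> (forall k, eamp g k <= D k)%E ->
  (eamp (f \* g)%R k <= econv A D k)%E.
Proof.
move=> wf ig fA gD; apply: le_trans (amp_mul k wf ig) _.
apply: le_esum => l _; rewrite EFinM.
apply: lee_pmul; [by rewrite lee_fin amp_ge0|by rewrite lee_fin amp_ge0|exact: fA|exact: gD].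
Qed.

Lemma ampB f g k : itg f -> itg g -> amp (f \- g) k <= amp f k + amp g k.
Proof.
move=> itf itg'; rewrite /amp ccoefB// scoefB//.
by apply: le_trans (nrm2D _ _ _ _) _; rewrite nrm2N.
Qed.

Lemma wienB f g : wien f -> wien g -> wien (f \- g).
Proof.
move=> wf wg; have [sf fE] := wf; have [sg gE] := wg.
have itf := wien_itg wf; have ig := wien_itg wg.
split.
  apply: le_gsummable (gsummableD sf sg) => k /=.
  rewrite !ger0_norm ?addr_ge0 ?amp_ge0//; exact: ampB.
apply/funext => x /=; rewrite {1}fE {1}gE /trig.
rewrite -gsumN; last exact: (trig_summable sg x).
rewrite -gsumD; last 2 first.
- exact: (trig_summable sf x).
- apply: le_gsummable (trig_summable sg x) => k; rewrite normrN//.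
by apply: eq_gsum => k /=; rewrite ccoefB// scoefB//; ring.
Qed.

Lemma amp_cst0 k : amp (fun _ : 'rV[R]_d => 0) k = 0.
Proof.
rewrite /amp /ccoef /scoef; under eq_avg do rewrite mul0r.
under [X in nrm2 _ X]eq_avg do rewrite mul0r.
by rewrite avg_cst nrm2_00.
Qed.

Lemma wien_cst0 : wien (fun _ : 'rV[R]_d => 0 : R).
Proof.
have s0 : gsummable (fun _ : G => 0 : R).
  by apply: le_gsummable (gsummable_single (0 : G) (0 : R)) => k; rewrite normr0.
split; first by rewrite (_ : amp _ = fun=> 0)//; apply/funext => k; exact: amp_cst0.
apply/funext => x; rewrite /trig.
rewrite (_ : gsum _ = gsum (fun k : G => 0 * 0)); first by rewrite gsumZ// mul0r.
apply: eq_gsum => k; rewrite mul0r /ccoef /scoef.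
under eq_avg do rewrite mul0r; under [X in _ + X * _]eq_avg do rewrite mul0r.
by rewrite avg_cst !mul0r addr0.
Qed.

Lemma amp_sum M (h : nat -> F) k : (forall i, itg (h i)) ->
  amp (fun x => \sum_(i < M) h i x) k <= \sum_(i < M) amp (h i) k.
Proof.
move=> ih; elim: M => [|M IH].
  by under [X in amp X _]eq_fun do rewrite big_ord0; rewrite amp_cst0 big_ord0.
under [X in amp X _]eq_fun do rewrite big_ord_recr/=.
rewrite big_ord_recr/=; apply: le_trans (ampD _ _ (ih M)) _; last by rewrite lerD2r.
elim: M {IH} => [|M IH].
  by under eq_fun do rewrite big_ord0; exact: bm_itg (bm_cst _ 0).
by under eq_fun do rewrite big_ord_recr/=; apply: itgD.
Qed.

Definition nl (y : R) : R := (1 + y) ^- 3 - 1 + 3 * y.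

Definition nl_poly M (y : R) : R := \sum_(i < M) ((- 1) ^+ i * pcoef i.+2) * y ^+ i.+2.

Lemma nl_poly_cvg y : `|y| < 1 -> nl_poly M y @[M --> \oo] --> nl y.
Proof.
move=> y1; have h : `|- y| < 1 by rewrite normrN.
(* The first two terms of the series of (1 + y)^-3 are 1 and - 3 y, those which N removes; hence the
   shift by 2. *)
have h2 : bin_sum 2 (- y) (M + 2) @[M --> \oo] --> (1 - - y) ^- 3.
  by rewrite (cvg_shiftn 2 (bin_sum 2 (- y))); exact: bin_sum_cvg.
rewrite (_ : (fun M => _) = fun M => bin_sum 2 (- y) (M + 2) - 1 + 3 * y).
  by rewrite /nl -[in (1 + y)](opprK y); apply: cvgD; [apply: cvgB|]; [exact: h2|exact: cvg_cst..].
apply/funext => M; rewrite addn2 /bin_sum !big_ord_recl/= /bump/=.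
rewrite expr0 expr1 !add0n (_ : 'C(2, 2) = 1%N)// (_ : 'C(1 + 2, 2) = 3%N)//.
rewrite (_ : \sum_(i < M) _ = nl_poly M y); first by ring.
rewrite /nl_poly; apply: eq_bigr => i _; rewrite /pcoef -[(1 + (1 + i))%N]/(i.+2).
have -> : (- y) ^+ i.+2 = (- 1) ^+ i * y ^+ i.+2.
  by rewrite (exprNn y i.+2) -[(- 1) ^+ i.+2]signr_odd /= negbK signr_odd.
rewrite mulrA [_%:R * _]mulrC; congr (_ * _ * _).
Qed.

Lemma norm_nl_le r y : `|y| <= r -> r < 1 -> `|nl y| <= (1 - r) ^- 3 + 1 + 3 * r.
Proof.
move=> yr r1; rewrite /nl; have := yr; rewrite ler_norml => /andP[y1 y2].
apply: le_trans (ler_normD _ _) _; apply: lerD; last first.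
  by rewrite normrM ger0_norm// ler_pM2l.
apply: le_trans (ler_normB _ _) _; rewrite normr1 lerD2r.
have y10 : 0 < 1 + y by lra.
rewrite ger0_norm ?invr_ge0 ?exprn_ge0 ?(ltW y10)//.
by rewrite lef_pV2 ?posrE ?exprn_gt0// ?subr_gt0//; apply: lerXn2r; rewrite ?nnegrE; lra.
Qed.

Lemma bm_nl_poly M f : bm f -> bm (nl_poly M \o f).
Proof. by move=> bf; apply: bm_sum => i; apply: bmZ; exact: bmX. Qed.

Lemma bm_nl f r : bm f -> (forall x, `|f x| <= r) -> r < 1 -> bm (nl \o f).
Proof.
move=> bf fr r1; split; last first.
  by exists ((1 - r) ^- 3 + 1 + 3 * r) => x; exact: norm_nl_le.
apply: (@measurable_fun_cvg _ _ _ _ (fun M => nl_poly M \o f)).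
  by move=> M; case: (bm_nl_poly M bf).
by move=> x _; apply: nl_poly_cvg; exact: le_lt_trans (fr x) r1.
Qed.

Lemma norm_nl_poly_le r y M : `|y| <= r -> r < 1 -> `|nl_poly M y| <= (1 - r) ^- 3.
Proof.
move=> yr r1; have r0 : 0 <= r := le_trans (normr_ge0 _) yr.
apply: le_trans (@bin_sum_le _ 2 r M.+2 _); last by rewrite r0.
apply: le_trans (ler_norm_sum _ _ _) _.
rewrite /bin_sum !big_ord_recl; apply: ler_wpDl; first by rewrite mulr_ge0 ?exprn_ge0.
apply: ler_wpDl; first by rewrite mulr_ge0 ?exprn_ge0.
apply: ler_sum => i _; rewrite normrM normrM normrX normrN1 expr1n mul1r normrX.
rewrite /pcoef ger0_norm//; apply: ler_wpM2l => //.
by rewrite lerXn2r ?nnegrE.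
Qed.

Lemma eamp_nl_cvg f r k : bm f -> (forall x, `|f x| <= r) -> r < 1 ->
  amp (nl_poly M \o f) k @[M --> \oo] --> amp (nl \o f) k.
Proof.
move=> bf fr r1; apply: (amp_cvg (M := (1 - r) ^- 3)).
- by move=> M; case: (bm_nl_poly M bf).
- by move=> M x; exact: norm_nl_poly_le.
- by move=> x; apply: nl_poly_cvg; exact: le_lt_trans (fr x) r1.
Qed.

Section weighted.
Variable m : G -> R.
Hypothesis m0 : forall k, 0 <= m k.
Hypothesis mD : forall k l, m (k + l) <= m k + m l.

(** In terms of moments, a power behaves like one wave of amplitude a^n and weight n b. At order 4
    this produces the factor n^4 in the series behind [delta]. *)
Lemma homogeneous_exp f a b n : wien f -> 0 <= a -> 0 <= b ->
  homogeneous m (eamp f) a b ->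
  homogeneous m (eamp (fun x => f x ^+ n.+1)) (a ^+ n.+1) (n.+1%:R * b).
Proof.
move=> wf a0 b0 hf; elim: n => [|n IH].
  by under [X in eamp X]eq_fun do rewrite expr1; rewrite expr1 mul1r.
have bX := bmX n.+1 (wien_bm wf).
have := homogeneous_econv m0 mD (eamp_ge0 f) (eamp_ge0 (fun x => f x ^+ n.+1)) a0 b0
  (exprn_ge0 n.+1 a0) (mulr_ge0 (ler0n _ _) b0) hf IH.
move=> H j j5; rewrite exprS (_ : n.+2%:R * b = b + n.+1%:R * b); last first.
  by rewrite -[n.+2%:R]natr1; ring.
apply: le_trans (H j j5); apply: (le_moment m0) => k.
rewrite (_ : (fun x => _) = f \* (fun x => f x ^+ n.+1)).
  by apply: eamp_econv => //; exact: bm_itg.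
by apply/funext => x; rewrite exprS.
Qed.

Lemma moment_sum j M (h : nat -> F) : (forall i, itg (h i)) ->
  (moment m j (eamp (fun x => (\sum_(i < M) h i x)%R)) <=
   \sum_(i < M) moment m j (eamp (h i)))%E.
Proof.
move=> ih; apply: (@le_trans _ _ (moment m j (fun k => \sum_(i < M) eamp (h i) k)%E)).
  by apply: (le_moment m0) => k; rewrite sumEFin lee_fin; exact: amp_sum.
rewrite /moment -esum_sum; last first.
  by move=> k i _ _; rewrite mule_ge0 ?eamp_ge0// lee_fin exprn_ge0.
by apply: le_esum => k _; rewrite ge0_sume_distrr// => i _; exact: eamp_ge0.
Qed.

(** The estimate is summed for the polynomial truncations of N, where the constant is a partial sum
    of the series of [delta], and passes to N by lower semicontinuity. The weight is an arbitrary
    subadditive one, so that truncated norms can be used. *)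
Lemma moment_nl f z S : wien f -> 0 < z < 1 -> 0 < S ->
  (\esum_(k in [set: G]) eamp f k <= z%:E)%E ->
  (moment m 4 (eamp f) <= S%:E)%E ->
  (moment m 4 (eamp (nl \o f)) <= ((3 - delta z) * S)%:E)%E.
Proof.
move=> wf /andP[z0 z1] S0 hz hS.
have fz x : `|f x| <= z.
  apply: le_trans (wien_norm_le x wf) _; rewrite -lee_fin -esum_eamp//.
  by case: wf.
(* The fourth root of S / z, for which a mass z at weight rho has fourth moment S. *)
pose rho := Num.sqrt (Num.sqrt (S / z)).
have Sz0 : 0 < S / z by rewrite divr_gt0.
have rho0 : 0 < rho by rewrite !sqrtr_gt0.
have rho4 : rho ^+ 4 = S / z.
  by rewrite (exprM _ 2 2) sqr_sqrtr ?sqrtr_ge0// sqr_sqrtr// ltW.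
have zr : z * rho ^+ 4 = S by rewrite rho4 mulrCA mulfV ?mulr1// gt_eqF.
have hf : homogeneous m (eamp f) z rho.
  by apply: homogeneous_interp => //; rewrite ?(ltW z0)// ?zr//; exact: eamp_ge0.
have bf := wien_bm wf.
have poly M : (moment m 4 (eamp (nl_poly M \o f)) <= ((3 - delta z) * S)%:E)%E.
  apply: le_trans (moment_sum 4 M (h := fun i x => ((- 1) ^+ i * pcoef i.+2) * f x ^+ i.+2) _) _.
    by move=> i; apply/bm_itg/bmZ/bmX.
  apply: (@le_trans _ _ (\sum_(i < M) (S * (pcoef i.+2 * i.+2%:R ^+ 4 * z ^+ i.+1))%:E)%E).
    apply: lee_sum => i _.
    have hX := homogeneous_exp i.+1 wf (ltW z0) (ltW rho0) hf (ltnSn 4).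
    apply: (@le_trans _ _ ((pcoef i.+2)%:E * moment m 4 (eamp (fun x => (f x ^+ i.+2)%R)))%E).
      rewrite /moment -esumZl//; last first.
        by move=> k; rewrite mule_ge0 ?eamp_ge0// lee_fin exprn_ge0.
      apply: le_esum => k _; rewrite /eamp /= ampZ; last exact/bm_itg/bmX.
      rewrite normrM normrX normrN1 expr1n mul1r ger0_norm//.
      by rewrite EFinM muleCA.
    apply: (@le_trans _ _ ((pcoef i.+2)%:E * (z ^+ i.+2 * (i.+2%:R * rho) ^+ 4)%:E)%E).
      by rewrite lee_wpmul2l// lee_fin.
    rewrite -EFinM lee_fin le_eqVlt; apply/orP; left; apply/eqP.
    by rewrite -zr exprMn [z ^+ i.+2]exprS; ring.
  rewrite sumEFin lee_fin -mulr_sumr mulrC ler_pM2r//.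
  (* The term m = 0 of that series is 3, the coefficient of the linear part which N does not
     contain; removing it leaves 3 - delta z. *)
  have := @delta_series _ z M.+1; rewrite big_ord_recl (ltW z0) z1 => /(_ isT).
  rewrite (_ : pcoef ord0.+1 = 3)// expr1n expr0 !mulr1 => h.
  by rewrite -(lerD2l 3); apply: le_trans h _; lra.
apply: (esum_lsc (a_ := fun M k => m k ^+ 4 * amp (nl_poly M \o f) k)).
  by move=> k; apply: cvgM; [exact: cvg_cst|exact: eamp_nl_cvg fz z1].
move=> M; apply: le_trans (poly M); rewrite le_eqVlt; apply/orP; left; apply/eqP.
by apply: eq_esum => k _; rewrite EFinM.
Qed.

End weighted.

Section lipschitz.
Variables (A D : G -> \bar R) (r s : R).
Hypothesis A0 : forall k, (0 <= A k)%E.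
Hypothesis D0 : forall k, (0 <= D k)%E.
Hypothesis r01 : 0 <= r < 1.
Hypothesis s0 : 0 <= s.
Hypothesis Ar : (\esum_(k in [set: G]) A k <= r%:E)%E.
Hypothesis Ds : (\esum_(k in [set: G]) D k <= s%:E)%E.

(** Majorants are built from [A] and [D] alone and not from the functions, so when these bound the
    coefficients at all times the result does too. The 0-th power is the coefficient family of the
    constant 1. *)
Fixpoint conv_pow n : G -> \bar R :=
  if n is n'.+1 then econv A (conv_pow n') else fun k => if k == 0 then 1%E else 0%E.

(* majorant of [f ^ n - g ^ n], from
   [f ^ n.+1 - g ^ n.+1 = (f - g) * f ^ n + g * (f ^ n - g ^ n)] *)
Fixpoint conv_pow_diff n : G -> \bar R :=
  if n is n'.+1 then
    fun k => (econv D (conv_pow n') k + econv A (conv_pow_diff n') k)%E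
  else fun _ => 0%E.

Definition nl_majorant (k : G) : \bar R :=
  (\esum_(i in [set: nat]) ((pcoef i.+2)%:E * conv_pow_diff i.+2 k))%E.

Lemma conv_pow_ge0 n k : (0 <= conv_pow n k)%E.
Proof.
elim: n k => [|n IH] k /=; first by case: ifP => //; rewrite lee_fin.
exact: econv_ge0.
Qed.

Lemma conv_pow_diff_ge0 n k : (0 <= conv_pow_diff n k)%E.
Proof.
elim: n k => [|n IH] k //=; rewrite adde_ge0// econv_ge0//.
exact: conv_pow_ge0.
Qed.

Lemma nl_majorant_ge0 k : (0 <= nl_majorant k)%E.
Proof. by apply: esum_ge0 => i _; rewrite mule_ge0 ?conv_pow_diff_ge0// lee_fin. Qed.

Lemma conv_pow_norm n : (\esum_(k in [set: G]) conv_pow n k <= (r ^+ n)%:E)%E.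
Proof.
have /andP[r0 _] := r01.
elim: n => [|n IH] /=.
  rewrite (esumID [set (0 : G)]); last by move=> k _; case: ifP => //; rewrite lee_fin.
  rewrite [X in (_ + X)%E]esum1 ?adde0; last by move=> k [_ /eqP/negbTE /= ->].
  by rewrite setTI esum_set1 eqxx ?lee_fin ?expr0.
apply: le_trans (econv_norm A0 (conv_pow_ge0 n)) _.
by rewrite exprS EFinM; apply: lee_pmul => //; apply: esum_ge0 => k _ //; exact: conv_pow_ge0.
Qed.

Lemma conv_pow_diff_norm n :
  (\esum_(k in [set: G]) conv_pow_diff n.+1 k <= (n.+1%:R * r ^+ n * s)%:E)%E.
Proof.
have /andP[r0 _] := r01.
have step n' B : (\esum_(k in [set: G]) conv_pow_diff n' k <= B%:E)%E ->
   (\esum_(k in [set: G]) conv_pow_diff n'.+1 k <= (s * r ^+ n' + r * B)%:E)%E.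
  move=> h; rewrite /= esumD; last 2 first.
  - by move=> k _; rewrite econv_ge0//; exact: conv_pow_ge0.
  - by move=> k _; rewrite econv_ge0//; exact: conv_pow_diff_ge0.
  rewrite EFinD; apply: leeD.
    apply: le_trans (econv_norm D0 (conv_pow_ge0 n')) _.
    rewrite EFinM; apply: lee_pmul => //; last exact: conv_pow_norm.
      by apply: esum_ge0.
    by apply: esum_ge0 => k _; exact: conv_pow_ge0.
  apply: le_trans (econv_norm A0 (conv_pow_diff_ge0 n')) _.
  rewrite EFinM; apply: lee_pmul => //; first by apply: esum_ge0.
  by apply: esum_ge0 => k _; exact: conv_pow_diff_ge0.
elim: n => [|n IH].
  apply: le_trans (step 0%N 0 _) _; first by rewrite /= esum1.
  by rewrite lee_fin; lra.
apply: le_trans (step n.+1 _ IH) _; rewrite lee_fin le_eqVlt; apply/orP; left; apply/eqP.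
by rewrite -[n.+2%:R]natr1 exprS; ring.
Qed.

(** Summing [conv_pow_diff_norm] gives the derivative at [r] of the majorant series of N, that is
    the sum over n >= 2 of 'C(n + 2, 2) n r^(n - 1). By [pcoef_mul] it is the series of 3 (1 - r)^-4
    without its constant term 3. *)
Lemma nl_majorant_norm :
  (\esum_(k in [set: G]) nl_majorant k <= ((3 * (1 - r) ^- 4 - 3) * s)%:E)%E.
Proof.
have /andP[r0 r1] := r01.
rewrite /nl_majorant esum_swap; last first.
  by move=> k i; rewrite mule_ge0 ?conv_pow_diff_ge0// lee_fin.
rewrite -nneseries_esumT; last first.
  by move=> i; apply: esum_ge0 => k _; rewrite mule_ge0 ?conv_pow_diff_ge0// lee_fin.
apply: lime_le.
  apply: is_cvg_nneseries => i _ _; apply: esum_ge0 => k _.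
  by rewrite mule_ge0 ?conv_pow_diff_ge0// lee_fin.
apply: nearW => M; rewrite big_mkord.
apply: (@le_trans _ _ (\sum_(i < M) (s * (pcoef i.+2 * i.+2%:R * r ^+ i.+1))%:E)%E).
  apply: lee_sum => i _.
  rewrite esumZl//; last by move=> k; exact: conv_pow_diff_ge0.
  apply: (@le_trans _ _ ((pcoef i.+2)%:E * (i.+2%:R * r ^+ i.+1 * s)%:E)%E).
    by apply: lee_wpmul2l; [rewrite lee_fin|exact: conv_pow_diff_norm].
  by rewrite -EFinM lee_fin le_eqVlt; apply/orP; left; apply/eqP; ring.
rewrite sumEFin lee_fin -mulr_sumr [leRHS]mulrC ler_wpM2l//.
have := @bin_shift_sum_le _ 0 r M.+1 r01; rewrite big_ord_recl expr0 mul1r !addn0.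
rewrite (_ : 'C(ord0 + 3, 3) = 1%N)// mul1r => h.
rewrite (eq_bigr (fun i : 'I_M => 3 * ('C(lift ord0 i + 3, 3)%:R * r ^+ lift ord0 i))); last first.
  by move=> i _; rewrite pcoef_mul mulrA.
by rewrite -mulr_sumr; move: h; lra.
Qed.

Lemma eamp_exp_le f n k : wien f -> (forall k, eamp f k <= A k)%E ->
  (eamp (fun x => (f x ^+ n)%R) k <= conv_pow n k)%E.
Proof.
move=> wf fA; elim: n k => [|n IH] k /=.
  rewrite /eamp /amp /ccoef /scoef.
  under eq_avg do rewrite expr0 mul1r.
  under [X in nrm2 _ X]eq_avg do rewrite expr0 mul1r.
  rewrite (avg_trig k).1 (avg_trig k).2 /nrm2 [0 ^+ 2]expr0n addr0 sqrtr_sqr.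
  by case: (k == 0); rewrite ?normr1 ?normr0.
rewrite (_ : (fun x => _) = f \* (fun x => f x ^+ n)).
  by apply: eamp_econv => //; apply/bm_itg/bmX/wien_bm.
by apply/funext => x; rewrite exprS.
Qed.

Lemma eamp_exp_diff_le f g n k : wien f -> wien g ->
  (forall k, eamp f k <= A k)%E -> (forall k, eamp g k <= A k)%E ->
  (forall k, eamp (f \- g)%R k <= D k)%E ->
  (eamp (fun x => (f x ^+ n - g x ^+ n)%R) k <= conv_pow_diff n k)%E.
Proof.
move=> wf wg fA gA fgD; elim: n k => [|n IH] k /=.
  by under [X in eamp X]eq_fun do rewrite !expr0 subrr; rewrite /eamp amp_cst0.
have bfX j : bm (fun x => f x ^+ j) by apply/bmX/wien_bm.
have bgX j : bm (fun x => g x ^+ j) by apply/bmX/wien_bm.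
have bd : bm (fun x => f x ^+ n - g x ^+ n) by exact: bmB.
rewrite (_ : (fun x => _) = ((f \- g) \* (fun x => f x ^+ n)) \+
    (g \* (fun x => f x ^+ n - g x ^+ n))).
  apply: (@le_trans _ _ (eamp ((f \- g) \* (fun x => f x ^+ n))%R k +
     eamp (g \* (fun x => f x ^+ n - g x ^+ n))%R k)%E).
    rewrite -EFinD lee_fin; apply: ampD.
      by apply/bm_itg/bmM => //; apply: wien_bm; exact: wienB.
    by apply/bm_itg/bmM => //; exact: wien_bm.
  apply: leeD.
    exact: (eamp_econv _ (wienB wf wg) (bm_itg _ (bfX n)) fgD
      (fun l => eamp_exp_le n l wf fA)).
  exact: (eamp_econv _ wg (bm_itg _ bd) gA IH).
by apply/funext => x /=; rewrite !exprS; ring.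
Qed.

Lemma norm_wien_le f x : wien f -> (forall k, eamp f k <= A k)%E -> `|f x| <= r.
Proof.
move=> wf fA; apply: le_trans (wien_norm_le x wf) _.
rewrite -lee_fin -esum_eamp; last by case: wf.
by apply: le_trans Ar; exact: le_esum.
Qed.

Lemma eamp_nl_diff_le f g k : wien f -> wien g ->
  (forall k, eamp f k <= A k)%E -> (forall k, eamp g k <= A k)%E ->
  (forall k, eamp (f \- g)%R k <= D k)%E ->
  (eamp ((nl \o f) \- (nl \o g))%R k <= nl_majorant k)%E.
Proof.
move=> wf wg fA gA fgD; have /andP[r0 r1] := r01.
have bf := wien_bm wf; have bg := wien_bm wg.
have fr x := norm_wien_le x wf fA; have gr x := norm_wien_le x wg gA.
have poly M : (eamp ((nl_poly M \o f) \- (nl_poly M \o g))%R k <= nl_majorant k)%E.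
  have bh i : bm (fun x => ((- 1) ^+ i * pcoef i.+2) * (f x ^+ i.+2 - g x ^+ i.+2)).
    by apply/bmZ/bmB; exact: bmX.
  rewrite (_ : (_ \- _) = fun x => \sum_(i < M)
      ((- 1) ^+ i * pcoef i.+2) * (f x ^+ i.+2 - g x ^+ i.+2)); last first.
    apply/funext => x /=; rewrite /nl_poly -sumrB.
    by apply: eq_bigr => i _; ring.
  apply: (@le_trans _ _ (\sum_(i < M) ((pcoef i.+2)%:E * conv_pow_diff i.+2 k))%E).
    apply: (@le_trans _ _ (\sum_(i < M) amp (fun x => ((- 1) ^+ i * pcoef i.+2) *
       (f x ^+ i.+2 - g x ^+ i.+2)) k)%:E).
      rewrite lee_fin; apply: (amp_sum M (h := fun i x => ((- 1) ^+ i * pcoef i.+2) *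
        (f x ^+ i.+2 - g x ^+ i.+2)) k) => i; exact: bm_itg.
    rewrite -sumEFin; apply: lee_sum => i _.
    rewrite ampZ; last by apply/bm_itg/bmB; exact: bmX.
    rewrite normrM normrX normrN1 expr1n mul1r ger0_norm// EFinM.
    by apply: lee_wpmul2l; [rewrite lee_fin|exact: eamp_exp_diff_le].
  rewrite /nl_majorant -nneseries_esumT; last first.
    by move=> i; rewrite mule_ge0 ?conv_pow_diff_ge0// lee_fin.
  rewrite -(big_mkord xpredT (fun i => (pcoef i.+2)%:E * conv_pow_diff i.+2 k)%E).
  apply: nneseries_lim_ge => i _ _.
  by rewrite mule_ge0 ?conv_pow_diff_ge0// lee_fin.
have cv : amp ((nl_poly M \o f) \- (nl_poly M \o g)) k @[M --> \oo] -->
    amp ((nl \o f) \- (nl \o g)) k.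
  apply: (amp_cvg (M := (1 - r) ^- 3 + (1 - r) ^- 3)).
  - by move=> M; case: (bmB (bm_nl_poly M bf) (bm_nl_poly M bg)).
  - move=> M x /=; apply: le_trans (ler_normB _ _) _.
    by apply: lerD; exact: norm_nl_poly_le.
  - by move=> x; apply: cvgB; apply: nl_poly_cvg; exact: le_lt_trans r1.
(* The majorant at a single [k] may a priori be infinite, in which case the bound is trivial. *)
case: (nl_majorant k) poly (nl_majorant_ge0 k) => [b| |] poly _ //; last by rewrite leey.
rewrite lee_fin -(cvg_lim (@Rhausdorff R) cv); apply: limr_le; first exact: cvgP cv.
by apply: nearW => M; have := poly M; rewrite lee_fin.
Qed.

End lipschitz.

End nonlinearity.

(** * Construction of the solution *)

Section duhamel.
Context {R : realType}.
Local Notation leb := (@lebesgue_measure R).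
Implicit Types (f g h psi : R -> R) (a b c mu ka t : R).

(* Duhamel integrals are extended by their initial value to negative times, so
   that they are continuous on the whole line. *)
Definition pos_time t : R := Num.max t 0.

Lemma pos_time_ge0 t : 0 <= pos_time t.
Proof. by rewrite /pos_time le_max lexx orbT. Qed.

Lemma pos_timeE t : 0 <= t -> pos_time t = t.
Proof. by move=> t0; rewrite /pos_time max_l. Qed.

Lemma pos_time_continuous : continuous pos_time.
Proof.
move=> t; apply: (@continuous_max R R id (cst 0)); first exact: cvg_id.
exact: cvg_cst.
Qed.

Lemma expR_scale_continuous a : continuous (fun t => expR (a * t)).
Proof.
by move=> t; apply: continuous_comp; [exact: continuous_scale|exact: continuous_expR].
Qed.

Lemma continuous_itv_integrable a b f : continuous f ->
  leb.-integrable `[a, b] (EFin \o f).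
Proof.
move=> cf; apply: continuous_compact_integrable; first exact: segment_compact.
exact: continuous_subspaceT.
Qed.

Lemma continuous_primitive f : continuous f ->
  continuous (fun t => \int[leb]_(s in `[0, pos_time t]) f s).
Proof.
move=> cf x; pose b := pos_time x + 1.
have b0 : 0 <= b by rewrite addr_ge0// pos_time_ge0.
have /subspace_continuousP/(_ (pos_time x)) :=
  parameterized_integral_continuous b0 (continuous_itv_integrable 0 b cf).
rewrite /= in_itv/= pos_time_ge0 lerDl ler01 => /(_ isT) h.
apply: cvg_comp h => P; rewrite /= /within/= => nP.
have h1 := pos_time_continuous nP.
have /= h2 := @cvgr_lt _ _ _ _ _ _ (@pos_time_continuous x) b _.
have : \forall t \near x, pos_time t < b by apply: h2; rewrite ltrDl.
move=> h3; near=> t; have : `[0, b]%classic (pos_time t) -> P (pos_time t) by near: t.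
apply; rewrite /= in_itv/= pos_time_ge0/=; apply: ltW; near: t; exact: h3.
Unshelve. all: by end_near. Qed.

Lemma continuous_cmul a f : continuous f -> continuous (fun t => a * f t).
Proof. by move=> cf t; apply: cvgM; [exact: cvg_cst|exact: cf]. Qed.

Lemma derive_primitive f t : continuous f -> 0 < t ->
  is_derive t (1 : R) (fun t => \int[leb]_(s in `[0, t]) f s) (f t).
Proof.
move=> cf t0; have t1 : t < t + 1 by rewrite ltrDl.
have [h1 h2] := continuous_FTC1_closed t1 (continuous_itv_integrable 0 (t + 1) cf) t0 (cf t).
by apply: DeriveDef; [exact: h1|rewrite -derive1E; exact: h2].
Qed.

(** Variation of constants for y' = ka g - mu y, y(0) = c. With e^(- mu t) taken out of the
    integral, continuity and differentiation reduce to those of a primitive. *)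
Definition duhamel mu ka c g t : R := expR (- mu * pos_time t) *
  (c + ka * \int[leb]_(s in `[0, pos_time t]) (expR (mu * s) * g s)).

Lemma duhamel0 mu ka c g : duhamel mu ka c g 0 = c.
Proof.
by rewrite /duhamel pos_timeE// set_itv1 Rintegral_set1 !mulr0 expR0 mul1r addr0.
Qed.

Lemma continuous_exp_mul mu g : continuous g -> continuous (fun s => expR (mu * s) * g s).
Proof. by move=> cg t; apply: cvgM; [exact: expR_scale_continuous|exact: cg]. Qed.

Lemma duhamel_continuous mu ka c g : continuous g -> continuous (duhamel mu ka c g).
Proof.
move=> cg t; apply: cvgM.
  apply: (@continuous_comp _ _ _ pos_time (fun t => expR (- mu * t))).
    exact: pos_time_continuous.
  exact: expR_scale_continuous.
apply: cvgD; first exact: cvg_cst.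
apply: cvgM; first exact: cvg_cst.
exact: (@continuous_primitive _ (@continuous_exp_mul mu g cg) t).
Qed.

Lemma duhamel_derive mu ka c g t : continuous g -> 0 < t ->
  is_derive t (1 : R) (duhamel mu ka c g) (ka * g t - mu * duhamel mu ka c g t).
Proof.
move=> cg t0; have dP := derive_primitive (@continuous_exp_mul mu g cg) t0.
rewrite {2}/duhamel pos_timeE ?ltW//.
set P := (fun t => \int[leb]_(s in `[0, t]) (expR (mu * s) * g s)) in dP *.
pose F s := expR (- mu * s) * (c + ka * P s).
have e : \near t, F t = duhamel mu ka c g t.
  near=> s; rewrite /duhamel pos_timeE//; near: s.
  by apply: filterS (lt_nbhsr t0) => x /ltW.
apply: (near_eq_is_derive e).
apply: is_derive_eq; rewrite /GRing.scale/= mulr1.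
rewrite -/(P t) mulNr expRN; have /eqP e0 : expR (mu * t) != 0 by rewrite gt_eqF ?expR_gt0.
by field; apply/eqP.
Unshelve. all: by end_near. Qed.

Lemma le_duhamel mu ka c d g h t : continuous g -> continuous h -> 0 <= ka -> c <= d ->
  (forall s, 0 <= s -> g s <= h s) -> duhamel mu ka c g t <= duhamel mu ka d h t.
Proof.
move=> cg ch ka0 cd gh; rewrite /duhamel ler_pM2l ?expR_gt0// lerD//.
apply: ler_wpM2l => //; apply: le_Rintegral => //.
- exact/continuous_itv_integrable/continuous_exp_mul.
- exact/continuous_itv_integrable/continuous_exp_mul.
- move=> s; rewrite /= in_itv/= => /andP[s0 _].
  by rewrite ler_pM2l ?expR_gt0// gh.
Qed.

Lemma duhamel_lin mu ka a b c d g h t : continuous g -> continuous h ->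
  duhamel mu ka (a * c + b * d) (fun s => a * g s + b * h s) t =
  a * duhamel mu ka c g t + b * duhamel mu ka d h t.
Proof.
move=> cg ch; rewrite /duhamel.
have ig := continuous_itv_integrable 0 (pos_time t) (@continuous_exp_mul mu g cg).
have ih := continuous_itv_integrable 0 (pos_time t) (@continuous_exp_mul mu h ch).
under eq_Rintegral do rewrite mulrDr mulrCA [expR _ * (b * _)]mulrCA.
rewrite RintegralD//; last 2 first.
- exact/continuous_itv_integrable/continuous_cmul/continuous_exp_mul.
- exact/continuous_itv_integrable/continuous_cmul/continuous_exp_mul.
by rewrite !RintegralZl//; ring.
Qed.

(** Along each unit vector (a, b) the pair becomes a scalar Duhamel solution whose data and forcing
    lie below the moduli; [nrm2_leP] then gives the modulus without differentiating it. *)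
Lemma nrm2_duhamel mu ka c d g h t : continuous g -> continuous h -> 0 <= ka ->
  nrm2 (duhamel mu ka c g t) (duhamel mu ka d h t) <=
  duhamel mu ka (nrm2 c d) (fun s => nrm2 (g s) (h s)) t.
Proof.
move=> cg ch ka0; apply: nrm2_leP => a b ab; rewrite -duhamel_lin//.
apply: le_duhamel => //.
- by move=> s; apply: cvgD; apply: cvgM; [exact: cvg_cst|exact: cg|exact: cvg_cst|exact: ch].
- by move=> s; apply: nrm2_cvg; [exact: cg|exact: ch].
- exact: le_nrm2.
- by move=> s _; exact: le_nrm2.
Qed.

(** The damping 3 ka compensates the factor ka of the forcing, so the gain 1/3 is the same at every
    frequency: this is where the loss of four derivatives is absorbed. *)
Lemma duhamel_cst ka c B t : 0 <= ka -> 0 <= c -> 0 <= B ->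
  duhamel (3 * ka) ka c (cst B) t <= c + B / 3.
Proof.
move=> ka0 c0 B0; rewrite /duhamel.
(* The mode of frequency 0 is neither damped nor forced and stays constant. *)
have [->|kn0] := eqVneq ka 0.
  by rewrite mulr0 oppr0 !mul0r expR0 mul1r addr0 lerDl divr_ge0.
have k3 : 3 * ka != 0 by rewrite mulf_neq0.
rewrite (@Rint_FTC2 _ (fun s => (3 * ka)^-1 * (expR (3 * ka * s) * B))); last first.
- move=> s _; have h : is_derive s (1 : R)
     (fun s => (3 * ka)^-1 * (expR (3 * ka * s) * B)) (expR (3 * ka * s) * B).
    by apply: is_derive_eq; rewrite /GRing.scale/=; field.
  by split; [exact: ex_derive|exact: derive_val].
- apply: continuous_exp_mul => s; exact: cvg_cst.
- move=> s; apply: cvgM; first exact: cvg_cst.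
  by apply: (@continuous_exp_mul _ (cst B)) => u; exact: cvg_cst.
- exact: pos_time_ge0.
rewrite mulr0 expR0 mulNr expRN.
have e1 : 1 <= expR (3 * ka * pos_time t).
  by rewrite -expR0 ler_expR !mulr_ge0// pos_time_ge0.
set e := expR _ in e1 *; have e0 : 0 < e := lt_le_trans ltr01 e1.
rewrite mulrC ler_pdivrMr//.
rewrite (_ : _ + _ = c + (e - 1) * B / 3); last by field.
rewrite -subr_ge0 (_ : _ - _ = c * (e - 1) + B / 3); last by field.
by rewrite addr_ge0 ?mulr_ge0 ?divr_ge0// subr_ge0.
Qed.

Lemma duhamel_ibp mu ka c g psi (psi' : R -> R) t : 0 <= t -> continuous g ->
  continuous psi -> continuous psi' ->
  (forall s, 0 < s < t -> is_derive s (1 : R) psi (psi' s)) ->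
  \int[leb]_(s in `[0, t]) (psi' s * duhamel mu ka c g s +
    psi s * (ka * g s - mu * duhamel mu ka c g s)) =
  psi t * duhamel mu ka c g t - psi 0 * c.
Proof.
move=> t0 cg cpsi cpsi' dpsi; have cy := @duhamel_continuous mu ka c g cg.
rewrite (@Rint_FTC2 _ (fun s => psi s * duhamel mu ka c g s))//; first by rewrite duhamel0.
- by move=> s; apply: cvgM; [exact: cpsi|exact: cy].
- move=> s; apply: cvgD; first by apply: cvgM; [exact: cpsi'|exact: cy].
  apply: cvgM; first exact: cpsi.
  by apply: cvgB; apply: cvgM; [exact: cvg_cst|exact: cg|exact: cvg_cst|exact: cy].
- move=> s st; have d1 := dpsi s st; have /andP[s0 _] := st.
  have d2 := @duhamel_derive mu ka c g s cg s0.
  have h : is_derive s (1 : R) (fun s => psi s * duhamel mu ka c g s)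
     (psi' s * duhamel mu ka c g s + psi s * (ka * g s - mu * duhamel mu ka c g s)).
    by apply: is_derive_eq; rewrite /GRing.scale/=; ring.
  by split; [exact: ex_derive|exact: derive_val].
Qed.

(** The balance of e^(la t) y, integrated in time. In this form it can be summed over modes without
    differentiating the sum. *)
Lemma duhamel_energy mu ka la c g t : 0 <= t -> continuous g ->
  expR (la * t) * duhamel mu ka c g t +
  (mu - la) * \int[leb]_(s in `[0, t]) (expR (la * s) * duhamel mu ka c g s) =
  c + ka * \int[leb]_(s in `[0, t]) (expR (la * s) * g s).
Proof.
move=> t0 cg; have cy := @duhamel_continuous mu ka c g cg.
have := @duhamel_ibp mu ka c g (fun s => expR (la * s)) (fun s => la * expR (la * s)) t
  t0 cg (@expR_scale_continuous la) _ _.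
rewrite mulr0 expR0 mul1r.
rewrite (@eq_Rintegral _ _ _ leb `[0, t] (fun s => ka * (expR (la * s) * g s) -
  (mu - la) * (expR (la * s) * duhamel mu ka c g s))); last by move=> s _; ring.
have ig := continuous_itv_integrable 0 t (@continuous_exp_mul la g cg).
have iy := continuous_itv_integrable 0 t (@continuous_exp_mul la _ cy).
rewrite RintegralB//; last 2 first.
- exact/continuous_itv_integrable/continuous_cmul/continuous_exp_mul.
- exact/continuous_itv_integrable/continuous_cmul/continuous_exp_mul.
rewrite !RintegralZl// => H.
have {H} := H _ _; set I := Rintegral _ _ _; set J := Rintegral _ _ _ => H.
suff : ka * I - (mu - la) * J = expR (la * t) * duhamel mu ka c g t - c by lra.
apply: H.
- by move=> s; apply: cvgM; [exact: cvg_cst|exact: expR_scale_continuous].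
- move=> s _; apply: is_derive_eq; rewrite /GRing.scale/=; ring.
Qed.

End duhamel.

(** * Numerical consequences of the smallness of the data *)

Section small_data.
Context {R : realType}.

Lemma delta_gt0_small (z : R) : 0 <= z < 1 -> 0 < delta z -> z < 32^-1.
Proof.
move=> /andP[z0 z1]; move=> dz; rewrite ltNge; apply/negP => z32.
move: dz; apply/negP; rewrite /delta -!expr_div_n.
have w0 : 0 < 1 - z by rewrite subr_gt0.
(* In this variable 1 / (1 - z) = 1 + w, so [delta] becomes 6 minus a polynomial with nonnegative
   coefficients, and z >= 1/32 reads w >= 1/31. *)
set w := z / (1 - z).
have wE : (1 - z)^-1 = 1 + w by rewrite /w; field; rewrite gt_eqF.
have w31 : 31^-1 <= w.
  by rewrite /w ler_pdivlMr//; move: z32; lra.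
have -> : 3 / (1 - z) ^+ 4 = 3 * (1 + w) ^+ 4 by rewrite -wE exprVn.
have {}w0 : 0 <= w by apply: le_trans w31; rewrite invr_ge0.
clearbody w; clear -w0 w31; rewrite -leNgt subr_le0.
have h1 : 1 + 4 * w <= (1 + w) ^+ 4.
  rewrite -subr_ge0 (_ : _ - _ = 6 * w ^+ 2 + 4 * w ^+ 3 + w ^+ 4); last by ring.
  by rewrite !addr_ge0// ?mulr_ge0// exprn_ge0.
have h2 : 1 + 28 * w <= 1 + 28 * w + 120 * w ^+ 2 + 120 * w ^+ 3.
  by rewrite -addrA lerDl addr_ge0// mulr_ge0// exprn_ge0.
(* The lower-order terms are enough: the product is at least 3 + 96 w, which exceeds 6 at w =
   1/31. *)
apply: (@le_trans _ _ (3 * (1 + 4 * w) * (1 + 28 * w))).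
  rewrite (_ : _ * _ = 3 + 96 * w + 336 * w ^+ 2); last by ring.
  have w2 : 31^-1 * 31^-1 <= w ^+ 2 by rewrite expr2 ler_pM// invr_ge0.
  by move: w31 w2; lra.
apply: ler_pM => //; [by rewrite mulr_ge0// addr_ge0// mulr_ge0| |by rewrite ler_pM2l].
by rewrite addr_ge0// mulr_ge0.
Qed.

(** The Lipschitz constant of N on the ball of radius 1/16; multiplied by the Duhamel gain 1/3 it
    gives the ratio 1/2 of the iteration. *)
Lemma contraction_factor : 3 * (1 - 16^-1) ^- 4 - 3 <= 3 / 2 :> R.
Proof.
rewrite (_ : (1 - 16^-1)^-4 = (16 / 15) ^+ 4 :> R).
  have h : (16 / 15) ^+ 2 <= 6 / 5 :> R by rewrite expr2; lra.
  have h0 : 0 <= (16 / 15) ^+ 2 :> R by rewrite exprn_ge0.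
  rewrite (exprM _ 2 2) [X in 3 * X]expr2.
  by move: h h0; move: ((16 / 15) ^+ 2) => a h h0; nra.
by rewrite -exprVn; congr (_ ^+ _); field.
Qed.

End small_data.

Section interval_measure.
Context {R : realType}.
Local Notation leb := (@lebesgue_measure R).

(** Lebesgue measure on [a, b] seen as a finite measure on the line, so that the dominated
    convergence, Fubini and summation results for finite measures apply in time as well. *)
Definition interval_measure (a b : R) := mrestr leb (measurable_itv `[a, b]).

HB.instance Definition _ a b := Measure.on (interval_measure a b).

Let interval_fin a b : fin_num_fun (interval_measure a b).
Proof.
move=> A mA; rewrite ge0_fin_numE//.
apply: (@le_lt_trans _ _ (leb `[a, b]%classic)).
  by apply: le_measure; rewrite ?inE//=; exact: measurableI.
by rewrite lebesgue_measure_itv/=; case: ifP => //; rewrite -EFinD ltry.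
Qed.

HB.instance Definition _ a b :=
  Measure_isFinite.Build _ _ _ (interval_measure a b) (@interval_fin a b).

Lemma Rint_interval (a b : R) (f : R -> R) : measurable_fun [set: measurableTypeR R] f ->
  \int[interval_measure a b]_x f x = \int[leb]_(x in `[a, b]) f x.
Proof. by move=> mf; congr fine; apply: integral_mrestr; exact/measurable_EFinP. Qed.

Lemma continuous_measurable (f : R -> R) : continuous f ->
  measurable_fun [set: measurableTypeR R] f.
Proof. by move=> cf; apply: continuous_measurable_fun => x; exact: cf. Qed.

Lemma duhamel_cvg mu ka c (g_ : nat -> R -> R) (g : R -> R) M t :
  (forall n, continuous (g_ n)) -> continuous g -> (forall n s, `|g_ n s| <= M) ->
  (forall s, g_ n s @[n --> \oo] --> g s) ->
  duhamel mu ka c (g_ n) t @[n --> \oo] --> duhamel mu ka c g t.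
Proof.
move=> cg_ cg gM gg; apply: cvgM; first exact: cvg_cst.
apply: cvgD; first exact: cvg_cst.
apply: cvgM; first exact: cvg_cst.
have m (f : R -> R) : continuous f -> measurable_fun [set: measurableTypeR R] (fun s : R => expR (mu * s) * f s).
  move=> cf; apply: continuous_measurable; exact: continuous_exp_mul.
have e (f : R -> R) : continuous f -> \int[leb]_(s in `[0, pos_time t]) (expR (mu * s) * f s) =
    \int[interval_measure 0 (pos_time t)]_s (expR (mu * s) * f s).
  by move=> cf; rewrite Rint_interval//; exact: m.
rewrite e//; under eq_fun do rewrite e//.
apply: (@Rint_dominated _ _ R (interval_measure 0 (pos_time t))
  (fun n s => expR (mu * s) * g_ n s) _ (fun s => expR (mu * s) * M)).
- by move=> n; exact: m.
- have cM : continuous (cst M : R -> R) by move=> s; exact: cvg_cst.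
  have ci := @continuous_itv_integrable R 0 (pos_time t) _ (@continuous_exp_mul R mu (cst M) cM).
  have /integrableP[mE lE] := ci; apply/integrableP; split.
    apply/measurable_EFinP; exact: (m (cst M)).
  rewrite ge0_integral_mrestr//; apply/measurable_EFinP/measurableT_comp => //.
  exact: (m (cst M)).
- by move=> n s; rewrite normrM ger0_norm ?expR_ge0// ler_pM2l ?expR_gt0.
- by move=> s; apply: cvgM; [exact: cvg_cst|exact: gg].
Qed.

End interval_measure.

(** * Picard iteration on Fourier coefficients *)

Section picard.
Context {R : realType} {d : nat}.
Local Notation G := 'rV[int]_d.
Local Notation F := ('rV[R]_d -> R).
Local Notation itg := (@itg _ _ R (torus d)).
Implicit Types (k : G) (A D : G -> \bar R) (t : R).

Lemma int_norm_ge0 k : 0 <= int_norm k :> R. Proof. exact: sqrtr_ge0. Qed.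

Lemma int_normN k : int_norm (- k) = int_norm k :> R.
Proof.
by congr Num.sqrt; apply: eq_bigr => i _; rewrite mxE rmorphN sqrrN.
Qed.

(* A trajectory is stored as its cosine and sine coefficients at each time. *)
Local Notation traj := (R -> G -> R * R).
Implicit Types p q : traj.

Definition field_of p t : F := trig (fun k => (p t k).1) (fun k => (p t k).2).

(** [A] majorises the coefficients at all times at once, so a bound on its sum bounds sum_k sup_t
    |v^(t, k)|. The third clause is the parity of the coefficients of a real function. *)
Definition admissible p A := [/\
  forall k, continuous (fun t => (p t k).1),
  forall k, continuous (fun t => (p t k).2),
  forall t k, p t (- k) = ((p t k).1, - (p t k).2) &
  forall t k, ((nrm2 (p t k).1 (p t k).2)%:E <= A k)%E].

Section admissible.
Variables (p : traj) (A : G -> \bar R) (r : R).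
Hypothesis pA : admissible p A.
Hypothesis r01 : 0 <= r < 1.
Hypothesis Ar : (\esum_(k in [set: G]) A k <= r%:E)%E.

Lemma admissible_ge0 k : (0 <= A k)%E.
Proof. by have [_ _ _ /(_ 0 k)] := pA; apply: le_trans; rewrite lee_fin nrm2_ge0. Qed.

Lemma admissible_fine k : A k = (fine (A k))%:E.
Proof.
rewrite fineK// ge0_fin_numE ?admissible_ge0//.
apply: le_lt_trans (le_lt_trans Ar (ltry r)).
apply: esum_ge; exists [set k]; first by split.
by rewrite fsbig_set1.
Qed.

Lemma admissible_gsummable : gsummable (fun k => fine (A k)).
Proof.
rewrite /gsummable /gnorm; apply: le_lt_trans (le_lt_trans Ar (ltry r)).
apply: le_esum => k _; rewrite ger0_norm ?fine_ge0 ?admissible_ge0//.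
by rewrite -admissible_fine.
Qed.

Lemma admissible_bound t k : nrm2 (p t k).1 (p t k).2 <= fine (A k).
Proof. by have [_ _ _ /(_ t k)] := pA; rewrite {1}admissible_fine lee_fin. Qed.

Lemma admissible_summable t : gsummable (fun k => nrm2 (p t k).1 (p t k).2).
Proof.
apply: le_gsummable admissible_gsummable => k.
rewrite !ger0_norm ?nrm2_ge0 ?fine_ge0 ?admissible_ge0//; exact: admissible_bound.
Qed.

Let pN1 t k : (p t (- k)).1 = (p t k).1.
Proof. by have [_ _ -> _] := pA. Qed.

Let pN2 t k : (p t (- k)).2 = - (p t k).2.
Proof. by have [_ _ -> _] := pA. Qed.

Lemma admissible_wien t : wien (field_of p t).
Proof. exact: (wien_trig (admissible_summable t) (pN1 t) (pN2 t)). Qed.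

Lemma ccoef_field t k : ccoef (field_of p t) k = (p t k).1.
Proof. exact: (ccoef_trig (admissible_summable t) (pN1 t)). Qed.

Lemma scoef_field t k : scoef (field_of p t) k = (p t k).2.
Proof. exact: (scoef_trig (admissible_summable t) (pN2 t)). Qed.

Lemma amp_field t k : amp (field_of p t) k = nrm2 (p t k).1 (p t k).2.
Proof. by rewrite /amp ccoef_field scoef_field. Qed.

Lemma eamp_field_le t k : (eamp (field_of p t) k <= A k)%E.
Proof. by rewrite /eamp amp_field; have [_ _ _] := pA. Qed.

Lemma norm_field_le t x : `|field_of p t x| <= r.
Proof. exact: (norm_wien_le Ar x (admissible_wien t) (eamp_field_le t)). Qed.

Lemma field_continuous x : continuous (fun t => field_of p t x).
Proof.
move=> t; have [c1 c2 _ _] := pA.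
apply: (@gsum_cvg R G R (nbhs t) _ (fun k t => (p t k).1 * cos (int_dot k x) +
   (p t k).2 * sin (int_dot k x)) _ _ admissible_gsummable).
  by move=> k s; apply: le_trans (le_trig_term _ _ _) _; exact: admissible_bound.
move=> k; apply: cvgD; apply: cvgM; [exact: c1|exact: cvg_cst|exact: c2|exact: cvg_cst].
Qed.

Lemma nl_continuous (y : R) : `|y| < 1 -> {for y, continuous (@nl R)}.
Proof.
rewrite ltr_norml => /andP[y1 _]; apply: cvgD; last first.
  by apply: cvgM; [exact: cvg_cst|exact: cvg_id].
apply: cvgB; last exact: cvg_cst.
apply: cvgV; first by rewrite expf_neq0// gt_eqF//; lra.
apply: (@continuous_comp _ _ _ (fun y : R => 1 + y) (fun y : R => y ^+ 3)).
  by apply: cvgD; [exact: cvg_cst|exact: cvg_id].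
exact: exprn_continuous.
Qed.

Lemma bm_nl_field t : bm (nl \o field_of p t).
Proof.
by have /andP[_ r1] := r01; exact: (bm_nl (wien_bm (admissible_wien t)) (norm_field_le t) r1).
Qed.

(** Continuity is tested along sequences, where dominated convergence in space applies: the field is
    continuous in time at each point and stays in a ball of radius r < 1, on which N is continuous
    and bounded. *)
Lemma nl_coef_continuous k :
  continuous (fun t => ccoef (nl \o field_of p t) k) /\
  continuous (fun t => scoef (nl \o field_of p t) k).
Proof.
have /andP[_ r1] := r01.
have h (u : nat -> R) t : u n @[n --> \oo] --> t ->
    ccoef (nl \o field_of p (u n)) k @[n --> \oo] --> ccoef (nl \o field_of p t) k /\
    scoef (nl \o field_of p (u n)) k @[n --> \oo] --> scoef (nl \o field_of p t) k.
  move=> ut; apply: (coef_cvg (M := (1 - r) ^- 3 + 1 + 3 * r)).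
  - by move=> n; case: (bm_nl_field (u n)).
  - by move=> n x; exact: norm_nl_le (norm_field_le _ x) r1.
  - move=> x; apply: (@cvg_comp _ _ _ (fun n => field_of p (u n) x) (@nl R)).
      apply: (@cvg_comp _ _ _ u (fun t => field_of p t x) _ (nbhs t)); first exact: ut.
      exact: field_continuous.
    by apply: nl_continuous; exact: le_lt_trans (norm_field_le t x) r1.
by split=> t; apply/(@cvg_nbhsP _ R^o) => u ut; case: (h u t ut).
Qed.

End admissible.

Lemma eamp_subE (f g : F) k a b a' b' : itg f -> itg g -> ccoef f k = a -> scoef f k = b ->
  ccoef g k = a' -> scoef g k = b' -> eamp (f \- g)%R k = (nrm2 (a - a') (b - b'))%:E.
Proof.
by move=> fi gi <- <- <- <-; rewrite /eamp /amp (ccoefB k fi gi) (scoefB k fi gi).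
Qed.

Variable v0 : F.
Hypothesis v0_wien : wien v0.

(** The mode [k] of v_t = - 3 Delta^2 v + Delta^2 N(v), where Delta^2 multiplies coefficients by
    |k|^4: damping rate 3 |k|^4, forcing |k|^4 times the coefficient of N(v). *)
Definition picard_step p : traj := fun t k =>
  (duhamel (3 * int_norm k ^+ 4) (int_norm k ^+ 4) (ccoef v0 k)
     (fun s => ccoef (nl \o field_of p s) k) t,
   duhamel (3 * int_norm k ^+ 4) (int_norm k ^+ 4) (scoef v0 k)
     (fun s => scoef (nl \o field_of p s) k) t).

Let ka_ge0 k : 0 <= int_norm k ^+ 4 :> R.
Proof. by rewrite exprn_ge0// int_norm_ge0. Qed.

Lemma picard_step_continuous p A r : admissible p A -> 0 <= r < 1 ->
  (\esum_(k in [set: G]) A k <= r%:E)%E -> forall k,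
  continuous (fun t => (picard_step p t k).1) /\
  continuous (fun t => (picard_step p t k).2).
Proof.
move=> pA r01 Ar k; have [h1 h2] := nl_coef_continuous pA r01 Ar k.
by split; exact: duhamel_continuous.
Qed.

Lemma duhamelN mu ka c (g : R -> R) t : continuous g ->
  duhamel mu ka (- c) (fun s => - g s) t = - duhamel mu ka c g t.
Proof.
move=> cg; have := @duhamel_lin R mu ka (-1) 0 c 0 g g t cg cg.
rewrite !mul0r !addr0 !mulN1r => <-; congr (duhamel _ _ _ _ _).
by apply/funext => s; rewrite mulN1r mul0r addr0.
Qed.

Lemma duhamelB mu ka c (g h : R -> R) t : continuous g -> continuous h ->
  duhamel mu ka c g t - duhamel mu ka c h t = duhamel mu ka 0 (fun s => g s - h s) t.
Proof.
move=> cg ch; have := @duhamel_lin R mu ka 1 (-1) c c g h t cg ch.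
rewrite !mul1r !mulN1r subrr => <-; congr (duhamel _ _ _ _ _).
by apply/funext => s; rewrite mul1r mulN1r.
Qed.

Lemma picard_step_sym p A r : admissible p A -> 0 <= r < 1 ->
  (\esum_(k in [set: G]) A k <= r%:E)%E -> forall t k,
  picard_step p t (- k) = ((picard_step p t k).1, - (picard_step p t k).2).
Proof.
move=> pA r01 Ar t k; have [h1 h2] := nl_coef_continuous pA r01 Ar k.
rewrite /picard_step /= int_normN ccoefN (scoefN _ (wien_itg v0_wien)).
have -> : (fun s => ccoef (nl \o field_of p s) (- k)) = fun s => ccoef (nl \o field_of p s) k.
  by apply/funext => s; rewrite ccoefN.
have -> : (fun s => scoef (nl \o field_of p s) (- k)) = fun s => - scoef (nl \o field_of p s) k.
  by apply/funext => s; rewrite scoefN//; exact/bm_itg/(bm_nl_field pA r01 Ar).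
by rewrite duhamelN.
Qed.

(* With [mu = 3 ka], the Duhamel integral of a forcing bounded by [B] is
   bounded by [B / 3]. *)
Lemma picard_step_diff p q A D r : admissible p A -> admissible q A ->
  (forall k, 0 <= D k)%E -> 0 <= r < 1 ->
  (\esum_(k in [set: G]) A k <= r%:E)%E ->
  (forall t k, ((nrm2 ((p t k).1 - (q t k).1) ((p t k).2 - (q t k).2))%:E <= D k)%E) ->
  forall t k, ((nrm2 ((picard_step p t k).1 - (picard_step q t k).1)
    ((picard_step p t k).2 - (picard_step q t k).2))%:E <= (3^-1)%:E * nl_majorant A D k)%E.
Proof.
move=> pA qA D0 r01 Ar pqD t k.
have wp s := admissible_wien pA Ar s; have wq s := admissible_wien qA Ar s.
have H s : (eamp ((nl \o field_of p s) \- (nl \o field_of q s))%R k <= nl_majorant A D k)%E.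
  apply: (eamp_nl_diff_le (admissible_ge0 pA) D0 r01 Ar k (wp s) (wq s)
    (eamp_field_le pA Ar s) (eamp_field_le qA Ar s)) => l.
  rewrite (eamp_subE (wien_itg (wp s)) (wien_itg (wq s)) (ccoef_field pA Ar s l)
    (scoef_field pA Ar s l) (ccoef_field qA Ar s l) (scoef_field qA Ar s l)).
  exact: pqD.
have := nl_majorant_ge0 (admissible_ge0 pA) D0 k.
case: (nl_majorant A D k) H => [B| |] H// B0; last first.
  by rewrite gt0_muley ?leey// lte_fin invr_gt0.
rewrite -EFinM lee_fin mulrC.
have [h1 h2] := nl_coef_continuous pA r01 Ar k.
have [h3 h4] := nl_coef_continuous qA r01 Ar k.
rewrite /picard_step /= !duhamelB//.
have cB (a b : R -> R) : continuous a -> continuous b -> continuous (fun s => a s - b s).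
  by move=> ca cb s; apply: cvgB; [exact: ca|exact: cb].
apply: le_trans (nrm2_duhamel _ _ _ _ (cB _ _ h1 h3) (cB _ _ h2 h4) (ka_ge0 k)) _.
rewrite nrm2_00 -[B / 3]add0r.
apply: le_trans (@duhamel_cst R _ 0 B t (ka_ge0 k) (lexx _) _); last by move: B0; rewrite lee_fin.
apply: le_duhamel => //.
- by have c1 := cB _ _ h1 h3; have c2 := cB _ _ h2 h4; move=> s; exact: (nrm2_cvg (c1 s) (c2 s)).
- by move=> s; exact: cvg_cst.
- move=> s _; have bp := bm_itg (torus d) (bm_nl_field pA r01 Ar s).
  have bq := bm_itg (torus d) (bm_nl_field qA r01 Ar s).
  by have := H s; rewrite (eamp_subE bp bq erefl erefl erefl erefl) lee_fin.
Qed.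

Hypothesis v0_small : gsum (amp v0) < 32^-1.

(** The first component is the sum of the increments made so far and bounds the current iterate; the
    second bounds the next increment. Both depend on the frequency only, hence are uniform in
    time. *)
Definition majorant_step (m : (G -> \bar R) * (G -> \bar R)) :=
  ((fun k => m.1 k + m.2 k)%E,
   (fun k => (3^-1)%:E * nl_majorant (fun k => m.1 k + m.2 k) m.2 k)%E).

Definition majorant n := iter n majorant_step (fun=> 0%E, eamp v0).

Definition picard n : traj := iter n picard_step (fun _ _ => (0, 0)).

Arguments picard : simpl never.

Lemma picardS n : picard n.+1 = picard_step (picard n). Proof. by []. Qed.

Let v0z n : 0 <= gsum (amp v0) * 2^-1 ^+ n.
Proof.
rewrite mulr_ge0 ?exprn_ge0// -lee_fin -esum_eamp; last by case: v0_wien.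
by apply: esum_ge0 => k _; exact: eamp_ge0.
Qed.

Lemma majorant_ge0 n k : (0 <= (majorant n).1 k)%E /\ (0 <= (majorant n).2 k)%E.
Proof.
elim: n k => [|n IH] k; first by rewrite /= eamp_ge0.
have A0 l : (0 <= (majorant n).1 l + (majorant n).2 l)%E.
  by have [h1 h2] := IH l; exact: adde_ge0.
have D0 l : (0 <= (majorant n).2 l)%E by case: (IH l).
by split; [exact: A0|rewrite /= mule_ge0 ?lee_fin ?invr_ge0// nl_majorant_ge0].
Qed.

(** A geometric series: one step multiplies the norm of the increment by 1/3 times the Lipschitz
    constant, at most 1/2. *)
Lemma majorant_norm n :
  (\esum_(k in [set: G]) (majorant n).1 k <= (gsum (amp v0) * (2 - 2 * 2^-1 ^+ n))%:E)%E /\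
  (\esum_(k in [set: G]) (majorant n).2 k <= (gsum (amp v0) * 2^-1 ^+ n)%:E)%E.
Proof.
elim: n => [|n [IH1 IH2]].
  rewrite /= esum1// expr0 mulr1 mulr1 subrr mulr0; split => //.
  by rewrite esum_eamp//; case: v0_wien.
have A0 l : (0 <= (majorant n).1 l)%E by case: (majorant_ge0 n l).
have D0 l : (0 <= (majorant n).2 l)%E by case: (majorant_ge0 n l).
have z0 := v0z n; have := v0z n.+1; move: v0_small z0; rewrite exprS.
have e1 : 2^-1 ^+ n <= 1 :> R by rewrite exprn_ile1// invf_le1//; lra.
have e0 : 0 <= 2^-1 ^+ n :> R by rewrite exprn_ge0.
move: (2^-1 ^+ n) (gsum (amp v0)) IH1 IH2 e1 e0 => e z IH1 IH2 e1 e0 zs ze0 _.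
have S1 : (\esum_(k in [set: G]) ((majorant n).1 k + (majorant n).2 k) <=
    (z * (2 - 2 * (2^-1 * e)))%:E)%E.
  rewrite esumD//; apply: le_trans (leeD IH1 IH2) _.
  by rewrite -EFinD lee_fin; lra.
split; first exact: S1.
rewrite /= esumZl//; last first.
  by move=> k; apply: nl_majorant_ge0 => // l; rewrite adde_ge0.
(* Partial sums are at most twice the norm of [v0], below 2/32: they stay in the ball where the
   Lipschitz constant is evaluated. *)
have S2 : (\esum_(k in [set: G]) ((majorant n).1 k + (majorant n).2 k) <= (16^-1)%:E)%E.
  by apply: le_trans S1 _; rewrite lee_fin; nra.
have r01 : 0 <= (16^-1 : R) < 1 by apply/andP; split; lra.
have H := nl_majorant_norm (fun l => adde_ge0 (A0 l) (D0 l)) D0 r01 ze0 S2 IH2.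
apply: le_trans (lee_wpmul2l _ H) _; first by rewrite lee_fin invr_ge0.
rewrite -EFinM lee_fin; have := ler_wpM2r ze0 (@contraction_factor R); lra.
Qed.

Lemma majorant_norm16 n : (\esum_(k in [set: G]) (majorant n).1 k <= (16^-1)%:E)%E.
Proof.
apply: le_trans (majorant_norm n).1 _; rewrite lee_fin.
have := v0z n; have := v0_small; rewrite mulrBr mulrCA; lra.
Qed.

Let r01 : 0 <= (16^-1 : R) < 1.
Proof. by apply/andP; split; lra. Qed.

(** The three assertions are proved together because the estimate of the next increment compares two
    successive iterates under a common majorant. *)
Lemma picard_admissible n :
  [/\ admissible (picard n) (majorant n).1, admissible (picard n.+1) (majorant n.+1).1 &
  forall t k, ((nrm2 ((picard n.+1 t k).1 - (picard n t k).1)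
    ((picard n.+1 t k).2 - (picard n t k).2))%:E <= (majorant n).2 k)%E].
Proof.
have succ p q m : (forall k, (0 <= m.2 k)%E) -> admissible p m.1 ->
    (\esum_(k in [set: G]) m.1 k <= (16^-1)%:E)%E ->
    (forall t k, ((nrm2 ((picard_step p t k).1 - (p t k).1)
       ((picard_step p t k).2 - (p t k).2))%:E <= m.2 k)%E) ->
    admissible (picard_step p) (majorant_step m).1.
  move=> m0 pA mS pD; split.
  - by move=> k; case: (picard_step_continuous pA r01 mS k).
  - by move=> k; case: (picard_step_continuous pA r01 mS k).
  - exact: (picard_step_sym pA r01 mS).
  - move=> t k; have [_ _ _ pAk] := pA.
    rewrite /majorant_step/= addeC; apply: le_trans (leeD (pD t k) (pAk t k)).
    rewrite -EFinD lee_fin.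
    have := nrm2D ((picard_step p t k).1 - (p t k).1) ((picard_step p t k).2 - (p t k).2)
      (p t k).1 (p t k).2.
    by rewrite !subrK.
elim: n => [|n [IH0 IH1 IHD]].
  have a0 : admissible (picard 0) (majorant 0).1.
    split=> [k t|k t|t k|t k] /=; [exact: cvg_cst|exact: cvg_cst|by rewrite oppr0|].
    by rewrite nrm2_00.
  (* Since N(0) = 0, the first iterate is the linear flow of [v0], whose coefficients do not exceed
     the initial ones in modulus. *)
  have d0 t k : ((nrm2 ((picard 1 t k).1 - (picard 0 t k).1)
      ((picard 1 t k).2 - (picard 0 t k).2))%:E <= (majorant 0).2 k)%E.
    rewrite picardS /= !subr0 lee_fin.
    have f0 s : nl \o field_of (fun _ _ => (0, 0)) s = (fun _ : 'rV[R]_d => 0 : R).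
      apply/funext => x /=; rewrite /field_of /trig.
      rewrite (_ : gsum _ = gsum (fun k : G => 0 * 0)); last by apply: eq_gsum => l; rewrite !mul0r addr0.
      have s0 : gsummable (fun _ : G => 0 : R).
        by apply: le_gsummable (gsummable_single (0 : G) (0 : R)) => l; rewrite normr0.
      by rewrite gsumZ// mul0r /nl addr0 expr1n invr1 subrr mulr0 addr0.
    have c0 s : ccoef (nl \o field_of (fun _ _ => (0, 0)) s) k = 0.
      by rewrite f0 /ccoef; under eq_avg do rewrite mul0r; rewrite avg_cst.
    have s0 s : scoef (nl \o field_of (fun _ _ => (0, 0)) s) k = 0.
      by rewrite f0 /scoef; under eq_avg do rewrite mul0r; rewrite avg_cst.
    under [fun s => ccoef _ k]eq_fun do rewrite c0.
    under [fun s => scoef _ k]eq_fun do rewrite s0.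
    have cc : continuous (fun _ : R => 0 : R) by move=> s; exact: cvg_cst.
    apply: le_trans (nrm2_duhamel _ _ _ _ cc cc (ka_ge0 k)) _; rewrite nrm2_00.
    have := @duhamel_cst R _ (amp v0 k) 0 t (ka_ge0 k) (amp_ge0 _ _) (lexx _).
    by rewrite mul0r addr0.
  split=> //; exact: (succ _ (picard 0) _ (fun k => (majorant_ge0 0 k).2) a0 (majorant_norm16 0) d0).
(* Majorants increase with the rank, so the newer one also covers the older iterate and can serve
   for both. *)
have q0 : admissible (picard n) (majorant n.+1).1.
  have [h1 h2 h3 h4] := IH0; split => // t k; apply: le_trans (h4 t k) _.
  by rewrite /= leeDl//; case: (majorant_ge0 n k).
have D0 k : (0 <= (majorant n).2 k)%E by case: (majorant_ge0 n k).
have dn t k := picard_step_diff IH1 q0 D0 r01 (majorant_norm16 n.+1) IHD t k.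
split; [exact: IH1| |exact: dn].
exact: (succ _ (picard 0) _ (fun k => (majorant_ge0 n.+1 k).2) IH1 (majorant_norm16 n.+1) dn).
Qed.

Definition increment n k : R := fine ((majorant n).2 k).

Definition picard_majorant k : R := gsum (increment^~ k).

(** The limit is written as a telescoping series of increments, dominated uniformly in time by the
    summable [increment]; continuity in time is then Tannery's theorem. *)
Definition picard_limit : traj := fun t k =>
  (gsum (fun n => (picard n.+1 t k).1 - (picard n t k).1),
   gsum (fun n => (picard n.+1 t k).2 - (picard n t k).2)).

Let incrementE n k : (majorant n).2 k = (increment n k)%:E.
Proof.
rewrite /increment fineK// ge0_fin_numE; last by case: (majorant_ge0 n k).
apply: le_lt_trans (le_lt_trans (majorant_norm n).2 (ltry _)).
by apply: esum_ge; exists [set k]; [split|rewrite fsbig_set1].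
Qed.

Let increment_ge0 n k : 0 <= increment n k.
Proof. by rewrite -lee_fin -incrementE; case: (majorant_ge0 n k). Qed.

Let majorantE n k : (majorant n).1 k = (series (increment^~ k) n)%:E.
Proof.
elim: n => [|n IH]; first by rewrite /series/= big_geq.
by rewrite seriesSr EFinD -IH -incrementE.
Qed.

Lemma increment_summable k : gsummable (increment^~ k).
Proof.
apply: le_lt_trans (ltry 16^-1); rewrite gnormE//.
rewrite -nneseries_esumT; last by move=> n; rewrite lee_fin.
apply: lime_le; first by apply: is_cvg_nneseries => n _ _; rewrite lee_fin.
apply: nearW => n; rewrite sumEFin -majorantE; apply: le_trans (majorant_norm16 n).
by apply: esum_ge; exists [set k]; [split|rewrite fsbig_set1].
Qed.

Lemma gsum_nat_cvg (u : nat -> R) : gsummable u -> series u n @[n --> \oo] --> gsum u.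
Proof.
move=> su; have := gsummable_cvg su; rewrite /gsum.
rewrite (_ : enum_fun u = u)//; apply/funext => n.
by rewrite /enum_fun (_ : pickle_inv n = Some n)//; exact: (@pickleK_inv nat n).
Qed.

Lemma series_majorant n k : series (increment^~ k) n <= picard_majorant k.
Proof.
have h := gsum_nat_cvg (increment_summable k).
rewrite /picard_majorant -(cvg_lim (@Rhausdorff R) h).
apply: nondecreasing_cvgn_le; last exact: cvgP h.
by apply/nondecreasing_seqP => m; rewrite seriesSr lerDl.
Qed.

Lemma picard_majorant_norm : (\esum_(k in [set: G]) (picard_majorant k)%:E <= (16^-1)%:E)%E.
Proof.
apply: (@esum_lsc _ _ (fun n k => series (increment^~ k) n)).
  by move=> k; exact: gsum_nat_cvg (increment_summable k).
move=> n; under eq_esum do rewrite -majorantE; exact: majorant_norm16.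
Qed.

Lemma picard_increment t k n :
  `|(picard n.+1 t k).1 - (picard n t k).1| <= increment n k /\
  `|(picard n.+1 t k).2 - (picard n t k).2| <= increment n k.
Proof.
have [_ _ /(_ t k)] := picard_admissible n; rewrite incrementE lee_fin => h.
split; [apply: le_trans (le_nrm2l _ _) h|apply: le_trans (le_nrm2r _ _) h].
Qed.

Let summable_1 t k : gsummable (fun n => (picard n.+1 t k).1 - (picard n t k).1).
Proof.
apply: le_gsummable (increment_summable k) => n.
by rewrite (ger0_norm (increment_ge0 n k)); case: (picard_increment t k n).
Qed.

Let summable_2 t k : gsummable (fun n => (picard n.+1 t k).2 - (picard n t k).2).
Proof.
apply: le_gsummable (increment_summable k) => n.
by rewrite (ger0_norm (increment_ge0 n k)); case: (picard_increment t k n).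
Qed.

Lemma picard_cvg t k :
  (picard n t k).1 @[n --> \oo] --> (picard_limit t k).1 /\
  (picard n t k).2 @[n --> \oo] --> (picard_limit t k).2.
Proof.
have h (u : nat -> R) : u 0%N = 0 -> series (fun n => u n.+1 - u n) = u.
  move=> u0; apply/funext => n; rewrite /series/= telescope_sumr//.
  by rewrite u0 subr0.
split.
  rewrite -[X in X @ _ --> _](h (fun n => (picard n t k).1))//.
  exact: gsum_nat_cvg.
rewrite -[X in X @ _ --> _](h (fun n => (picard n t k).2))//.
exact: gsum_nat_cvg.
Qed.

Lemma picard_limit_admissible : admissible picard_limit (fun k => (picard_majorant k)%:E).
Proof.
have sym n t k : picard n t (- k) = ((picard n t k).1, - (picard n t k).2).
  by have [[]] := picard_admissible n.
split=> [k t|k t|t k|t k].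
- apply: (@gsum_cvg R nat R (nbhs t) _
    (fun n s => (picard n.+1 s k).1 - (picard n s k).1) _ _ (increment_summable k)).
    by move=> n s; case: (picard_increment s k n).
  by move=> n; have [[c0 _ _ _] [c1 _ _ _] _] := picard_admissible n; apply: cvgB; [exact: c1|exact: c0].
- apply: (@gsum_cvg R nat R (nbhs t) _
    (fun n s => (picard n.+1 s k).2 - (picard n s k).2) _ _ (increment_summable k)).
    by move=> n s; case: (picard_increment s k n).
  by move=> n; have [[_ c0 _ _] [_ c1 _ _] _] := picard_admissible n; apply: cvgB; [exact: c1|exact: c0].
- have e1 n : (picard n t (- k)).1 = (picard n t k).1 by rewrite sym.
  have e2 n : (picard n t (- k)).2 = - (picard n t k).2 by rewrite sym.
  have E1 : (picard_limit t (- k)).1 = (picard_limit t k).1.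
    by apply: eq_gsum => n; rewrite (e1 n.+1) (e1 n).
  have E2 : (picard_limit t (- k)).2 = - (picard_limit t k).2.
    rewrite -gsumN//; apply: eq_gsum => n; rewrite (e2 n.+1) (e2 n); ring.
  by rewrite [LHS]surjective_pairing E1 E2.
- rewrite lee_fin; have [h1 h2] := picard_cvg t k.
  have h : nrm2 (picard n t k).1 (picard n t k).2 @[n --> \oo] -->
    nrm2 (picard_limit t k).1 (picard_limit t k).2 by exact: nrm2_cvg.
  rewrite -(cvg_lim (@Rhausdorff R) h).
  apply: limr_le; first exact: cvgP h.
  apply: nearW => n; apply: le_trans (series_majorant n k); rewrite -lee_fin -majorantE.
  by have [[]] := picard_admissible n.
Qed.

Lemma picard_admissible_limit n : admissible (picard n) (fun k => (picard_majorant k)%:E).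
Proof.
have [[h1 h2 h3 h4] _ _] := picard_admissible n; split => // t k.
by apply: le_trans (h4 t k) _; rewrite majorantE lee_fin series_majorant.
Qed.

(** The limit is taken through three nested operations, each by domination: the Fourier series at a
    point, the spatial average defining a coefficient of N, and the time integral in Duhamel's
    formula. *)
Lemma picard_limit_fixed t k : picard_limit t k = picard_step picard_limit t k.
Proof.
have lA := picard_limit_admissible; have pA := picard_admissible_limit.
have lN := picard_majorant_norm.
have fcv s x : field_of (picard n) s x @[n --> \oo] --> field_of picard_limit s x.
  apply: (@gsum_cvg R G nat \oo _ (fun k n => (picard n s k).1 * cos (int_dot k x) +
    (picard n s k).2 * sin (int_dot k x)) _ picard_majorant).
  - exact: (admissible_gsummable lA lN).
  - by move=> l n; apply: le_trans (le_trig_term _ _ _) _; exact: (admissible_bound (pA n) lN).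
  - move=> l; have [c1 c2] := picard_cvg s l.
    by apply: cvgD; apply: cvgM; [exact: c1|exact: cvg_cst|exact: c2|exact: cvg_cst].
pose M : R := (1 - 16^-1) ^- 3 + 1 + 3 * 16^-1.
have r1 : 16^-1 < 1 :> R by case/andP: r01.
have ncv s : ccoef (nl \o field_of (picard n) s) k @[n --> \oo] -->
      ccoef (nl \o field_of picard_limit s) k /\
    scoef (nl \o field_of (picard n) s) k @[n --> \oo] -->
      scoef (nl \o field_of picard_limit s) k.
  apply: (coef_cvg (M := M)).
  - by move=> n; case: (bm_nl_field (pA n) r01 lN s).
  - by move=> n x; exact: norm_nl_le (norm_field_le (pA n) lN s x) r1.
  - move=> x; apply: (@cvg_comp _ _ _ (fun n => field_of (picard n) s x) (@nl R)).
      exact: fcv.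
    apply: nl_continuous; exact: le_lt_trans (norm_field_le lA lN s x) r1.
have nb n s : amp (nl \o field_of (picard n) s) k <= M *+ 2.
  have bn := bm_nl_field (pA n) r01 lN s.
  apply: le_trans (amp_le_L1 _ (bm_itg _ bn)) _; rewrite lerMn2r orFb.
  apply: le_trans (ler_norm _) _; apply: norm_avg_le.
    by apply: measurableT_comp => //; case: bn.
  by move=> x; rewrite normr_id; exact: norm_nl_le (norm_field_le (pA n) lN s x) r1.
have [h1 h2] := picard_cvg t k.
have [l1 l2] := nl_coef_continuous lA r01 lN k.
have d1 := @duhamel_cvg R (3 * int_norm k ^+ 4) (int_norm k ^+ 4) (ccoef v0 k) _ _ (M *+ 2) t
   (fun n => (nl_coef_continuous (pA n) r01 lN k).1) l1
   (fun n s => le_trans (le_nrm2l _ _) (nb n s)) (fun s => (ncv s).1).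
have d2 := @duhamel_cvg R (3 * int_norm k ^+ 4) (int_norm k ^+ 4) (scoef v0 k) _ _ (M *+ 2) t
   (fun n => (nl_coef_continuous (pA n) r01 lN k).2) l2
   (fun n s => le_trans (le_nrm2r _ _) (nb n s)) (fun s => (ncv s).2).
have s1 : (picard n.+1 t k).1 @[n --> \oo] --> (picard_limit t k).1.
  by have := h1; rewrite -(cvg_shiftS (fun n => (picard n t k).1)).
have s2 : (picard n.+1 t k).2 @[n --> \oo] --> (picard_limit t k).2.
  by have := h2; rewrite -(cvg_shiftS (fun n => (picard n t k).2)).
rewrite [LHS]surjective_pairing /picard_step; congr pair.
  by rewrite -(cvg_lim (@Rhausdorff R) s1) -(cvg_lim (@Rhausdorff R) d1).
by rewrite -(cvg_lim (@Rhausdorff R) s2) -(cvg_lim (@Rhausdorff R) d2).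
Qed.

End picard.

(** * Dissipation and exponential decay *)

Section lattice_norm.
Context {R : realType} {d : nat}.
Local Notation G := 'rV[int]_d.
Implicit Types k l : G.

Lemma le_nrm2_mono (x y z : R) : 0 <= y -> y <= z -> nrm2 x y <= nrm2 x z.
Proof.
move=> y0 yz; rewrite /nrm2 ler_wsqrtr// lerD2l lerXn2r// nnegrE//.
exact: le_trans yz.
Qed.

(** Minkowski's inequality by induction: each step is the triangle inequality in the plane, between
    one coordinate and the norm of the others. *)
Lemma sqrt_sumD (I : Type) (r : seq I) (f g : I -> R) :
  Num.sqrt (\sum_(i <- r) (f i + g i) ^+ 2) <=
  Num.sqrt (\sum_(i <- r) f i ^+ 2) + Num.sqrt (\sum_(i <- r) g i ^+ 2).
Proof.
have sum0 (h : I -> R) s : 0 <= \sum_(i <- s) h i ^+ 2 :> R.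
  by apply: sumr_ge0 => i _; exact: sqr_ge0.
have step (h : I -> R) i s : Num.sqrt (\sum_(j <- i :: s) h j ^+ 2) =
    nrm2 (h i) (Num.sqrt (\sum_(j <- s) h j ^+ 2)) :> R.
  by rewrite big_cons /nrm2 sqr_sqrtr.
elim: r => [|i r IH]; first by rewrite !big_nil sqrtr0 addr0.
rewrite (step (fun i => f i + g i)) !step.
apply: le_trans (le_nrm2_mono _ _ IH) _; first exact: sqrtr_ge0.
exact: nrm2D.
Qed.

Lemma int_normD k l : int_norm (k + l) <= int_norm k + int_norm l :> R.
Proof.
rewrite /int_norm; under eq_bigr do rewrite mxE rmorphD/=.
exact: sqrt_sumD.
Qed.

Lemma int_norm0 : int_norm (0 : G) = 0 :> R.
Proof. by rewrite /int_norm big1 ?sqrtr0// => i _; rewrite mxE expr0n. Qed.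

Lemma int_norm_ge1 k : k != 0 -> 1 <= int_norm k :> R.
Proof.
move=> /eqP k0; have [i ki] : exists i, k ord0 i != 0.
  apply: contrapT => h; apply: k0; apply/rowP => i; rewrite mxE.
  by apply/eqP; apply: contrapT => /negP ki; apply: h; exists i.
rewrite -sqrtr1 /int_norm ler_wsqrtr// (bigD1 i)//= -rmorphXn/=.
apply: ler_wpDr; first by apply: sumr_ge0 => j _; exact: sqr_ge0.
by rewrite ler1z -gtz0_ge1 lt_def sqrf_eq0 ki sqr_ge0.
Qed.

Definition trunc_norm (K : R) k : R := Num.min (int_norm k) K.

Lemma trunc_norm_ge0 K k : 0 <= K -> 0 <= trunc_norm K k.
Proof. by move=> K0; rewrite /trunc_norm le_min int_norm_ge0. Qed.

Lemma trunc_normD K k l : 0 <= K ->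
  trunc_norm K (k + l) <= trunc_norm K k + trunc_norm K l.
Proof.
move=> K0; have := int_normD k l; rewrite /trunc_norm.
have := @int_norm_ge0 R d k; have := @int_norm_ge0 R d l.
move=> h1 h2 h3; case: (leP (int_norm (k + l)) K) => ?;
  by case: (leP (int_norm k) K) => ?; case: (leP (int_norm l) K) => ?; lra.
Qed.

(* The energy of the mode [k] is weighted by [damping], which tends to [1]
   when the truncation level does, so that its dissipation is weighted by the
   bounded and subadditive-like [trunc_norm K k ^+ 4]. *)
Definition damping K k : R := trunc_norm K k ^+ 4 / int_norm k ^+ 4.

Lemma damping_ge0 K k : 0 <= K -> 0 <= damping K k.
Proof. by move=> K0; rewrite divr_ge0 ?exprn_ge0 ?trunc_norm_ge0 ?int_norm_ge0. Qed.

Lemma damping_le1 K k : 0 <= K -> damping K k <= 1.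
Proof.
(* At k = 0 the quotient is 0 / 0, which is 0 by convention. *)
move=> K0; have [->|k0] := eqVneq k 0.
  by rewrite /damping int_norm0 expr0n invr0 mulr0.
have kp : 0 < int_norm k ^+ 4 :> R by rewrite exprn_gt0// (lt_le_trans ltr01 (int_norm_ge1 k0)).
rewrite /damping ler_pdivrMr// mul1r.
apply: lerXn2r; rewrite ?nnegrE ?trunc_norm_ge0 ?int_norm_ge0//.
by rewrite /trunc_norm ge_min lexx.
Qed.

Lemma dampingM K k : k != 0 -> damping K k * int_norm k ^+ 4 = trunc_norm K k ^+ 4.
Proof.
move=> /int_norm_ge1 k1; rewrite /damping divfK// expf_neq0// gt_eqF//.
exact: lt_le_trans k1.
Qed.

(** Spectral gap: a nonzero lattice point has norm at least 1. This is the inequality |v|_4 >= |v|_0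
    at the truncated level, which lets dissipation pay for the exponential weight in time. *)
Lemma damping_le K k : 0 <= K -> k != 0 -> damping K k <= trunc_norm K k ^+ 4.
Proof.
move=> K0 k0; rewrite -dampingM// ler_peMr ?damping_ge0//.
by rewrite exprn_ege1// int_norm_ge1.
Qed.

Lemma trunc_norm_cvg k : \forall n \near \oo, trunc_norm n%:R k = int_norm k.
Proof.
near=> n; rewrite /trunc_norm min_l//; near: n; exact: nbhs_infty_ger.
Unshelve. all: by end_near. Qed.

Lemma damping_cvg k : k != 0 -> damping n%:R k @[n --> \oo] --> (1 : R).
Proof.
move=> k0; apply: cvg_near_cst; apply: filterS (trunc_norm_cvg k) => n h.
rewrite /damping h divff// expf_neq0// gt_eqF//.
exact: lt_le_trans (int_norm_ge1 k0).
Qed.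

Lemma delta_continuous (z : R) : z < 1 -> {for z, continuous (@delta R)}.
Proof.
move=> z1; have w0 : 1 - z != 0 by rewrite gt_eqF// subr_gt0.
have cX n (f : R -> R) : f y @[y --> z] --> f z -> f y ^+ n @[y --> z] --> f z ^+ n.
  by move=> cf; exact: (cvg_comp _ _ cf (@exprn_continuous R n (f z))).
have cw : (1 - y) @[y --> z] --> 1 - z by apply: cvgB; [exact: cvg_cst|exact: cvg_id].
have cV n : (1 - y) ^- n @[y --> z] --> (1 - z) ^- n.
  by apply: cvgV; [rewrite expf_neq0|exact: (cX n (fun y => 1 - y))].
have cT (c : R) n : c * (y ^+ n / (1 - y) ^+ n) @[y --> z] --> c * (z ^+ n / (1 - z) ^+ n).
  by apply: cvgM; [exact: cvg_cst|apply: cvgM; [exact: (cX n id cvg_id)|exact: cV]].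
apply: cvgB; first exact: cvg_cst.
apply: cvgM; first by apply: cvgM; [exact: cvg_cst|exact: cV].
by apply: cvgD; [apply: cvgD; [apply: cvgD; [exact: cvg_cst|exact: (cT 28 1)]|exact: (cT 120 2)]|exact: (cT 120 3)].
Qed.

Lemma delta_le3 (z : R) : 0 <= z < 1 -> delta z <= 3.
Proof.
move=> /andP[z0 z1]; rewrite /delta -!expr_div_n.
have w0 : 0 < 1 - z by rewrite subr_gt0.
have q0 : 0 <= z / (1 - z) by rewrite divr_ge0// ltW.
have a1 : 1 <= (1 - z) ^- 4 by rewrite -exprVn exprn_ege1// invf_ge1//; lra.
have b1 : 1 <= 1 + 28 * (z / (1 - z)) + 120 * (z / (1 - z)) ^+ 2 + 120 * (z / (1 - z)) ^+ 3.
  by rewrite -!addrA lerDl !addr_ge0// mulr_ge0// exprn_ge0.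
move: a1 b1; set a := _ ^- 4; set b := 1 + _ + _ + _; move: a b => a b a1 b1.
have : 1 * 1 <= a * b by apply: ler_pM.
rewrite mul1r -mulrA; lra.
Qed.

(** The continuity argument needs a radius strictly above [z] at which the dissipation rate is still
    positive. *)
Lemma larger_radius (z : R) : z < 1 -> 0 < delta z ->
  exists z', [/\ z < z', z' < 1 & 0 < delta z'].
Proof.
move=> z1 dz; have h := cvgr_gt (delta z) (delta_continuous z1) 0 dz.
have [e /= e0 eP] := h.
pose y := Num.min (e / 2) ((1 - z) / 2).
have y0 : 0 < y by rewrite lt_min !divr_gt0// subr_gt0.
have ye : y <= e / 2 by rewrite ge_min lexx.
have yz : y <= (1 - z) / 2 by rewrite ge_min lexx orbT.
exists (z + y); split; [by rewrite ltrDl|lra|].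
apply: eP; rewrite /= opprD addNKr normrN gtr0_norm//; lra.
Qed.

(* Continuity argument: as long as the function is at most z', it is at most z. *)
Lemma bootstrap (N : R -> R) (z z' : R) : continuous N -> N 0 <= z -> z < z' ->
  (forall s, 0 <= s -> (forall x, 0 <= x <= s -> N x <= z') -> N s <= z) ->
  forall t, 0 <= t -> N t <= z.
Proof.
move=> cN N0 zz' low.
suff bnd s : 0 <= s -> N s <= z'.
  by move=> t t0; apply: low => // x /andP[x0 _]; exact: bnd.
move=> s0; rewrite leNgt; apply/negP => Ns.
pose S := [set x | 0 <= x <= s /\ forall y, 0 <= y <= x -> N y <= z'].
have S0 : S 0.
  split; first by rewrite lexx.
  by move=> y y0; rewrite (_ : y = 0) ?(le_trans N0 (ltW zz'))//; apply/le_anti; rewrite andbC.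
have hS : has_sup S by split; [exists 0|exists s => x [/andP[]]].
pose m := sup S.
have m0 : 0 <= m by exact: sup_upper_bound hS _ S0.
have ms : m <= s by apply: ge_sup; [exists 0|move=> x [/andP[]]].
have Nlt y : 0 <= y -> y < m -> N y <= z'.
  move=> y0 ym; have [x [_ Sx] yx] := sup_gt hS.1 ym.
  by apply: Sx; rewrite y0 ltW.
have Nm : N m <= z'.
  have [m00|m00] := eqVneq m 0; first by rewrite m00 (le_trans N0 (ltW zz')).
  have mp : 0 < m by rewrite lt_def m00.
  rewrite leNgt; apply/negP => h.
  have h' := cvgr_gt (N m) (@cN m) z' h; have [e /= e0 eP] := h'.
  pose x := Num.max 0 (m - e / 2).
  have xm : x < m by rewrite gt_max mp/= ltrBlDr ltrDl divr_gt0.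
  have : N x <= z' by apply: Nlt => //; rewrite le_max lexx.
  rewrite leNgt => /negP; apply; apply: eP => /=.
  have : m - e / 2 <= x by rewrite le_max lexx orbT.
  by rewrite gtr0_norm ?subr_gt0//; lra.
have Nle y : 0 <= y <= m -> N y <= z'.
  by move=> /andP[y0]; rewrite le_eqVlt => /predU1P[->//|]; exact: Nlt.
have Nmz : N m <= z by exact: low.
have ms' : m < s.
  rewrite lt_neqAle ms andbT; apply/eqP => h.
  by move: Ns; rewrite -h ltNge Nm.
have h' := cvgr_lt (N m) (@cN m) z' (le_lt_trans Nmz zz'); have [e /= e0 eP] := h'.
pose x := Num.min s (m + e / 2).
have mx : m < x by rewrite lt_min ms'/= ltrDl divr_gt0.
have xe : x <= m + e / 2 by rewrite ge_min lexx orbT.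
have : S x.
  split; first by rewrite (le_trans m0 (ltW mx))/= ge_min lexx.
  move=> y /andP[y0 yx]; have [ym|my] := leP y m; first by apply: Nle; rewrite y0.
  by apply: ltW; apply: eP => /=; rewrite ltr0_norm ?subr_lt0//; lra.
by move=> /(sup_upper_bound hS); rewrite -/m leNgt mx.
Qed.

End lattice_norm.

Lemma energy_absorb (R : realType) (e la I J dz z : R) :
  e + (3 - la) * I <= z + J -> J <= (3 - dz) * I -> e + (dz - la) * I <= z.
Proof. by lra. Qed.

Lemma le_subst (R : realType) (e c g g' I J z : R) : g = I -> g' = J ->
  e + c * g <= z + g' -> e + c * I <= z + J.
Proof. by move=> <- <-. Qed.

Lemma le_subst2 (R : realType) (x y x' y' : R) : x = x' -> y = y' -> x <= y -> x' <= y'.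
Proof. by move=> <- <-. Qed.

Lemma inv32_lt1 (R : realType) : 32^-1 < 1 :> R. Proof. by lra. Qed.

Lemma expR_shift (R : realType) (x e c : R) : expR e * x <= c -> x <= c * expR (- e).
Proof. by move=> h; rewrite expRN ler_pdivlMr ?expR_gt0// mulrC. Qed.

Lemma le_of_dissipation (R : realType) (S g dz I z : R) :
  0 < dz -> 0 <= g -> g + dz * I <= z -> S <= I -> S <= z / dz.
Proof.
move=> dz0 g0 h SI; rewrite ler_pdivlMr// mulrC.
by apply: le_trans (ler_wpM2l (ltW dz0) SI) _; lra.
Qed.

Lemma le_sum_gsum (R : realType) (G : countType) (f : G -> R) (F : seq G) :
  gsummable f -> (forall k, 0 <= f k) -> uniq F -> \sum_(k <- F) f k <= gsum f.
Proof.
move=> sf f0 uF; rewrite -lee_fin gsum_esum//.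
apply: esum_ge; exists [set` F]; first by split=> //; exact: finite_seq.
by rewrite -fsbig_seq// sumEFin.
Qed.

Lemma sum_Rint (R : realType) (I : eqType) (F : seq I) (w w' : I -> R) (f : I -> R -> R) T :
  (forall k, continuous (f k)) -> {in F, w =1 w'} ->
  \sum_(k <- F) (w k * \int[@lebesgue_measure R]_(s in `[0, T]) f k s) =
  \int[@lebesgue_measure R]_(s in `[0, T]) \sum_(k <- F) (w' k * f k s).
Proof.
move=> cf; elim: F => [|k F IH] ww'.
  rewrite big_nil; under eq_Rintegral do rewrite big_nil.
  by rewrite Rintegral_cst// mul0r.
have cs : continuous (fun s => \sum_(k <- F) (w' k * f k s)).
  by move=> s; apply: cvg_big_sum => l; apply: cvgM; [exact: cvg_cst|exact: cf].
have ck : continuous (fun s => w' k * f k s) by exact/continuous_cmul/cf.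
rewrite big_cons IH; last by move=> l lF; apply: ww'; rewrite inE lF orbT.
under [RHS]eq_Rintegral do rewrite big_cons.
rewrite RintegralD//; [|exact: continuous_itv_integrable..].
rewrite RintegralZl//; last by apply: continuous_itv_integrable; exact: cf.
by rewrite ww'// inE eqxx.
Qed.

(** * Energy inequality and exponential decay *)

Section decay.
Context {R : realType} {d : nat}.
Local Notation G := 'rV[int]_d.
Local Notation leb := (@lebesgue_measure R).
Variables (p : R -> G -> R * R) (A : G -> \bar R) (v0 : 'rV[R]_d -> R).
Hypothesis v0_wien : wien v0.
Hypothesis v0_mean : amp v0 0 = 0.
Hypothesis pA : admissible p A.
Hypothesis Ar : (\esum_(k in [set: G]) A k <= (16^-1)%:E)%E.
Hypothesis p_fixed : forall t k, p t k = picard_step v0 p t k.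

Let v t := field_of p t.
Let a k t := amp (v t) k.
Let b k t := amp (nl \o v t) k.
Let z := gsum (amp v0).
Let r01 : 0 <= (16^-1 : R) < 1. Proof. by apply/andP; split; lra. Qed.

Lemma amp_continuous k : continuous (a k).
Proof.
have [c1 c2 _ _] := pA; move=> t; rewrite /a /v.
under eq_fun do rewrite (amp_field pA Ar).
by apply: nrm2_cvg; [exact: c1|exact: c2].
Qed.

Lemma amp_nl_continuous k : continuous (b k).
Proof.
have [c1 c2] := nl_coef_continuous pA r01 Ar k.
by move=> t; apply: nrm2_cvg; [exact: c1|exact: c2].
Qed.

Lemma amp_bound k t : a k t <= fine (A k).
Proof. by rewrite /a /v (amp_field pA Ar); exact: (admissible_bound pA Ar). Qed.

Let B k : R := fine (nl_majorant A A k).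

Let nlAA : (\esum_(k in [set: G]) nl_majorant A A k < +oo)%E.
Proof.
have r0 : 0 <= 16^-1 :> R by rewrite invr_ge0.
exact: le_lt_trans (nl_majorant_norm (admissible_ge0 pA) (admissible_ge0 pA) r01 r0 Ar Ar)
  (ltry _).
Qed.

Let BE k : nl_majorant A A k = (B k)%:E.
Proof.
have n0 := nl_majorant_ge0 (admissible_ge0 pA) (admissible_ge0 pA).
rewrite /B fineK// ge0_fin_numE//; apply: le_lt_trans nlAA.
by apply: esum_ge; exists [set k]; [split|rewrite fsbig_set1].
Qed.

Let B_ge0 k : 0 <= B k.
Proof.
rewrite -lee_fin -BE; exact: (nl_majorant_ge0 (admissible_ge0 pA) (admissible_ge0 pA)).
Qed.

Lemma nl_majorant_summable : gsummable B.
Proof. by rewrite /gsummable gnormE//; under eq_esum do rewrite -BE. Qed.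

(** Since N(0) = 0, this is the Lipschitz estimate against the zero function, with [A] also
    majorising the difference. *)
Lemma amp_nl_bound k t : b k t <= B k.
Proof.
have w := admissible_wien pA Ar t.
have n0 : nl (0 : R) = 0 by rewrite /nl addr0 expr1n invr1 subrr mulr0 addr0.
have := eamp_nl_diff_le (admissible_ge0 pA) (admissible_ge0 pA) r01 Ar k w wien_cst0
  (eamp_field_le pA Ar t).
have -> : (nl \o field_of p t) \- (nl \o (fun=> 0)) = nl \o field_of p t.
  by apply/funext => x /=; rewrite n0 subr0.
have -> : (field_of p t \- (fun=> 0)) = field_of p t.
  by apply/funext => x /=; rewrite subr0.
rewrite BE lee_fin; apply; last exact: (eamp_field_le pA Ar t).
by move=> l; rewrite /eamp amp_cst0 (admissible_ge0 pA).
Qed.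

(** At k = 0 both damping rate and forcing carry the factor |k|^4 = 0, so the mean is conserved. *)
Lemma amp_mean t : a 0 t = 0.
Proof.
have c0 : ccoef v0 0 = 0.
  by apply/eqP; rewrite -normr_le0 -v0_mean; exact: le_nrm2l.
have s0 : scoef v0 0 = 0.
  by apply/eqP; rewrite -normr_le0 -v0_mean; exact: le_nrm2r.
rewrite /a /v (amp_field pA Ar) p_fixed /picard_step /=.
by rewrite int_norm0 expr0n mulr0 /duhamel oppr0 !mul0r expR0 !mul1r !addr0 c0 s0 nrm2_00.
Qed.

(** The modulus [a k] is dominated by the scalar Duhamel solution [y] driven by the moduli of the
    forcing, for which the energy balance is an equality; the inequality is recovered by returning
    from [y] to [a k] on the left. *)
Lemma mode_energy k la K t : 0 <= t -> 0 <= K -> 0 <= la <= 3 ->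
  damping K k * (expR (la * t) * a k t) +
  (3 - la) * (trunc_norm K k ^+ 4 * \int[leb]_(s in `[0, t]) (expR (la * s) * a k s)) <=
  damping K k * amp v0 k +
  trunc_norm K k ^+ 4 * \int[leb]_(s in `[0, t]) (expR (la * s) * b k s).
Proof.
move=> t0 K0 /andP[la0 la3].
set ka : R := int_norm k ^+ 4; set om := trunc_norm K k ^+ 4.
have ca := @amp_continuous k; have cb := @amp_nl_continuous k.
have om0 : 0 <= om by rewrite exprn_ge0// trunc_norm_ge0.
have int0 (f : R -> R) : (forall s, 0 <= f s) ->
    0 <= \int[leb]_(s in `[0, t]) (expR (la * s) * f s).
  by move=> f0; apply: Rintegral_ge0 => s _; rewrite mulr_ge0 ?expR_ge0.
have [k0|k0] := eqVneq k 0.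
  rewrite /damping k0 int_norm0 [0 ^+ 4]expr0n invr0 mulr0 !mul0r add0r add0r.
  rewrite (@eq_Rintegral _ _ _ leb `[0, t] (cst 0)); last first.
    by move=> s _; rewrite amp_mean mulr0.
  rewrite Rintegral_cst// mul0r mulr0 mulr0 mulr_ge0//; last by apply: int0 => s; exact: amp_ge0.
set y := duhamel (3 * ka) ka (amp v0 k) (b k).
have cy : continuous y by exact: duhamel_continuous.
have ay s : a k s <= y s.
  rewrite /a /v (amp_field pA Ar) p_fixed.
  have [c1 c2] := nl_coef_continuous pA r01 Ar k.
  by apply: nrm2_duhamel => //; rewrite exprn_ge0// int_norm_ge0.
have H := @duhamel_energy R (3 * ka) ka la (amp v0 k) (b k) t t0 cb.
rewrite -/y in H.
have le1 : expR (la * t) * a k t <= expR (la * t) * y t by rewrite ler_pM2l ?expR_gt0.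
have le2 : \int[leb]_(s in `[0, t]) (expR (la * s) * a k s) <=
    \int[leb]_(s in `[0, t]) (expR (la * s) * y s).
  apply: le_Rintegral => //.
  - exact/continuous_itv_integrable/continuous_exp_mul.
  - exact/continuous_itv_integrable/continuous_exp_mul.
  - by move=> s _; rewrite ler_pM2l ?expR_gt0.
have ia0 : 0 <= \int[leb]_(s in `[0, t]) (expR (la * s) * a k s).
  by apply: int0 => s; exact: amp_ge0.
have sg0 := @damping_ge0 R d K k K0; have sgM := @dampingM R d K k k0.
have sgle := @damping_le R d K k K0 k0.
rewrite -/ka -/om in sgM sgle.
move: (damping K k) (expR _ * a k t) (expR _ * y t) (\int[leb]_(s in _) (_ * a k s))
  (\int[leb]_(s in _) (_ * y s)) (\int[leb]_(s in _) (_ * b k s)) (amp v0 k)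
  H le1 le2 ia0 sg0 sgM sgle => sg ea ey ia iy ib a0 H le1 le2 ia0 sg0 sgM sgle.
apply: (@le_trans _ _ (sg * (ey + (3 * ka - la) * iy))); last first.
  by rewrite H mulrDr mulrA sgM.
(* All three terms are nonnegative: [y] dominates [a k], and sg <= om by the spectral gap, which
   with la <= 3 also gives la sg <= 3 om. *)
rewrite -subr_ge0 (_ : _ - _ = sg * (ey - ea) + (3 * om - la * sg) * (iy - ia) +
  la * (om - sg) * ia); last by rewrite -sgM; ring.
have : la * sg <= 3 * om by rewrite ler_pM.
by move=> h; rewrite !addr_ge0// !mulr_ge0// subr_ge0.
Qed.

Section time_sums.
Variables (f : G -> R -> R) (M : G -> R) (la t : R).
Hypothesis f0 : forall k s, 0 <= f k s.
Hypothesis fM : forall k s, f k s <= M k.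
Hypothesis sM : gsummable M.
Hypothesis cf : forall k, continuous (f k).
Hypothesis t0 : 0 <= t.

Lemma gsum_continuous : continuous (fun s => gsum (f^~ s)).
Proof.
move=> s; apply: (@gsum_cvg R G R (nbhs s) _ f _ M sM).
  by move=> k x; rewrite ger0_norm.
by move=> k; exact: cf.
Qed.

Lemma Rint_exp_summable :
  gsummable (fun k => \int[leb]_(s in `[0, t]) (expR (la * s) * f k s)).
Proof.
have M0 k : 0 <= M k := le_trans (f0 k 0) (fM k 0).
have cE : continuous (fun s : R => expR (la * s)) by exact: expR_scale_continuous.
apply: le_gsummable (gsummableZ (\int[leb]_(s in `[0, t]) expR (la * s)) sM) => k.
have e0 : 0 <= \int[leb]_(s in `[0, t]) expR (la * s).
  by apply: Rintegral_ge0 => s _; exact: expR_ge0.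
rewrite ger0_norm; last by apply: Rintegral_ge0 => s _; rewrite mulr_ge0 ?expR_ge0.
rewrite ger0_norm ?mulr_ge0// mulrC -RintegralZl//; last exact: continuous_itv_integrable.
apply: le_Rintegral => //.
- exact/continuous_itv_integrable/continuous_exp_mul.
- exact/continuous_itv_integrable/continuous_cmul.
- by move=> s _; rewrite mulrC ler_wpM2r ?expR_ge0.
Qed.

Lemma gsum_Rint_exp :
  gsum (fun k => \int[leb]_(s in `[0, t]) (expR (la * s) * f k s)) =
  \int[leb]_(s in `[0, t]) (expR (la * s) * gsum (f^~ s)).
Proof.
have cE : continuous (fun s : R => expR (la * s)) by exact: expR_scale_continuous.
have mE := continuous_measurable cE.
have iE : itg (interval_measure 0 t) (fun s : R => expR (la * s)).
  have /integrableP[_ lE] := @continuous_itv_integrable R 0 t _ cE.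
  apply/integrableP; split; first exact/measurable_EFinP.
  by rewrite ge0_integral_mrestr//; apply/measurable_EFinP/measurableT_comp.
rewrite -Rint_interval; last first.
  exact: (continuous_measurable (@continuous_exp_mul R la _ gsum_continuous)).
under eq_Rintegral do rewrite mulrC.
rewrite (@Rint_gsum R _ _ _ (interval_measure 0 t) f M (fun s => expR (la * s))
  (fun k => continuous_measurable (@cf k)) iE sM); last by move=> k s; rewrite ger0_norm.
apply: eq_gsum => k.
rewrite -Rint_interval; last exact: (continuous_measurable (@continuous_exp_mul R la _ (@cf k))).
by under eq_Rintegral do rewrite mulrC.
Qed.

End time_sums.

Let X K t := gsum (fun k => trunc_norm K k ^+ 4 * a k t).
Let Y K t := gsum (fun k => trunc_norm K k ^+ 4 * b k t).
Let N t := gsum (amp (v t)).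

Let sA : gsummable (fun k => fine (A k)).
Proof. exact: (admissible_gsummable pA Ar). Qed.

Let om_le (K : R) (k : G) : 0 <= K -> trunc_norm K k ^+ 4 <= K ^+ 4 :> R.
Proof.
by move=> K0; rewrite lerXn2r ?nnegrE ?trunc_norm_ge0// /trunc_norm ge_min lexx orbT.
Qed.

Let om_ge0 (K : R) (k : G) : 0 <= K -> 0 <= trunc_norm K k ^+ 4 :> R.
Proof. by move=> K0; rewrite exprn_ge0// trunc_norm_ge0. Qed.

Let oa0 (K : R) (K0 : 0 <= K) k s : 0 <= trunc_norm K k ^+ 4 * a k s.
Proof. by rewrite mulr_ge0 ?om_ge0// amp_ge0. Qed.

Let oaM (K : R) (K0 : 0 <= K) k s : trunc_norm K k ^+ 4 * a k s <= K ^+ 4 * fine (A k).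
Proof. by rewrite ler_pM ?om_ge0 ?amp_ge0 ?om_le// amp_bound. Qed.

Let oac K k : continuous (fun s => trunc_norm K k ^+ 4 * a k s).
Proof. by apply: continuous_cmul; exact: amp_continuous. Qed.

Let ob0 (K : R) (K0 : 0 <= K) k s : 0 <= trunc_norm K k ^+ 4 * b k s.
Proof. by rewrite mulr_ge0 ?om_ge0// amp_ge0. Qed.

Let obM (K : R) (K0 : 0 <= K) k s : trunc_norm K k ^+ 4 * b k s <= K ^+ 4 * B k.
Proof. by rewrite ler_pM ?om_ge0 ?amp_ge0 ?om_le// amp_nl_bound. Qed.

Let obc K k : continuous (fun s => trunc_norm K k ^+ 4 * b k s).
Proof. by apply: continuous_cmul; exact: amp_nl_continuous. Qed.

Lemma trunc_summable K t : 0 <= K -> gsummable (fun k => trunc_norm K k ^+ 4 * a k t).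
Proof.
move=> K0; apply: le_gsummable (gsummableZ (K ^+ 4) sA) => k.
rewrite !ger0_norm ?oa0 ?oaM// mulr_ge0 ?exprn_ge0// fine_ge0//.
exact: (admissible_ge0 pA).
Qed.

Let X_continuous K : 0 <= K -> continuous (X K).
Proof. move=> K0; exact: (@gsum_continuous (fun k s => trunc_norm K k ^+ 4 * a k s) _ (oa0 K0) (oaM K0) (gsummableZ _ sA) (@oac K)). Qed.

Let Y_continuous K : 0 <= K -> continuous (Y K).
Proof.
move=> K0.
exact: (@gsum_continuous (fun k s => trunc_norm K k ^+ 4 * b k s) _ (ob0 K0) (obM K0) (gsummableZ _ nl_majorant_summable) (@obc K)).
Qed.

Let N_continuous : continuous N.
Proof.
exact: (gsum_continuous (fun k s => amp_ge0 _ _) (fun k s => amp_bound k s) sA amp_continuous).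
Qed.

Let sa t : gsummable (amp (v t)).
Proof. by case: (admissible_wien pA Ar t). Qed.

Lemma damping_summable K t : 0 <= K -> gsummable (fun k => damping K k * a k t).
Proof.
move=> K0; apply: le_gsummable (sa t) => k; rewrite normrM ler_piMl//.
by rewrite ger0_norm ?damping_ge0// damping_le1.
Qed.

(** At a finite truncation level each series is dominated by K^4 times a summable majorant, which
    justifies exchanging the sum over modes with the time integral. *)
Lemma energy_sum K la t : 0 <= t -> 0 <= K -> 0 <= la <= 3 ->
  expR (la * t) * gsum (fun k => damping K k * a k t) +
  (3 - la) * \int[leb]_(s in `[0, t]) (expR (la * s) * X K s) <=
  z + \int[leb]_(s in `[0, t]) (expR (la * s) * Y K s).
Proof.
move=> t0 K0 la03.
have I0 (f : G -> R -> R) k : continuous (f k) ->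
    \int[leb]_(s in `[0, t]) (expR (la * s) * (trunc_norm K k ^+ 4 * f k s)) =
    trunc_norm K k ^+ 4 * \int[leb]_(s in `[0, t]) (expR (la * s) * f k s).
  move=> cf; rewrite -RintegralZl//; last exact/continuous_itv_integrable/continuous_exp_mul.
  by apply: eq_Rintegral => s _; rewrite mulrCA.
have sE := damping_summable t K0.
have s0 : gsummable (amp v0) by case: v0_wien.
have sE0 : gsummable (fun k => damping K k * amp v0 k).
  apply: le_gsummable s0 => k; rewrite normrM ler_piMl//.
  by rewrite ger0_norm ?damping_ge0// damping_le1.
have sX := Rint_exp_summable la t (oa0 K0) (oaM K0) (gsummableZ (K ^+ 4) sA) (@oac K).
have sY := Rint_exp_summable la t (ob0 K0) (obM K0) (gsummableZ (K ^+ 4) nl_majorant_summable) (@obc K).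
apply: (le_subst (gsum_Rint_exp la t (oa0 K0) (oaM K0) (gsummableZ (K ^+ 4) sA) (@oac K))
  (gsum_Rint_exp la t (ob0 K0) (obM K0) (gsummableZ (K ^+ 4) nl_majorant_summable) (@obc K))).
have EL := etrans (gsumD (gsummableZ (expR (la * t)) sE) (gsummableZ (3 - la) sX))
  (congr2 +%R (gsumZ (expR (la * t)) sE) (gsumZ (3 - la) sX)).
have ER := gsumD sE0 sY.
have hk k : ((fun k => expR (la * t) * (damping K k * a k t)) \+ (fun k => (3 - la) *
    \int[leb]_(s in `[0, t]) (expR (la * s) * (trunc_norm K k ^+ 4 * a k s)))) k <=
    ((fun k => damping K k * amp v0 k) \+ (fun k =>
    \int[leb]_(s in `[0, t]) (expR (la * s) * (trunc_norm K k ^+ 4 * b k s)))) k.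
  rewrite /= (I0 a); last exact: amp_continuous.
  by rewrite (I0 b); [rewrite [expR _ * _]mulrCA; exact: mode_energy|exact: amp_nl_continuous].
have H := le_subst2 EL ER
  (le_gsum (gsummableD (gsummableZ (expR (la * t)) sE) (gsummableZ (3 - la) sX)) (gsummableD sE0 sY) hk).
apply: le_trans H _; rewrite lerD2r; apply: (le_gsum sE0 s0) => k.
exact: ler_piMl (amp_ge0 _ _) (@damping_le1 R d K k K0).
Qed.

Lemma nl_dissipation K z' t : 0 <= K -> 0 < z' < 1 -> N t <= z' ->
  Y K t <= (3 - delta z') * X K t.
Proof.
move=> K0 z01 Nz; have w : wien (v t) := admissible_wien pA Ar t.
have c0 : 0 <= 3 - delta z'.
  by rewrite subr_ge0 delta_le3//; move: z01 => /andP[/ltW -> ->].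
have sX := trunc_summable t K0.
have sY : gsummable (fun k => trunc_norm K k ^+ 4 * b k t).
  apply: le_gsummable (gsummableZ (K ^+ 4) nl_majorant_summable) => k.
  by rewrite !ger0_norm ?ob0 ?obM// mulr_ge0 ?exprn_ge0.
have X0 : 0 <= X K t.
  by rewrite -lee_fin gsum_esum//; [apply: esum_ge0 => k _; rewrite lee_fin oa0|move=> k; exact: oa0].
have mX : moment (trunc_norm K) 4 (eamp (v t)) = (X K t)%:E.
  rewrite /moment gsum_esum; [|exact: sX|by move=> k; exact: oa0].
  by apply: eq_esum => k _; rewrite EFinM.
have mY : moment (trunc_norm K) 4 (eamp (nl \o v t)) = (Y K t)%:E.
  rewrite /moment gsum_esum; [|exact: sY|by move=> k; exact: ob0].
  by apply: eq_esum => k _; rewrite EFinM.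
(* [moment_nl] asks for a positive bound on the moment, while [X K t] may vanish; it is enlarged by
   an amount contributing at most [e]. *)
apply/ler_addgt0Pr => e e0.
have c1 : 0 < 3 - delta z' + 1 by rewrite ltr_wpDl.
have S0 : 0 < X K t + e / (3 - delta z' + 1) by rewrite ltr_wpDl// divr_gt0.
have H1 : (\esum_(k in [set: G]) eamp (v t) k <= z'%:E)%E.
  by rewrite (esum_eamp (sa t)) lee_fin.
have H2 : (moment (trunc_norm K) 4 (eamp (v t)) <= (X K t + e / (3 - delta z' + 1))%:E)%E.
  by rewrite mX lee_fin lerDl divr_ge0// ltW.
have := @moment_nl _ _ _ (fun k => trunc_norm_ge0 k K0) (fun k l => trunc_normD k l K0)
  (v t) _ _ w z01 S0 H1 H2.
rewrite mY lee_fin => H; apply: le_trans H _; rewrite mulrDr lerD2l mulrCA ler_piMr ?(ltW e0)//.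
by rewrite ler_pdivrMr// mul1r lerDl.
Qed.

Lemma decay_main K z' la t : 0 <= t -> 0 <= K -> 0 < z' < 1 -> 0 <= la <= delta z' ->
  (forall s, 0 <= s <= t -> N s <= z') ->
  expR (la * t) * gsum (fun k => damping K k * a k t) +
  (delta z' - la) * \int[leb]_(s in `[0, t]) (expR (la * s) * X K s) <= z.
Proof.
move=> t0 K0 z01 /andP[la0 lad] Nz.
have d3 : delta z' <= 3 by rewrite delta_le3//; move: z01 => /andP[/ltW -> ->].
have la3 : 0 <= la <= 3 by rewrite la0 (le_trans lad).
have H := energy_sum t0 K0 la3.
have XY : \int[leb]_(s in `[0, t]) (expR (la * s) * Y K s) <=
    (3 - delta z') * \int[leb]_(s in `[0, t]) (expR (la * s) * X K s).
  have cX := X_continuous K0; have cY := Y_continuous K0.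
  rewrite -RintegralZl//; last exact/continuous_itv_integrable/continuous_exp_mul.
  apply: le_Rintegral => //.
  - exact/continuous_itv_integrable/continuous_exp_mul.
  - exact/continuous_itv_integrable/continuous_cmul/continuous_exp_mul.
  - move=> s; rewrite /= in_itv/= => s0t.
    by rewrite [leRHS]mulrCA ler_pM2l ?expR_gt0// nl_dissipation// Nz.
exact: energy_absorb H XY.
Qed.

Lemma damping_sum_cvg t : gsum (fun k => damping n%:R k * a k t) @[n --> \oo] --> N t.
Proof.
apply: (@gsum_cvg R G nat \oo _ (fun k n => damping n%:R k * a k t) _ (amp (v t)) (sa t)).
  move=> k n; have d0 := @damping_ge0 R d _ k (ler0n R n).
  rewrite ger0_norm; last exact: mulr_ge0 d0 (amp_ge0 _ _).
  exact: ler_piMl (amp_ge0 _ _) (@damping_le1 R d _ k (ler0n R n)).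
(* The damping of the mode 0 is 0 and does not tend to 1, but this mode vanishes. *)
move=> k; have [->|k0] := eqVneq k 0.
  rewrite (_ : (fun n => _) = fun=> amp (v t) 0); first exact: cvg_cst.
  by apply/funext => n; rewrite [amp _ _]amp_mean amp_mean mulr0.
rewrite -[X in _ --> X]mul1r; apply: cvgM; last exact: cvg_cst.
exact: damping_cvg.
Qed.

(** The truncation level tends to infinity in [decay_main], the dissipation being dropped. Rate 0
    with a radius above [z] closes the continuity argument; the rate delta z at the radius [z]
    itself then gives the decay. *)
Lemma decay_exp z' la t : 0 <= t -> 0 < z' < 1 -> 0 <= la <= delta z' ->
  (forall s, 0 <= s <= t -> N s <= z') -> expR (la * t) * N t <= z.
Proof.
move=> t0 z01 lad Nz.
have h : expR (la * t) * gsum (fun k => damping n%:R k * a k t) @[n --> \oo] -->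
    expR (la * t) * N t by apply: cvgM; [exact: cvg_cst|exact: damping_sum_cvg].
rewrite -(cvg_lim (@Rhausdorff R) h); apply: limr_le; first exact: cvgP h.
apply: nearW => n; apply: le_trans (decay_main t0 (ler0n _ n) z01 lad Nz).
rewrite lerDl mulr_ge0// ?subr_ge0; first by case/andP: lad.
apply: Rintegral_ge0 => s _; rewrite mulr_ge0 ?expR_ge0//.
rewrite -lee_fin gsum_esum; first by apply: esum_ge0 => k _; rewrite lee_fin oa0.
- exact: trunc_summable s (ler0n R n).
- by move=> k; exact: oa0.
Qed.

Let N0 : N 0 = z.
Proof.
rewrite /N /z; apply: eq_gsum => k; rewrite /v (amp_field pA Ar) p_fixed /picard_step/=.
by rewrite !duhamel0.
Qed.

Hypothesis z_small : z < 32^-1.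
Hypothesis delta_gt0 : 0 < delta z.

Let z_ge0 : 0 <= z.
Proof.
rewrite /z -lee_fin -esum_eamp; last by case: v0_wien.
by apply: esum_ge0 => k _; exact: eamp_ge0.
Qed.

Lemma norm_le_initial t : 0 <= t -> N t <= z.
Proof.
have z1 : z < 1 := lt_trans z_small (inv32_lt1 R).
have [z' [zz' z'1 dz']] := larger_radius z1 delta_gt0.
have z01 : 0 < z' < 1 by rewrite (le_lt_trans z_ge0 zz') z'1.
apply: (bootstrap N_continuous _ zz'); first by rewrite N0 lexx.
move=> s s0 Ns; have la0 : 0 <= (0 : R) <= delta z' by rewrite lexx (ltW dz').
by have := decay_exp s0 z01 la0 Ns; rewrite mul0r expR0 mul1r.
Qed.

Lemma norm_decay t : 0 <= t -> N t <= z * expR (- (delta z * t)).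
Proof.
(* The radius is now [z] itself, and [decay_exp] requires a positive one. *)
move=> t0; have [z0|zn0] := eqVneq z 0.
  by rewrite z0 mul0r -z0 norm_le_initial.
have z01 : 0 < z < 1 by rewrite lt_def zn0 z_ge0 (lt_trans z_small (inv32_lt1 R)).
have la0 : 0 <= delta z <= delta z by rewrite lexx (ltW delta_gt0).
have Nz s : 0 <= s <= t -> N s <= z by move=> /andP[s0 _]; exact: norm_le_initial.
have H := decay_exp t0 z01 la0 Nz.
exact: expR_shift H.
Qed.

(** On a finite set of modes a truncation level above all their norms is inactive, so [decay_main]
    bounds the untruncated dissipation, by a constant depending neither on [T] nor on the set. *)
Lemma dissipation_bound : exists C : R, forall T (F : seq G), 0 <= T -> uniq F ->
  \sum_(k <- F) (int_norm k ^+ 4 * \int[leb]_(s in `[0, T]) a k s) <= C.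
Proof.
have z1 : z < 1 := lt_trans z_small (inv32_lt1 R).
have [z' [zz' z'1 dz']] := larger_radius z1 delta_gt0.
have z01 : 0 < z' < 1 by rewrite (le_lt_trans z_ge0 zz') z'1.
exists (z / delta z') => T F T0 uF.
have [K K0 KF] : exists2 K : R, 0 <= K & forall k, k \in F -> int_norm k <= K.
  exists (\sum_(k <- F) int_norm k); first by apply: sumr_ge0 => k _; exact: int_norm_ge0.
  by move=> k kF; rewrite (big_rem k kF) /= lerDl; apply: sumr_ge0 => l _; exact: int_norm_ge0.
have la0 : 0 <= (0 : R) <= delta z' by rewrite lexx ltW.
have Nz s : 0 <= s <= T -> N s <= z'.
  by move=> /andP[s0 _]; apply: le_trans (norm_le_initial s0) (ltW zz').
have := decay_main T0 K0 z01 la0 Nz; rewrite subr0 mul0r expR0 mul1r => H.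
have sa' : 0 <= gsum (fun k => damping K k * a k T).
  rewrite -lee_fin gsum_esum.
  - by apply: esum_ge0 => k _; rewrite lee_fin mulr_ge0 ?damping_ge0 ?amp_ge0.
  - exact: damping_summable T K0.
  - by move=> k; rewrite mulr_ge0 ?damping_ge0 ?amp_ge0.
apply: (le_of_dissipation dz' sa' H).
rewrite (sum_Rint (w' := fun k => trunc_norm K k ^+ 4) T amp_continuous); last first.
  by move=> k kF; rewrite /trunc_norm (min_idPl (KF k kF)).
apply: le_Rintegral.
- exact: measurable_itv.
- apply: continuous_itv_integrable => s; apply: cvg_big_sum => l; exact: oac.
- exact: (continuous_itv_integrable 0 T (continuous_exp_mul (X_continuous K0))).
move=> s _; rewrite mul0r expR0 mul1r; exact: (le_sum_gsum (trunc_summable s K0) (fun k => oa0 K0 k s) uF).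
Qed.

End decay.

(** * Weak formulation *)

Section smooth_functions.
Context {R : realType}.

Lemma CkD (V : normedModType R) n (f g : V -> R) : Ck n f -> Ck n g -> Ck n (f \+ g).
Proof.
elim: n f g => [|n IH] f g [cf df] [cg dg].
  by split=> // x; apply: cvgD; [exact: cf|exact: cg].
split=> [x|v]; first by apply: cvgD; [exact: cf|exact: cg].
have [f1 f2] := df v; have [g1 g2] := dg v.
split=> [x|]; first exact: derivableD.
rewrite (_ : 'D_v (f \+ g) = ('D_v f) \+ ('D_v g)); first exact: IH.
by apply/funext => x; exact: deriveD.
Qed.

Lemma Ck_cst0 (V : normedModType R) n : Ck n (fun _ : V => 0 : R).
Proof.
elim: n => [|n IH]; first by split=> // x; exact: cvg_cst.
split=> [x|v]; first exact: cvg_cst.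
split=> [x|]; first exact: derivable_cst.
rewrite (_ : 'D_v (fun=> 0) = fun=> 0)//; apply/funext => x; exact: derive_cst.
Qed.

Lemma smooth_sum (V : normedModType R) (I : Type) (r : seq I) (h : I -> V -> R) :
  (forall i, smooth (h i)) -> smooth (fun x => \sum_(i <- r) h i x).
Proof.
move=> sh n; elim: r => [|i r IH].
  by under eq_fun do rewrite big_nil; exact: Ck_cst0.
under eq_fun do rewrite big_cons; apply: CkD => //; exact: sh.
Qed.

Lemma smooth_derive (V : normedModType R) (f : V -> R) v :
  smooth f -> smooth (fun x => 'D_v f x).
Proof. by move=> sf n; have [_ /(_ v)[]] := sf n.+1. Qed.

Lemma smooth_continuous (V : normedModType R) (f : V -> R) : smooth f -> continuous f.
Proof. by move=> /(_ 0%N)[]. Qed.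

Lemma smooth_derivable (V : normedModType R) (f : V -> R) x v : smooth f -> derivable f x v.
Proof. by move=> /(_ 1%N)[_ /(_ v)[]]. Qed.

Lemma continuous_pair (T U V : topologicalType) (f : T -> U) (g : T -> V) :
  continuous f -> continuous g -> continuous (fun x => (f x, g x)).
Proof. by move=> cf cg x; have h1 := cf x; have h2 := cg x; exact: (cvg_pair h1 h2). Qed.

Lemma continuous_pairl (U V : topologicalType) (t : U) : continuous (fun y : V => (t, y)).
Proof. by apply: continuous_pair => y; [exact: cvg_cst|exact: cvg_id]. Qed.

(** Equal difference quotients transfer both derivability and the value of the derivative. The two
    domains may differ, which identifies derivatives of slices with directional derivatives in
    space-time. *)
Lemma eq_quotient_derive (V W : normedModType R) (f : V -> R) (g : W -> R) a v b w :
  (forall h : R, f (h *: v + a) = g (h *: w + b)) -> f a = g b ->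
  (derivable f a v -> derivable g b w) /\ 'D_v f a = 'D_w g b.
Proof.
move=> fg ab; have E : (fun h : R => h^-1 *: ((f \o shift a) (h *: v) - f a)) =
    (fun h => h^-1 *: ((g \o shift b) (h *: w) - g b)).
  by apply/funext => h /=; rewrite fg ab.
by rewrite /derivable /derive E.
Qed.

End smooth_functions.

(** * Periodic test functions in space and time *)

Section space_time.
Context {R : realType} {d : nat}.
Local Notation ST := (R * 'rV[R]_d)%type.
Local Notation e_ i := (delta_mx ord0 i : 'rV[R]_d).
Implicit Types (f g : ST -> R) (t : R) (x : 'rV[R]_d).

Definition dt f : ST -> R := fun z => 'D_((1 : R), (0 : 'rV[R]_d)) f z.
Definition dx i f : ST -> R := fun z => 'D_((0 : R), e_ i) f z.
Definition st_laplacian f : ST -> R := fun z => \sum_i dx i (dx i f) z.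
Definition st_periodic f := forall t x i, f (t, x + (2 * pi) *: e_ i) = f (t, x).
Definition st_test f := smooth f /\ st_periodic f.

Lemma st_periodic_derive f v : st_periodic f -> st_periodic (fun z => 'D_v f z).
Proof.
move=> pf t x i; apply: (eq_quotient_derive _ _).2; last exact: pf.
move=> h; exact: (etrans (congr1 (fun y => f (h *: v.1 + t, y)) (addrA _ _ _)) (pf _ _ i)).
Qed.

Lemma st_test_derive f v : st_test f -> st_test (fun z => 'D_v f z).
Proof. by move=> [sf pf]; split; [exact: smooth_derive|exact: st_periodic_derive]. Qed.

Lemma st_test_laplacian f : st_test f -> st_test (st_laplacian f).
Proof.
move=> tf; have ti i : st_test (dx i (dx i f)) by do 2 apply: st_test_derive.
split; first by apply: smooth_sum => i; case: (ti i).
by move=> t x i; apply: eq_bigr => j _; case: (ti j) => _ ->.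
Qed.

Lemma st_shift0 (V : normedModType R) (h : R) (x : V) : h *: 0 + x = x.
Proof. by rewrite scaler0 add0r. Qed.

Lemma is_derive_dt f t x : smooth f -> is_derive t (1 : R) (fun s => f (s, x)) (dt f (t, x)).
Proof.
move=> sf; have [h1 h2] := @eq_quotient_derive R _ _ f (fun s : R => f (s, x)) (t, x)
  ((1 : R), (0 : 'rV[R]_d)) t 1
  (fun h => congr1 f (congr1 (pair (h *: 1 + t)) (st_shift0 h x))) erefl.
by apply: DeriveDef; [exact/h1/smooth_derivable|rewrite -h2].
Qed.

Lemma derive1_dt f t x : derive1 (fun s => f (s, x)) t = dt f (t, x).
Proof.
rewrite derive1E; symmetry; apply: (eq_quotient_derive _ _).2 => // h.
exact: (congr1 f (congr1 (pair (h *: 1 + t)) (st_shift0 h x))).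
Qed.

Lemma derive_dx f t i x : 'D_(e_ i) (fun y => f (t, y)) x = dx i f (t, x).
Proof.
symmetry; apply: (eq_quotient_derive _ _).2 => // h.
exact: (congr1 f (congr1 (pair^~ (h *: e_ i + x)) (st_shift0 h t))).
Qed.

Lemma laplacian_st f t x : laplacian (fun y => f (t, y)) x = st_laplacian f (t, x).
Proof.
apply: eq_bigr => i _.
have E : 'D_(e_ i) (fun y => f (t, y)) = fun y => dx i f (t, y).
  by apply/funext => y; exact: derive_dx.
exact: (etrans (congr1 (fun h => 'D_(e_ i) h x) E) (derive_dx _ _ _ _)).
Qed.

Lemma bilaplacian_st f t x :
  laplacian (laplacian (fun y => f (t, y))) x = st_laplacian (st_laplacian f) (t, x).
Proof.
have E : laplacian (fun y => f (t, y)) = fun y => st_laplacian f (t, y).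
  by apply/funext => y; exact: laplacian_st.
exact: (etrans (congr1 (fun h => laplacian h x) E) (laplacian_st _ _ _)).
Qed.

Lemma is_derive_line f t i x (a : R) : smooth f ->
  is_derive a (1 : R) (fun b => f (t, x + b *: e_ i)) (dx i f (t, x + a *: e_ i)).
Proof.
move=> sf; have E (h : R) : f (h *: ((0 : R), e_ i) + (t, x + a *: e_ i)) =
    f (t, x + (h *: (1 : R) + a) *: e_ i).
  apply: congr1; congr pair; first exact: st_shift0.
  by rewrite [h *: 1]mulr1 scalerDl addrCA.
have [h1 h2] := @eq_quotient_derive R _ _ f (fun b : R => f (t, x + b *: e_ i))
  (t, x + a *: e_ i) ((0 : R), e_ i) a 1 E erefl.
by apply: DeriveDef; [exact/h1/smooth_derivable|rewrite -h2].
Qed.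

Lemma st_periodicZ f t x i (m : int) : st_periodic f ->
  f (t, x + (m%:~R * (2 * pi)) *: e_ i) = f (t, x).
Proof.
move=> pf.
have nat_per n y : f (t, y + (n%:R * (2 * pi)) *: e_ i) = f (t, y).
  elim: n => [|n IH]; first by rewrite mul0r scale0r addr0.
  by rewrite -natr1 mulrDl mul1r scalerDl addrA pf.
case: m => n; first exact: nat_per.
rewrite NegzE mulrNz mulNr scaleNr.
by rewrite -(nat_per n.+1 (x - _)) subrK.
Qed.

Lemma st_bounded f T : continuous f -> st_periodic f ->
  exists M, forall t x, 0 <= t <= T -> `|f (t, x)| <= M.
Proof.
move=> cf pf.
have cK : compact (`[0, T] `*` [set v : 'rV[R]_d | forall i, `[0, 2 * pi]%classic (v ord0 i)]).
  apply: compact_setX; first exact: segment_compact.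
  apply: (@rV_compact _ d (fun=> `[0, 2 * pi]%classic)) => i; exact: segment_compact.
have := continuous_compact (continuous_subspaceT cf) cK.
move=> /compact_bounded [M [_ /(_ (M + 1))]]; rewrite ltrDl ltr01 => /(_ isT) HM.
exists (M + 1) => t x t0T.
have pi0 := @pi2_gt0 R.
(* The number of periods to subtract in each coordinate in order to land in the compact box
   [0, 2 pi]^d. *)
pose m i : int := Num.floor (x ord0 i / (2 * pi)).
have red r : f (t, x + \sum_(i <- r) ((- m i)%:~R * (2 * pi)) *: e_ i) = f (t, x).
  elim: r => [|i r IH]; first by rewrite big_nil addr0.
  by rewrite big_cons addrCA addrC st_periodicZ.
rewrite -(red (index_enum _)); apply: HM.
exists (t, x + \sum_i ((- m i)%:~R * (2 * pi)) *: e_ i) => //.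
split=> //= i; rewrite in_itv/= mxE summxE (bigD1 i)//= big1 => [|j ji].
  rewrite !mxE !eqxx mulr1 addr0 rmorphN/= mulNr subr_ge0.
  have /andP[h1 h2] := floor_itv (x ord0 i / (2 * pi)).
  rewrite -ler_pdivlMr// h1/= lerBlDl -[X in _ + X]mul1r -mulrDl -ler_pdivrMr//.
  by move: h2; rewrite intrD => /ltW.
by rewrite !mxE [i == j]eq_sym (negbTE ji) mulr0.
Qed.

Lemma st_slice_bm f t : continuous f -> st_periodic f -> bm (fun x => f (t, x)).
Proof.
move=> cf pf; split.
  apply: continuous_rV_measurable => x.
  apply: (@continuous_comp _ _ _ (fun y : 'rV[R]_d => (t, y)) f); last exact: cf.
  exact: continuous_pairl.
(* Freezing the time gives a periodic function of space-time, bounded over the degenerate time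
   interval [0, 0]. *)
pose g (z : ST) := f (t, z.2).
have cg : continuous g.
  move=> z; apply: (@continuous_comp _ _ _ (fun z : ST => (t, z.2)) f); last exact: cf.
  apply: (@continuous_pair _ _ _ (fun=> t) snd) => y; [exact: cvg_cst|exact: cvg_snd].
have [M HM] := @st_bounded g 0 cg (fun s x i => pf t x i).
by exists M => x; apply: (HM 0 x); rewrite lexx.
Qed.

End space_time.

(** * Integration by parts on the torus *)

Section torus_ibp.
Context {R : realType}.

Lemma consrV_line n (a : R) (x : 'rV[R]_n) (b : R) :
  consrV (a, x) + b *: delta_mx ord0 ord0 = consrV (a + b, x).
Proof.
apply/rowP => i; rewrite !mxE; case: unliftP => [j ->|->] /=.
  by rewrite mulr0 addr0.
by rewrite mulr1.
Qed.

Lemma consrV_shift n (a : R) (x : 'rV[R]_n) j (b : R) :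
  consrV (a, x + b *: delta_mx ord0 j) = consrV (a, x) + b *: delta_mx ord0 (lift ord0 j).
Proof.
apply/rowP => i; rewrite !mxE; case: unliftP => [l ->|->] /=.
  by rewrite !mxE (inj_eq lift_inj).
by rewrite mulr0 addr0.
Qed.

Lemma is_derive_continuous (F f : R -> R) : (forall a, is_derive a (1 : R) F (f a)) ->
  continuous F.
Proof.
by move=> h a; apply/differentiable_continuous/derivable1_diffP; have [] := h a.
Qed.

(** Periodicity cancels the boundary terms. If the derivative is along the first coordinate, that
    coordinate is integrated innermost; otherwise it is frozen and the induction hypothesis applies
    to the slices. *)
Lemma Rint_line_derive n (i : 'I_n) (f g : 'rV[R]_n -> R) : bm g ->
  (forall x, continuous (fun a : R => g (x + a *: delta_mx ord0 i))) ->
  (forall x a, is_derive a (1 : R) (fun b => f (x + b *: delta_mx ord0 i))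
     (g (x + a *: delta_mx ord0 i))) ->
  (forall x, f (x + (2 * pi) *: delta_mx ord0 i) = f x) ->
  \int[torus n]_x g x = 0.
Proof.
elim: n i f g => [[]//|n IH] i f g bg cg dg pf.
case: (unliftP ord0 i) cg dg pf => [j ->|->] cg dg pf.
  rewrite Rint_torusS//; under eq_Rintegral => a _.
    have -> : \int[torus n]_x g (consrV (a, x)) = 0.
      apply: (IH j (fun x => f (consrV (a, x))) (fun x => g (consrV (a, x)))).
      - exact: (bm_section1 a (bm_consrV bg)).
      - by move=> x; under eq_fun do rewrite consrV_shift; exact: cg.
      - move=> x b; rewrite consrV_shift; under eq_fun do rewrite consrV_shift; exact: dg.
      - by move=> x; rewrite consrV_shift pf.
    over.
  by rewrite /Rintegral integral0.
rewrite Rint_torusS'//; under eq_Rintegral => x _.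
  rewrite Rint_circle; last by case: (bm_section2 x (bm_consrV bg)).
  have E (a : R) : consrV (a, x) = consrV (0, x) + a *: delta_mx ord0 ord0.
    by rewrite consrV_line add0r.
  rewrite (@Rint_FTC2 _ (fun a => f (consrV (0, x) + a *: delta_mx ord0 ord0))).
  - rewrite -!E -(pf (consrV (- pi, x))) consrV_line (_ : - pi + 2 * pi = pi) ?subrr; last by ring.
    over.
  - exact/ltW/Npi_lt_pi.
  - exact: (is_derive_continuous (dg (consrV (0, x)))).
  - by under eq_fun do rewrite E; exact: cg.
  - move=> a _; have := dg (consrV (0, x)) a; rewrite -E => h.
    by split; [exact: ex_derive|exact: derive_val].
by rewrite /Rintegral integral0.
Qed.

Lemma cos_intpi2 (y : R) (m : int) : cos (y + m%:~R * (2 * pi)) = cos y /\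
  sin (y + m%:~R * (2 * pi)) = sin y.
Proof.
have e : m%:~R * (2 * pi) = m%:~R * pi + m%:~R * pi :> R by ring.
have s0 := @sin_intpi R m; have c2 := cos2Dsin2 (m%:~R * pi : R).
move: c2; rewrite s0 expr0n addr0 expr2 => c2.
by rewrite e cosD sinD (cosD (_ * _)) (sinD (_ * _)) s0 c2; split; ring.
Qed.

Lemma int_dot_line n (k : 'rV[int]_n) (x : 'rV[R]_n) (a : R) i :
  int_dot k (x + a *: delta_mx ord0 i) = int_dot k x + (k ord0 i)%:~R * a.
Proof.
rewrite /int_dot; under eq_bigr do rewrite !mxE mulrDr.
rewrite big_split/=; congr (_ + _); rewrite (bigD1 i)//= big1 => [|j ji].
  by rewrite !eqxx mulr1 addr0.
by rewrite (negbTE ji) !mulr0.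
Qed.

(** The derivative multiplies c - i s by i times the frequency, which exchanges cosine and sine
    parts. It follows from [Rint_line_derive] for the products of [f] with the two waves. *)
Lemma coef_line_derive n (i : 'I_n) (f g : 'rV[R]_n -> R) k : bm f -> bm g ->
  (forall x, continuous (fun a : R => g (x + a *: delta_mx ord0 i))) ->
  (forall x a, is_derive a (1 : R) (fun b => f (x + b *: delta_mx ord0 i))
     (g (x + a *: delta_mx ord0 i))) ->
  (forall x, f (x + (2 * pi) *: delta_mx ord0 i) = f x) ->
  ccoef g k = (k ord0 i)%:~R * scoef f k /\ scoef g k = - ((k ord0 i)%:~R * ccoef f k).
Proof.
move=> bf bg cg dg pf; set m := k ord0 i.
have cf x := is_derive_continuous (dg x).
have bfc : bm (fun x => f x * cos (int_dot k x)) by exact: (bmM bf (bm_cos k)).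
have bfs : bm (fun x => f x * sin (int_dot k x)) by exact: (bmM bf (bm_sin k)).
have bgc : bm (fun x => g x * cos (int_dot k x)) by exact: (bmM bg (bm_cos k)).
have bgs : bm (fun x => g x * sin (int_dot k x)) by exact: (bmM bg (bm_sin k)).
have cl (x : 'rV[R]_n) : continuous (fun a : R => int_dot k x + m%:~R * a).
  by move=> a; apply: cvgD; [exact: cvg_cst|exact: continuous_scale].
have ccos (x : 'rV[R]_n) : continuous (fun a : R => cos (int_dot k x + m%:~R * a)).
  by move=> a; apply: continuous_comp; [exact: cl|exact: continuous_cos].
have csin (x : 'rV[R]_n) : continuous (fun a : R => sin (int_dot k x + m%:~R * a)).
  by move=> a; apply: continuous_comp; [exact: cl|exact: continuous_sin].
have per (x : 'rV[R]_n) : cos (int_dot k (x + (2 * pi) *: delta_mx ord0 i)) = cos (int_dot k x) /\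
    sin (int_dot k (x + (2 * pi) *: delta_mx ord0 i)) = sin (int_dot k x).
  by rewrite int_dot_line; exact: cos_intpi2.
have e1 : \int[torus n]_x (g x * cos (int_dot k x) - m%:~R * (f x * sin (int_dot k x))) = 0.
  apply: (Rint_line_derive (i := i) (f := fun x => f x * cos (int_dot k x))).
  - exact: (bmB bgc (bmZ _ bfs)).
  - move=> x; under eq_fun do rewrite int_dot_line -/m.
    move=> a; apply: cvgB; first by apply: cvgM; [exact: cg|exact: ccos].
    by apply: cvgM; [exact: cvg_cst|apply: cvgM; [exact: cf|exact: csin]].
  - move=> x a; under eq_fun do rewrite int_dot_line -/m.
    rewrite int_dot_line -/m; have h := dg x a.
    by apply: is_derive_eq; rewrite /GRing.scale/=; ring.
  - by move=> x; rewrite pf (per x).1.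
have e2 : \int[torus n]_x (g x * sin (int_dot k x) + m%:~R * (f x * cos (int_dot k x))) = 0.
  apply: (Rint_line_derive (i := i) (f := fun x => f x * sin (int_dot k x))).
  - exact: (bmD bgs (bmZ _ bfc)).
  - move=> x; under eq_fun do rewrite int_dot_line -/m.
    move=> a; apply: cvgD; first by apply: cvgM; [exact: cg|exact: csin].
    by apply: cvgM; [exact: cvg_cst|apply: cvgM; [exact: cf|exact: ccos]].
  - move=> x a; under eq_fun do rewrite int_dot_line -/m.
    rewrite int_dot_line -/m; have h := dg x a.
    by apply: is_derive_eq; rewrite /GRing.scale/=; ring.
  - by move=> x; rewrite pf (per x).2.
split.
  apply/eqP; rewrite -subr_eq0 /ccoef /scoef -avgZ; last exact: bm_itg.
  by rewrite -avgB; [rewrite /avg e1 mulr0|exact: bm_itg|exact/bm_itg/bmZ].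
apply/eqP; rewrite -addr_eq0 /ccoef /scoef -avgZ; last exact: bm_itg.
by rewrite -avgD; [rewrite /avg e2 mulr0|exact: bm_itg|exact/bm_itg/bmZ].
Qed.

End torus_ibp.

Section test_coefficients.
Context {R : realType} {d : nat}.
Local Notation ST := (R * 'rV[R]_d)%type.
Implicit Types (f : ST -> R) (t : R) (k : 'rV[int]_d).

Lemma st_test_bm f t : st_test f -> bm (fun x => f (t, x)).
Proof. by move=> [sf pf]; exact: (st_slice_bm t (smooth_continuous sf) pf). Qed.

Lemma coef_sum (I : Type) (r : seq I) (h : I -> 'rV[R]_d -> R) k : (forall i, bm (h i)) ->
  ccoef (fun x => \sum_(i <- r) h i x) k = \sum_(i <- r) ccoef (h i) k /\
  scoef (fun x => \sum_(i <- r) h i x) k = \sum_(i <- r) scoef (h i) k.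
Proof.
move=> bh; elim: r => [|i r [IH1 IH2]].
  rewrite !big_nil /ccoef /scoef.
  under eq_avg do rewrite big_nil mul0r.
  under [X in _ /\ X = _]eq_avg do rewrite big_nil mul0r.
  by rewrite avg_cst.
have bs := bm_sum r bh; rewrite !big_cons -IH1 -IH2.
rewrite -(ccoefD k (bm_itg _ (bh i)) (bm_itg _ bs)) -(scoefD k (bm_itg _ (bh i)) (bm_itg _ bs)).
by split; apply: eq_avg => x /=; rewrite big_cons.
Qed.

Lemma coef_dx f t i k : st_test f ->
  ccoef (fun x => dx i f (t, x)) k = (k ord0 i)%:~R * scoef (fun x => f (t, x)) k /\
  scoef (fun x => dx i f (t, x)) k = - ((k ord0 i)%:~R * ccoef (fun x => f (t, x)) k).
Proof.
move=> tf; have tg : st_test (dx i f) by exact: st_test_derive.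
apply: coef_line_derive.
- exact: st_test_bm.
- exact: st_test_bm.
- move=> x; exact: (is_derive_continuous (fun a => is_derive_line t i x a tg.1)).
- by move=> x a; apply: is_derive_line; case: tf.
- by move=> x; case: tf => _ ->.
Qed.

Lemma coef_laplacian f t k : st_test f ->
  ccoef (fun x => st_laplacian f (t, x)) k = - (int_norm k ^+ 2 * ccoef (fun x => f (t, x)) k) /\
  scoef (fun x => st_laplacian f (t, x)) k = - (int_norm k ^+ 2 * scoef (fun x => f (t, x)) k).
Proof.
move=> tf; have t1 i : st_test (dx i f) by exact: st_test_derive.
have t2 i : st_test (dx i (dx i f)) by exact: st_test_derive.
have [-> ->] := coef_sum (index_enum 'I_d) k (fun i => st_test_bm t (t2 i)).
have n2 : int_norm k ^+ 2 = \sum_i (k ord0 i)%:~R ^+ 2 :> R.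
  by rewrite sqr_sqrtr//; apply: sumr_ge0 => i _; exact: sqr_ge0.
rewrite n2 !mulr_suml -!sumrN; split; apply: eq_bigr => i _.
  by have [-> _] := coef_dx t i k (t1 i); have [_ ->] := coef_dx t i k tf; ring.
by have [_ ->] := coef_dx t i k (t1 i); have [-> _] := coef_dx t i k tf; ring.
Qed.

Lemma coef_bilaplacian f t k : st_test f ->
  ccoef (fun x => st_laplacian (st_laplacian f) (t, x)) k =
    int_norm k ^+ 4 * ccoef (fun x => f (t, x)) k /\
  scoef (fun x => st_laplacian (st_laplacian f) (t, x)) k =
    int_norm k ^+ 4 * scoef (fun x => f (t, x)) k.
Proof.
move=> tf; have [c1 s1] := coef_laplacian t k tf.
have [-> ->] := coef_laplacian t k (st_test_laplacian tf).
by rewrite c1 s1; split; ring.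
Qed.

End test_coefficients.

Lemma avg_combine (R : realType) (x1 x2 x3 x4 y1 y3 y4 : R) :
  x1 = y1 -> x2 = 0 -> x3 = y3 -> x4 = y4 -> x1 + x2 + (- 3 * x3 + x4) = y1 + (- 3 * y3 + y4).
Proof. by move=> -> -> -> ->; rewrite addr0. Qed.

Lemma norm_CS (R : realType) (a b x y M N : R) : nrm2 a b <= M -> nrm2 x y <= N ->
  `|a * x + b * y| <= M * N.
Proof.
move=> h1 h2; apply: (@le_trans _ _ (nrm2 a b * nrm2 x y)); last first.
  by apply: ler_pM => //; exact: nrm2_ge0.
rewrite ler_norml nrm2_CS andbT lerNl -(nrm2N a b).
by apply: le_trans (nrm2_CS _ _ _ _); rewrite !mulNr opprD.
Qed.

Lemma mode_arith (R : realType) (M1 M2 a b C1 S1 C2 S2 c s e g ka : R) :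
  0 <= M1 -> 0 <= M2 -> 0 <= a -> 0 <= b ->
  `|C1 * c + S1 * s| <= 2 * M1 * a -> `|ka * C2 * c + ka * S2 * s| <= 2 * M2 * a ->
  `|ka * C2 * e + ka * S2 * g| <= 2 * M2 * b ->
  `|C1 * c + C2 * (ka * e - 3 * ka * c) + (S1 * s + S2 * (ka * g - 3 * ka * s))| <=
  (2 * M1 + 6 * M2) * (a + b).
Proof.
move=> M10 M20 a0 b0 h1 h2 h3.
rewrite (_ : _ + _ = (C1 * c + S1 * s) + (- 3) * (ka * C2 * c + ka * S2 * s) +
  (ka * C2 * e + ka * S2 * g)); last by ring.
have h4 : `|(- 3) * (ka * C2 * c + ka * S2 * s)| <= 3 * (2 * M2 * a).
  by rewrite normrM (_ : `|- 3| = 3) ?ler_pM2l// normrN ger0_norm.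
apply: le_trans (ler_normD _ _) _; apply: le_trans (lerD (ler_normD _ _) (lexx _)) _.
apply: le_trans (lerD (lerD h1 h4) h3) _.
rewrite -subr_ge0 (_ : _ - _ = 2 * (M1 * b) + 4 * (M2 * b)); last by ring.
by rewrite addr_ge0// !mulr_ge0.
Qed.

(** * The weak equation, mode by mode *)

Section weak_form.
Context {R : realType} {d : nat}.
Local Notation ST := (R * 'rV[R]_d)%type.
Local Notation mST := (measurableTypeR R * 'rV[R]_d)%type.
Local Notation leb := (@lebesgue_measure R).
Local Notation G := 'rV[int]_d.
Variable T : R.
Hypothesis T0 : 0 < T.
Local Notation mI := (interval_measure 0 T).
Implicit Types (f : ST -> R) (t : R) (k : G).

(** Evaluation at the clamped time makes integrands bounded on the whole line and leaves them
    unchanged on [0, T], so that the calculus of bounded measurable functions applies. *)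
Definition clamp (t : R) : R := Num.min (pos_time t) T.

Lemma clamp_itv t : 0 <= clamp t <= T.
Proof. by rewrite /clamp le_min pos_time_ge0 (ltW T0)/= ge_min lexx orbT. Qed.

Lemma clampE t : 0 <= t <= T -> clamp t = t.
Proof. by move=> /andP[t0 tT]; rewrite /clamp pos_timeE// min_l. Qed.

Lemma clamp_continuous : continuous clamp.
Proof.
move=> t; apply: (@continuous_min R R pos_time (cst T)); first exact: pos_time_continuous.
exact: cvg_cst.
Qed.

Lemma Rint_clamp (h : R -> R) : measurable_fun [set: measurableTypeR R] (h \o clamp) ->
  \int[mI]_s h (clamp s) = \int[leb]_(s in `[0, T]) h s.
Proof.
move=> mh; rewrite (Rint_interval _ _ mh); apply: eq_Rintegral => s.
by rewrite inE/= in_itv/= => s0T; rewrite clampE.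
Qed.

Lemma bm_clamp f : continuous f -> st_periodic f ->
  bm (fun z : mST => f (clamp z.1, z.2)).
Proof.
move=> cf pf; have [M HM] := st_bounded T cf pf.
split; last by exists M => z; exact/HM/clamp_itv.
apply: continuous_prod_measurable => z.
apply: (@continuous_comp _ _ _ (fun z : ST => (clamp z.1, z.2)) f); last exact: cf.
apply: (@continuous_pair _ _ _ (clamp \o fst) snd) => y; last exact: cvg_snd.
by apply: continuous_comp; [exact: cvg_fst|exact: clamp_continuous].
Qed.

Lemma bm_snd (w : 'rV[R]_d -> R) : bm w -> bm (fun z : mST => w z.2).
Proof. by move=> [mw [M wM]]; split; [exact: measurableT_comp|exists M]. Qed.

Lemma st_periodic_time (y : R -> R) : st_periodic (fun z : ST => y z.1).
Proof. by []. Qed.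

Lemma bm_avg_clamp f (w : 'rV[R]_d -> R) : continuous f -> st_periodic f -> bm w ->
  bm (fun s : measurableTypeR R => avg (fun x => f (clamp s, x) * w x)).
Proof.
move=> cf pf bw; apply: bmZ.
exact: (bm_Rint1 mI (torus d) (bmM (bm_clamp cf pf) (bm_snd bw))).
Qed.

Lemma continuous_time (y : R -> R) : continuous y -> continuous (fun z : ST => y z.1).
Proof. by move=> cy z; apply: continuous_comp; [exact: cvg_fst|exact: cy]. Qed.

(** At fixed [x] the integrand is the time derivative of f(s, x) y(s), with y the Duhamel solution;
    [f] vanishes at [T], so only the initial term remains. Fubini exchanges time and space. *)
Lemma mode_weak f (w : 'rV[R]_d -> R) mu ka c (g : R -> R) : st_test f ->
  (forall x, f (T, x) = 0) -> bm w -> continuous g ->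
  \int[mI]_s (avg (fun x => dt f (clamp s, x) * w x) * duhamel mu ka c g (clamp s) +
    avg (fun x => f (clamp s, x) * w x) *
      (ka * g (clamp s) - mu * duhamel mu ka c g (clamp s))) =
  - (avg (fun x => f (0, x) * w x) * c).
Proof.
move=> tf fT bw cg; have [sf pf] := tf; have tdt : st_test (dt f) by exact: st_test_derive.
have [sdt pdt] := tdt.
set y := duhamel mu ka c g; pose q s := ka * g s - mu * y s.
have cy : continuous y by exact: duhamel_continuous.
have cq : continuous q.
  by move=> s; apply: cvgB; apply: cvgM; [exact: cvg_cst|exact: cg|exact: cvg_cst|exact: cy].
pose P (z : ST) := dt f z * y z.1 + f z * q z.1.
have cP : continuous P.
  move=> z; apply: cvgD; apply: cvgM.
  - exact: smooth_continuous.
  - exact: continuous_time.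
  - exact: smooth_continuous.
  - exact: continuous_time.
have pP : st_periodic P by move=> t x i; rewrite /P /= pf pdt.
have bH : bm (fun z : mST => P (clamp z.1, z.2) * w z.2) by exact: bmM (bm_clamp cP pP) (bm_snd bw).
have fcs s : bm (fun x => f (clamp s, x) * w x) by exact: bmM (st_test_bm _ tf) bw.
have dcs s : bm (fun x => dt f (clamp s, x) * w x) by exact: bmM (st_test_bm _ tdt) bw.
rewrite (@eq_Rintegral _ _ _ mI setT (fun s => (2 * pi) ^- d * \int[torus d]_x (P (clamp s, x) * w x))); last first.
  move=> s _; rewrite -/(q (clamp s)) ![avg _ * _]mulrC.
  rewrite -!avgZ; [|exact: bm_itg..]; rewrite -avgD; [|exact/bm_itg/bmZ..].
  by apply: eq_avg => x; rewrite /P /=; ring.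
have bR := bm_Rint1 mI (torus d) bH.
rewrite RintZ; last exact: bm_itg bR.
rewrite (Rint_swap mI (torus d) bH) /avg.
have inner x : \int[mI]_s (P (clamp s, x) * w x) = (- c) * (f (0, x) * w x).
  have bPx : bm (fun s : measurableTypeR R => P (clamp s, x)) := bm_section2 x (bm_clamp cP pP).
  under eq_Rintegral do rewrite mulrC.
  rewrite RintZ; last exact: bm_itg bPx.
  rewrite (Rint_clamp (h := fun s => P (s, x))); last by case: bPx.
  have E := @duhamel_ibp R mu ka c g (fun s => f (s, x)) (fun s => dt f (s, x)) T (ltW T0) cg
    (is_derive_continuous (fun s => is_derive_dt s x sf))
    (is_derive_continuous (fun s => is_derive_dt s x sdt)) (fun s _ => is_derive_dt s x sf).
  by rewrite [X in _ * X]E fT; ring.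
under eq_Rintegral do rewrite inner.
have bf0 : bm (fun x => f (0, x) * w x) by exact: bmM (st_test_bm _ tf) bw.
by rewrite RintZ; [ring|exact: bm_itg bf0].
Qed.

Lemma avg_trigE (c s : G -> R) (h : 'rV[R]_d -> R) :
  gsummable (fun k => nrm2 (c k) (s k)) -> itg (torus d) h ->
  avg (fun x => trig c s x * h x) = gsum (fun k => c k * ccoef h k + s k * scoef h k).
Proof.
move=> sm ih; rewrite (avg_trigM sm ih); apply: eq_gsum => k.
have ic := itg_cos k ih; have is' := itg_sin k ih.
rewrite /ccoef /scoef -avgZ// -avgZ// -avgD; [|exact: itgZ..].
by apply: eq_avg => x; ring.
Qed.

Lemma coef_summable (c s : G -> R) (h : 'rV[R]_d -> R) :
  gsummable (fun k => nrm2 (c k) (s k)) -> itg (torus d) h ->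
  gsummable (fun k => c k * ccoef h k + s k * scoef h k).
Proof.
move=> sm ih; have := trig_avg_summable sm ih.
rewrite (_ : (fun k => avg _) = fun k => c k * ccoef h k + s k * scoef h k)//.
apply/funext => k; have ic := itg_cos k ih; have is' := itg_sin k ih.
rewrite /ccoef /scoef -avgZ// -avgZ// -avgD; [|exact: itgZ..].
by apply: eq_avg => x; ring.
Qed.

Variables (p : R -> G -> R * R) (A : G -> \bar R) (v0 : 'rV[R]_d -> R).
Hypothesis v0_wien : wien v0.
Hypothesis pA : admissible p A.
Hypothesis Ar : (\esum_(k in [set: G]) A k <= (16^-1)%:E)%E.
Hypothesis p_fixed : forall t k, p t k = picard_step v0 p t k.

Let v t := field_of p t.
Let r01 : 0 <= (16^-1 : R) < 1. Proof. by apply/andP; split; lra. Qed.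
Let B k : R := fine (nl_majorant A A k).

Let bm_nlv t : bm (nl \o v t). Proof. exact: (bm_nl_field pA r01 Ar). Qed.

Let amp_nl_summable t : gsummable (amp (nl \o v t)).
Proof.
have sB : gsummable B := nl_majorant_summable pA Ar.
apply: le_gsummable sB => k; rewrite ger0_norm ?amp_ge0//.
by apply: le_trans (ler_norm _); exact: (amp_nl_bound pA Ar).
Qed.

(** N(v) has summable coefficients, so it equals its Fourier series off a null set, which the
    average ignores. *)
Lemma nl_trig_ae t (h : 'rV[R]_d -> R) : bm h ->
  avg (fun x => nl (v t x) * h x) =
  gsum (fun k => ccoef (nl \o v t) k * ccoef h k + scoef (nl \o v t) k * scoef h k).
Proof.
move=> bh; rewrite -avg_trigE; [|exact: amp_nl_summable|exact: bm_itg].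
have bt := bm_trig (amp_nl_summable t).
rewrite /avg; congr (_ * _); apply: ae_eq_Rint.
- by case: (bmM (bm_nlv t) bh).
- by case: (bmM bt bh).
- have := Fourier_inversion (bm_itg _ (bm_nlv t)) (amp_nl_summable t).
  by apply: filterS => x e; exact: (congr1 (fun y => y * h x) e).
Qed.

Section test.
Variable f : ST -> R.
Hypothesis tf : st_test f.
Hypothesis fT : forall x, f (T, x) = 0.

Let chi := st_laplacian (st_laplacian f).
Let cs1 t k := (p t k).1.
Let cs2 t k := (p t k).2.

(* The k-th mode of the weak formulation is a total derivative in time. *)
Definition mode t k : R :=
  (ccoef (fun x => dt f (t, x)) k * cs1 t k +
   ccoef (fun x => f (t, x)) k *
    (int_norm k ^+ 4 * ccoef (nl \o v t) k - 3 * int_norm k ^+ 4 * cs1 t k)) +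
  (scoef (fun x => dt f (t, x)) k * cs2 t k +
   scoef (fun x => f (t, x)) k *
    (int_norm k ^+ 4 * scoef (nl \o v t) k - 3 * int_norm k ^+ 4 * cs2 t k)).

Let tdt : st_test (dt f). Proof. exact: st_test_derive. Qed.
Let tchi : st_test chi. Proof. exact/st_test_laplacian/st_test_laplacian. Qed.

Let inv_cube t x : (1 + v t x) ^- 3 = 1 - 3 * v t x + nl (v t x).
Proof. by rewrite /nl; ring. Qed.

Let sm t : gsummable (fun k => nrm2 (cs1 t k) (cs2 t k)).
Proof. exact: (admissible_summable pA Ar). Qed.

Lemma avg_weak_integrand t :
  avg (fun x => dt f (t, x) * v t x + chi (t, x) / (1 + v t x) ^+ 3) = gsum (mode t).
Proof.
have b1 := st_test_bm t tdt; have b2 := st_test_bm t tchi.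
have bv : bm (v t) by exact: bm_trig (sm t).
have i1 := bm_itg (torus d) b1; have i2 := bm_itg (torus d) b2.
(* The constant in (1 + v)^-3 = 1 - 3 v + N(v) drops out because a bilaplacian has mean zero. *)
have chi0 : avg (fun x => chi (t, x)) = 0.
  have [h _] := coef_bilaplacian t 0 tf; move: h.
  rewrite int_norm0 expr0n mul0r => h; rewrite -[RHS]h; apply: eq_avg => x.
  by rewrite int_dot0 cos0 mulr1.
have e1 : avg (fun x => v t x * dt f (t, x)) = gsum (fun k =>
    cs1 t k * ccoef (fun x => dt f (t, x)) k + cs2 t k * scoef (fun x => dt f (t, x)) k).
  exact: (avg_trigE (sm t) i1).
have e2 : avg (fun x => v t x * chi (t, x)) = gsum (fun k =>
    cs1 t k * ccoef (fun x => chi (t, x)) k + cs2 t k * scoef (fun x => chi (t, x)) k).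
  exact: (avg_trigE (sm t) i2).
have e3 := nl_trig_ae t b2.
have s1 := coef_summable (sm t) i1; have s2 := coef_summable (sm t) i2.
have s3 := coef_summable (amp_nl_summable t) i2.
have bvd : bm (fun x => v t x * dt f (t, x)) by exact: bmM.
have bvc : bm (fun x => (- 3) * (v t x * chi (t, x))) by exact/bmZ/bmM.
have bnc : bm (fun x => nl (v t x) * chi (t, x)) by exact: bmM (bm_nlv t) b2.
rewrite (@eq_avg _ _ _ (fun x => (v t x * dt f (t, x) + chi (t, x)) +
  ((- 3) * (v t x * chi (t, x)) + nl (v t x) * chi (t, x)))); last first.
  by move=> x; rewrite inv_cube; ring.
rewrite avgD; [|exact/bm_itg/bmD|exact/bm_itg/bmD].
rewrite avgD; [|exact: bm_itg..]; rewrite avgD; [|exact: bm_itg..].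
rewrite avgZ; last exact/bm_itg/bmM.
have E := etrans (gsumD s1 (gsummableD (gsummableZ (- 3) s2) s3))
  (congr1 (+%R _) (etrans (gsumD (gsummableZ (- 3) s2) s3)
    (congr1 (fun y => y + _) (gsumZ (- 3) s2)))).
apply: etrans (avg_combine e1 chi0 e2 e3) _; apply: etrans (esym E) _.
apply: eq_gsum => k /=; rewrite /mode /chi.
by have [-> ->] := coef_bilaplacian t k tf; ring.
Qed.

(** The factor |k|^4 is moved onto the test function, where it produces the coefficients of a
    bounded bilaplacian. The modes are thus dominated by summable majorants although no decay of
    |k|^4 v^(t, k) is available. *)
Lemma mode_bound : exists M : R, forall t k, 0 <= t <= T ->
  `|mode t k| <= M * (fine (A k) + B k).
Proof.
have [M1 H1] := st_bounded T (smooth_continuous tdt.1) tdt.2.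
have [M2 H2] := st_bounded T (smooth_continuous tchi.1) tchi.2.
exists (2 * M1 + 6 * M2) => t k t0T.
have M10 : 0 <= M1 := le_trans (normr_ge0 _) (H1 t 0 t0T).
have M20 : 0 <= M2 := le_trans (normr_ge0 _) (H2 t 0 t0T).
have coef_le (h : ST -> R) M : st_test h -> (forall x, `|h (t, x)| <= M) ->
    nrm2 (ccoef (fun x => h (t, x)) k) (scoef (fun x => h (t, x)) k) <= 2 * M.
  move=> th hM; have bh := st_test_bm t th.
  apply: le_trans (amp_le_L1 k (bm_itg _ bh)) _; rewrite -[leLHS]mulr_natl ler_pM2l//.
  apply: le_trans (ler_norm _) _; apply: norm_avg_le.
    by apply: measurableT_comp => //; case: bh.
  by move=> x; rewrite normr_id.
have c1 := coef_le (dt f) M1 tdt (fun x => H1 t x t0T).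
have c2 := coef_le chi M2 tchi (fun x => H2 t x t0T).
have a1 : nrm2 (cs1 t k) (cs2 t k) <= fine (A k) := admissible_bound pA Ar t k.
have b1 : nrm2 (ccoef (nl \o v t) k) (scoef (nl \o v t) k) <= B k := amp_nl_bound pA Ar k t.
have n1 := norm_CS c1 a1; have n2 := norm_CS c2 a1; have n3 := norm_CS c2 b1.
have A0 := le_trans (nrm2_ge0 _ _) a1; have B0 := le_trans (nrm2_ge0 _ _) b1.
move: n1 n2 n3; rewrite /mode; have [-> ->] := coef_bilaplacian t k tf.
exact: mode_arith.
Qed.

Lemma bm_time (y : R -> R) : continuous y -> bm (fun s : measurableTypeR R => y (clamp s)).
Proof.
move=> cy; have [M HM] := st_bounded T (continuous_time cy) (st_periodic_time y).
split; last by exists M => s; exact: (HM (clamp s) 0 (clamp_itv s)).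
apply: continuous_measurable => s; apply: continuous_comp; last exact: cy.
exact: clamp_continuous.
Qed.

Lemma bm_mode_part (h1 h2 : ST -> R) (w : 'rV[R]_d -> R) (y1 y2 : R -> R) :
  st_test h1 -> st_test h2 -> bm w -> continuous y1 -> continuous y2 ->
  bm (fun s : measurableTypeR R => avg (fun x => h1 (clamp s, x) * w x) * y1 (clamp s) +
    avg (fun x => h2 (clamp s, x) * w x) * y2 (clamp s)).
Proof.
move=> [sh1 ph1] [sh2 ph2] bw cy1 cy2; apply: bmD; apply: bmM; try exact: bm_time.
  exact: (bm_avg_clamp (smooth_continuous sh1) ph1 bw).
exact: (bm_avg_clamp (smooth_continuous sh2) ph2 bw).
Qed.

Let q1 k s := int_norm k ^+ 4 * ccoef (nl \o v s) k - 3 * int_norm k ^+ 4 * cs1 s k.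
Let q2 k s := int_norm k ^+ 4 * scoef (nl \o v s) k - 3 * int_norm k ^+ 4 * cs2 s k.

Let cq1 k : continuous (q1 k).
Proof.
have [c1 _] := nl_coef_continuous pA r01 Ar k; have [c2 _ _ _] := pA.
by move=> s; apply: cvgB; apply: cvgM; [exact: cvg_cst|exact: c1|exact: cvg_cst|exact: c2].
Qed.

Let cq2 k : continuous (q2 k).
Proof.
have [_ c1] := nl_coef_continuous pA r01 Ar k; have [_ c2 _ _] := pA.
by move=> s; apply: cvgB; apply: cvgM; [exact: cvg_cst|exact: c1|exact: cvg_cst|exact: c2].
Qed.

Let bm_part1 k : bm (fun s : measurableTypeR R =>
  ccoef (fun x => dt f (clamp s, x)) k * cs1 (clamp s) k +
  ccoef (fun x => f (clamp s, x)) k * q1 k (clamp s)).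
Proof.
by have [c1 _ _ _] := pA; exact: (bm_mode_part tdt tf (bm_cos k) (c1 k) (@cq1 k)).
Qed.

Let bm_part2 k : bm (fun s : measurableTypeR R =>
  scoef (fun x => dt f (clamp s, x)) k * cs2 (clamp s) k +
  scoef (fun x => f (clamp s, x)) k * q2 k (clamp s)).
Proof.
by have [_ c1 _ _] := pA; exact: (bm_mode_part tdt tf (bm_sin k) (c1 k) (@cq2 k)).
Qed.

Lemma Rint_mode k : \int[mI]_s mode (clamp s) k =
  - (ccoef v0 k * ccoef (fun x => f (0, x)) k + scoef v0 k * scoef (fun x => f (0, x)) k).
Proof.
have [c1 c2] := nl_coef_continuous pA r01 Ar k.
have y1 s : cs1 s k = duhamel (3 * int_norm k ^+ 4) (int_norm k ^+ 4) (ccoef v0 k)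
    (fun s => ccoef (nl \o v s) k) s by exact: (congr1 fst (p_fixed s k)).
have y2 s : cs2 s k = duhamel (3 * int_norm k ^+ 4) (int_norm k ^+ 4) (scoef v0 k)
    (fun s => scoef (nl \o v s) k) s by exact: (congr1 snd (p_fixed s k)).
have E := RintD (bm_itg mI (@bm_part1 k)) (bm_itg mI (@bm_part2 k)).
apply: etrans E _; rewrite opprD; congr (_ + _).
  rewrite mulrC; apply: etrans (mode_weak (3 * int_norm k ^+ 4) (int_norm k ^+ 4) (ccoef v0 k) tf fT (bm_cos k) c1).
  by apply: eq_Rintegral => s _; rewrite /q1 y1.
rewrite mulrC; apply: etrans (mode_weak (3 * int_norm k ^+ 4) (int_norm k ^+ 4) (scoef v0 k) tf fT (bm_sin k) c2).
by apply: eq_Rintegral => s _; rewrite /q2 y2.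
Qed.

(** [mode_bound] allows integrating the series in time term by term; the remaining initial
    contributions add up to the average of f(0, x) v0 by expanding [v0] in its Fourier series. *)
Lemma weak_identity :
  \int[leb]_(t in `[0, T]) avg (fun x => dt f (t, x) * v t x + chi (t, x) / (1 + v t x) ^+ 3) =
  - avg (fun x => f (0, x) * v0 x).
Proof.
rewrite (@eq_Rintegral _ _ _ leb `[0, T] (fun t => gsum (mode t))); last first.
  by move=> t _; exact: avg_weak_integrand.
have [M HM] := mode_bound.
have sM : gsummable (fun k => M * (fine (A k) + B k)).
  apply: gsummableZ; apply: gsummableD; last exact: (nl_majorant_summable pA Ar).
  exact: (admissible_gsummable pA Ar).
have mm k : measurable_fun [set: measurableTypeR R] (fun s : measurableTypeR R => mode (clamp s) k).
  by case: (bmD (@bm_part1 k) (@bm_part2 k)).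
have sm' s : gsummable (fun k => mode (clamp s) k).
  apply: le_gsummable sM => k; apply: le_trans (ler_norm _).
  exact: HM (clamp_itv s).
rewrite -Rint_clamp; last first.
  exact: (@measurable_gsum _ _ _ _ (fun k s => mode (clamp s) k) mm sm').
rewrite (@eq_Rintegral _ _ _ mI setT (fun s => gsum (fun k => mode (clamp s) k) * 1)); last first.
  by move=> s _; rewrite mulr1.
rewrite (@Rint_gsum R _ _ _ mI (fun k s => mode (clamp s) k) _ (cst 1) mm (bm_itg _ (bm_cst _ 1)) sM); last first.
  by move=> k s; exact: HM (clamp_itv s).
have [s0 v0E] := v0_wien.
have i0 := bm_itg (torus d) (st_test_bm 0 tf).
have e0 : avg (fun x => v0 x * f (0, x)) = gsum (fun k =>
    ccoef v0 k * ccoef (fun x => f (0, x)) k + scoef v0 k * scoef (fun x => f (0, x)) k).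
  by rewrite -(avg_trigE s0 i0) -v0E.
rewrite (@eq_avg _ _ (fun x => f (0, x) * v0 x) (fun x => v0 x * f (0, x))) => [|x]; last exact: mulrC.
apply: etrans _ (esym (congr1 -%R e0)); rewrite -gsumN; last exact: (coef_summable s0 i0).
apply: eq_gsum => k; rewrite -Rint_mode.
by apply: eq_Rintegral => s _; rewrite mulr1.
Qed.

End test.

End weak_form.

(** * Initial datum and regularity of the solution *)

Section initial_datum.
Context {R : realType} {d : nat}.
Local Notation itg := (@itg _ _ R (torus d)).

(** The total inverse, 0 at 0, is discontinuous there but is the pointwise limit of the continuous
    functions y / (y^2 + 1/n), which also vanish at 0. *)
Lemma measurable_inv : measurable_fun [set: measurableTypeR R] (fun y : R => y^-1).
Proof.
pose f n (y : R) := y / (y ^+ 2 + n.+1%:R^-1).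
apply: (@measurable_fun_cvg _ _ _ _ f).
  move=> n; apply: continuous_measurable => y.
  have n0 : 0 < n.+1%:R^-1 :> R by rewrite invr_gt0.
  apply: cvgM; first exact: cvg_id.
  apply: cvgV; first by rewrite gt_eqF// ltr_wpDl// sqr_ge0.
  by apply: cvgD; [exact: exprn_continuous|exact: cvg_cst].
move=> y _; have [->|y0] := eqVneq y 0.
  rewrite invr0 (_ : f^~ 0 = fun=> 0); first exact: cvg_cst.
  by apply/funext => n; rewrite /f mul0r.
have -> : y^-1 = y * (y ^+ 2 + 0)^-1 by rewrite addr0; field.
apply: cvgM; first exact: cvg_cst.
apply: cvgV; first by rewrite addr0 expf_neq0.
by apply: cvgD; [exact: cvg_cst|exact: cvg_harmonic].
Qed.

Variable u0 : 'rV[R]_d -> R.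
Hypothesis u0_ge0 : {ae torus d, forall x, 0 <= u0 x}.
Hypothesis u0_meas : measurable_fun setT u0.
Hypothesis u0_mean :
  (((2 * pi) ^- d)%:E * (\int[torus d]_x ((u0 x)%:E)^-1) = 1)%E.

Let inv_meas : measurable_fun setT (fun x => (u0 x)^-1).
Proof. exact: (measurableT_comp measurable_inv u0_meas). Qed.

Let h x : \bar R := (((u0 x)%:E)^-1)%E.

Let h_meas : measurable_fun setT h.
Proof.
rewrite (_ : h = fun x => if u0 x == 0 then +oo%E else ((u0 x)^-1)%:E).
  apply: measurable_fun_ifT => //; last exact/measurable_EFinP.
  by apply: measurable_fun_eqr.
by apply/funext => x; rewrite /h inver.
Qed.

Let h_int : (\int[torus d]_x h x = ((2 * pi) ^+ d)%:E)%E.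
Proof.
have V0 := @volume_gt0 R d; move: u0_mean; rewrite -/h => e.
have e2 := congr1 (fun y => (((2 * pi) ^+ d)%:E * y)%E) e.
by move: e2; rewrite muleA -EFinM mulfV ?gt_eqF// mul1e mule1.
Qed.

(** The mean is taken in the extended reals, where 1/0 is +oo: its finiteness excludes zeros of [u0]
    on a set of positive measure, after which the real inverse agrees almost everywhere with the
    extended one. *)
Lemma inv_integrable : [/\ itg (fun x => (u0 x)^-1), avg (fun x => (u0 x)^-1) = 1 &
  {ae torus d, forall x, 0 < u0 x}].
Proof.
have h0 : {ae torus d, forall x, 0 <= h x}%E.
  apply: filterS u0_ge0 => x ux; rewrite /h inver; case: ifP => // _.
  by rewrite lee_fin invr_ge0.
have ih : (torus d).-integrable setT h.
  apply/integrableP; split=> //.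
  have E : (\int[torus d]_x `|h x| = \int[torus d]_x h x)%E.
    apply: ae_eq_integral => //; first exact: measurableT_comp.
    by apply: filterS h0 => x hx _; rewrite gee0_abs.
  by rewrite E h_int ltry.
have fin : {ae torus d, forall x, u0 x != 0}.
  have := integrable_ae measurableT ih; apply: filterS => x /(_ I).
  by rewrite /h inver; case: ifP.
have hE : ae_eq (torus d) setT h (fun x => ((u0 x)^-1)%:E).
  by apply: filterS fin => x /negbTE ux _; rewrite /h inver ux.
have iu : itg (fun x => (u0 x)^-1).
  have /integrableP[_ lh] := ih; apply/integrableP; split; first exact/measurable_EFinP.
  apply: le_lt_trans lh; rewrite le_eqVlt; apply/orP; left; apply/eqP.
  apply: ae_eq_integral => //; last by apply: filterS hE => x e xT; rewrite e.
    by apply: measurableT_comp => //; exact/measurable_EFinP.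
  exact: measurableT_comp.
split=> //.
- have V0 := @volume_gt0 R d; rewrite /avg /Rintegral.
  rewrite -(ae_eq_integral _ _ _ _ _ hE)//; last exact/measurable_EFinP.
  by rewrite h_int /= mulVf// gt_eqF.
- by apply: filterS2 u0_ge0 fin => x u1 u2; rewrite lt_def u2.
Qed.

Let w := inv_sub1 u0.

Lemma inv_sub1_itg : itg w.
Proof. by have [iu _ _] := inv_integrable; exact: (itgB iu (bm_itg _ (bm_cst _ 1))). Qed.

Lemma inv_sub1_avg : avg w = 0.
Proof.
have [iu au _] := inv_integrable.
by rewrite /w /inv_sub1 avgB ?au ?avg_cst ?subrr//; exact: bm_itg (bm_cst _ 1).
Qed.

Lemma wiener_norm0 (f : 'rV[R]_d -> R) :
  wiener_norm 0 f = (\esum_(k in [set: 'rV[int]_d]) (amp f k)%:E)%E.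
Proof.
by apply: eq_esum => k _; rewrite powRr0 mul1r normc_fourier_coef.
Qed.

Hypothesis w_small : (wiener_norm 0 w < 1)%E.

Lemma amp_inv_summable : gsummable (amp w).
Proof.
rewrite /gsummable gnormE; last by move=> k; exact: amp_ge0.
by apply: lt_trans (ltry 1); rewrite -wiener_norm0.
Qed.

Lemma wiener_norm_inv : wiener_norm 0 w = (gsum (amp w))%:E.
Proof. by rewrite wiener_norm0 gsum_esum//; [exact: amp_inv_summable|move=> k; exact: amp_ge0]. Qed.

(** The everywhere bounded representative of 1/u0 - 1 from which the evolution starts, [u0] being
    given up to null sets. *)
Definition inv_sub1_series := trig (ccoef w) (scoef w).

Lemma inv_sub1_series_wien : wien inv_sub1_series.
Proof.
apply: (wien_trig amp_inv_summable); first exact: ccoefN.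
by move=> k; rewrite scoefN//; exact: inv_sub1_itg.
Qed.

Lemma ccoef_series k : ccoef inv_sub1_series k = ccoef w k.
Proof. exact: (ccoef_trig amp_inv_summable (ccoefN w)). Qed.

Lemma scoef_series k : scoef inv_sub1_series k = scoef w k.
Proof.
apply: (scoef_trig amp_inv_summable) => l; rewrite scoefN//; exact: inv_sub1_itg.
Qed.

Lemma amp_series k : amp inv_sub1_series k = amp w k.
Proof. by rewrite /amp ccoef_series scoef_series. Qed.

Lemma amp_series0 : amp inv_sub1_series 0 = 0.
Proof.
rewrite amp_series /amp (_ : ccoef w 0 = 0); last first.
  rewrite -[RHS]inv_sub1_avg; apply: eq_avg => x; rewrite int_dot0 cos0 mulr1//.
rewrite (_ : scoef w 0 = 0) ?nrm2_00// /scoef.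
by under eq_avg do rewrite int_dot0 sin0 mulr0; rewrite avg_cst.
Qed.

Lemma inv_sub1_series_ae : {ae torus d, forall x, w x = inv_sub1_series x}.
Proof. exact: Fourier_inversion inv_sub1_itg amp_inv_summable. Qed.

Lemma u0_gt_half : {ae torus d, forall x, 1 / 2 < u0 x}.
Proof.
have z1 : gsum (amp w) < 1 by move: w_small; rewrite wiener_norm_inv lte_fin.
have [_ _ up] := inv_integrable.
apply: filterS2 up inv_sub1_series_ae => x u0x wx.
have : `|w x| < 1.
  by rewrite wx; apply: le_lt_trans z1; exact: (norm_trig_le amp_inv_summable).
rewrite /w /inv_sub1 ltr_norml => /andP[_]; rewrite ltrBlDr => h1.
have : (u0 x)^-1 < 2 by move: h1; lra.
by rewrite invf_plt ?posrE// div1r.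
Qed.

End initial_datum.

Lemma addl_subK {R : zmodType} (a x y : R) : (a + x) - (a + y) = x - y.
Proof. by rewrite opprD addrACA subrr add0r. Qed.

(** * Regularity and asymptotics of the constructed solution *)

Section solution.
Context {R : realType} {d : nat}.
Local Notation G := 'rV[int]_d.
Local Notation leb := (@lebesgue_measure R).
Local Notation mST := (measurableTypeR R * 'rV[R]_d)%type.
Implicit Types (f : 'rV[R]_d -> R) (t T : R).

Lemma torus_gt0 : (0 < torus d [set: 'rV[R]_d])%E.
Proof. by rewrite torusT lte_fin volume_gt0. Qed.

Lemma Linfty_norm_le f M : (forall x, `|f x| <= M) -> (Linfty_norm f <= M%:E)%E.
Proof.
move=> fM; rewrite /Linfty_norm unlock torus_gt0.
by apply/ess_supP; apply: nearW => x; rewrite /= lee_fin.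
Qed.

Lemma Linfty_norm_ge f c : (forall x, c <= `|f x|) -> (c%:E <= Linfty_norm f)%E.
Proof.
move=> fc; rewrite /Linfty_norm unlock torus_gt0.
by apply: ess_sup_gee; [exact: torus_gt0|apply: nearW => x; rewrite /= lee_fin].
Qed.

Lemma L2_norm_le f M : measurable_fun setT f -> (forall x, `|f x| <= M) ->
  (Lnorm (torus d) 2%:E (EFin \o f) <= (M * Num.sqrt ((2 * pi) ^+ d))%:E)%E.
Proof.
move=> mf fM; have M0 : 0 <= M := le_trans (normr_ge0 _) (fM 0).
have V0 := ltW (@volume_gt0 R d).
have -> : M * Num.sqrt ((2 * pi) ^+ d) = (M ^+ 2 * (2 * pi) ^+ d) `^ 2^-1.
  by rewrite powR12_sqrt ?mulr_ge0 ?sqr_ge0// sqrtrM ?sqr_ge0// sqrtr_sqr ger0_norm.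
rewrite unlock -poweR_EFin.
have E : (\int[torus d]_x (`|(EFin \o f) x| `^ 2) = \int[torus d]_x (f x ^+ 2)%:E)%E.
  apply: eq_integral => x _; rewrite /= (powR_mulrn 2)//.
  by rewrite real_normK// num_real.
rewrite E; apply: gt0_ler_poweR; rewrite ?invr_ge0//.
- by rewrite in_itv/= leey andbT; apply: integral_ge0 => x _; rewrite lee_fin sqr_ge0.
- by rewrite in_itv/= leey andbT lee_fin mulr_ge0// sqr_ge0.
apply: (@le_trans _ _ (\int[torus d]_x (cst (M ^+ 2)%:E x))%E).
  apply: ge0_le_integral => //.
  - by move=> x _; rewrite lee_fin sqr_ge0.
  - by apply/measurable_EFinP; exact: measurable_funX.
  - move=> x _; rewrite /= lee_fin -[f x ^+ 2]real_normK ?num_real//.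
    by rewrite lerXn2r ?nnegrE.
rewrite integral_cst//.
rewrite [leRHS]EFinM le_eqVlt; apply/orP; left; apply/eqP.
congr (_ * _)%E; exact: torusT.
Qed.

Variables (p : R -> G -> R * R) (A : G -> \bar R) (v0 : 'rV[R]_d -> R).
Hypothesis v0_wien : wien v0.
Hypothesis v0_mean : amp v0 0 = 0.
Hypothesis pA : admissible p A.
Hypothesis Ar : (\esum_(k in [set: G]) A k <= (16^-1)%:E)%E.
Hypothesis p_fixed : forall t k, p t k = picard_step v0 p t k.
Hypothesis z_small : gsum (amp v0) < 32^-1.
Hypothesis delta_gt0 : 0 < delta (gsum (amp v0)).

Definition density t x : R := (1 + field_of p t x)^-1.

Let v t := field_of p t.

Let v_le t x : `|v t x| <= 16^-1. Proof. exact: (norm_field_le pA Ar). Qed.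

Let v1_gt0 t x : 0 < 1 + v t x.
Proof. by have := v_le t x; rewrite ler_norml => /andP[]; lra. Qed.

Lemma inv_densityE : (fun t x => (density t x)^-1) = (fun t x => 1 + v t x).
Proof. by apply/funext => t; apply/funext => x; rewrite /density invrK. Qed.

Lemma inv_sub1_density t : inv_sub1 (density t) = v t.
Proof. by apply/funext => x; rewrite /inv_sub1 /density invrK addrC addKr. Qed.

Lemma measurable_solution : measurable_fun [set: mST] (fun z => v z.1 z.2).
Proof.
have [c1 c2 _ _] := pA.
apply: (@measurable_gsum _ _ _ _ (fun k (z : mST) => (p z.1 k).1 * cos (int_dot k z.2) +
  (p z.1 k).2 * sin (int_dot k z.2))).
  move=> k; apply: measurable_funD; apply: measurable_funM.
  - exact: (measurableT_comp (continuous_measurable (c1 k)) measurable_fst).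
  - exact: (measurableT_comp (bm_cos k).1 measurable_snd).
  - exact: (measurableT_comp (continuous_measurable (c2 k)) measurable_fst).
  - exact: (measurableT_comp (bm_sin k).1 measurable_snd).
by move=> z; exact: (trig_summable (admissible_summable pA Ar z.1)).
Qed.

Lemma solution_upto T : measurable_upto T v.
Proof. exact: measurable_funTS measurable_solution. Qed.

Lemma solution_decay t x : 0 <= t ->
  `|v t x| <= gsum (amp v0) * expR (- (delta (gsum (amp v0)) * t)).
Proof.
move=> t0; apply: le_trans (wien_norm_le x (admissible_wien pA Ar t)) _.
exact: (norm_decay v0_wien v0_mean pA Ar p_fixed z_small delta_gt0 t0).
Qed.

Lemma solution_Linfty t : 0 <= t -> (Linfty_norm (inv_sub1 (density t)) <=
  (gsum (amp v0) * expR (- (delta (gsum (amp v0)) * t)))%:E)%E.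
Proof.
by move=> t0; rewrite inv_sub1_density; apply: Linfty_norm_le => x; exact: solution_decay.
Qed.

Section weak.
Variables (w0 : 'rV[R]_d -> R) (T : R).
Hypothesis T0 : 0 < T.
Hypothesis w0_itg : itg (torus d) w0.
Hypothesis w0_ae : {ae torus d, forall x, w0 x = v0 x}.

Lemma weak_integrandE (phi : R * 'rV[R]_d -> R) t x :
  weak_integrand phi v t x =
  dt phi (t, x) * v t x + st_laplacian (st_laplacian phi) (t, x) / (1 + v t x) ^+ 3.
Proof. by rewrite /weak_integrand derive1_dt bilaplacian_st. Qed.

Let test (phi : R * 'rV[R]_d -> R) : test_function T phi -> st_test phi /\ forall x, phi (T, x) = 0.
Proof.
move=> [sphi pphi [T' T'T zphi]]; split; first by split=> // t x i; exact: pphi.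
by move=> x; apply: zphi; exact: ltW.
Qed.

Lemma bm_weak_integrand phi : test_function T phi -> bm (fun z : mST =>
  dt phi (clamp T z.1, z.2) * v z.1 z.2 +
  st_laplacian (st_laplacian phi) (clamp T z.1, z.2) / (1 + v z.1 z.2) ^+ 3).
Proof.
move=> /test[tphi _]; have [sd pd] : st_test (dt phi) by exact: st_test_derive.
have [sc pc] := st_test_laplacian (st_test_laplacian tphi).
have bv : bm (fun z : mST => v z.1 z.2).
  by split; [exact: measurable_solution|exists 16^-1 => z; exact: v_le].
have bd := bm_clamp T0 (smooth_continuous sd) pd.
have bc := bm_clamp T0 (smooth_continuous sc) pc.
apply: bmD; first exact: bmM.
apply: bmM => //; split.
  apply: (measurableT_comp measurable_inv); apply: measurable_funX.
  by apply: measurable_funD => //; exact: measurable_solution.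
exists ((1 - 16^-1) ^- 3) => z; have := v_le z.1 z.2; rewrite ler_norml => /andP[h1 h2].
have h3 : 1 - 16^-1 <= 1 + v z.1 z.2 by move: h1; lra.
have h4 : 0 < 1 - 16^-1 :> R by lra.
rewrite ger0_norm ?invr_ge0 ?exprn_ge0 ?(ltW (v1_gt0 _ _))//.
by rewrite lef_pV2 ?posrE ?exprn_gt0// lerXn2r ?nnegrE ?(ltW h4) ?(ltW (v1_gt0 _ _)).
Qed.

Lemma weak_solution_density : weak_solution T w0 (fun t => inv_sub1 (density t)).
Proof.
have -> : (fun t => inv_sub1 (density t)) = v by apply/funext => t; exact: inv_sub1_density.
split.
- split; first exact: solution_upto.
  by exists 16^-1; apply: aeW => t _; apply: Linfty_norm_le => x; exact: v_le.
- by apply: aeW => z _; rewrite gt_eqF.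
- move=> phi /test[tphi _].
  by have := itgM w0_itg (st_test_bm 0 tphi); apply: eq_integrable => // x _ /=; rewrite mulrC.
(* On [0, T] clamping the time changes nothing, and the clamped integrand is bounded everywhere. *)
- move=> phi tphi; have [mH [M HM]] := bm_weak_integrand tphi.
  apply: (@eq_integrable _ _ _ _ _ _ (EFin \o (fun z : mST =>
    dt phi (clamp T z.1, z.2) * v z.1 z.2 +
    st_laplacian (st_laplacian phi) (clamp T z.1, z.2) / (1 + v z.1 z.2) ^+ 3))).
  + by apply: measurableX.
  + move=> z; rewrite inE => -[/= z1 _]; by rewrite weak_integrandE clampE.
  + apply: measurable_bounded_integrable.
    * by apply: measurableX.
    * apply: (@le_lt_trans _ _ (leb `[0%R, T] * torus d setT)%E).
        by rewrite le_eqVlt; apply/orP; left; apply/eqP; exact: product_measure1E.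
      by rewrite lebesgue_measure_itv/= torusT lte_fin T0 oppr0 adde0 -EFinM ltry.
    * exact: measurable_funTS.
    * exists M; split; first exact: num_real.
      by move=> y My z _ /=; apply: le_trans (ltW My); exact: HM.
- move=> phi tphi; have [st phiT] := test tphi.
  have H := weak_identity T0 v0_wien pA Ar p_fixed st phiT.
  have V0 := @volume_gt0 R d.
  (* The datum enters through an integral, which ignores the null set where it differs from [v0]. *)
  have e0 : \int[torus d]_x (phi (0, x) * w0 x) = (2 * pi) ^+ d * avg (fun x => phi (0, x) * v0 x).
    rewrite /avg mulrA mulfV ?gt_eqF// mul1r.
    have b0 := st_test_bm 0 st; have bv0 := wien_bm v0_wien.
    apply: ae_eq_Rint.
    - by apply: measurable_funM; [case: b0|exact: itg_meas w0_itg].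
    - by case: (bmM b0 bv0).
    - by apply: filterS w0_ae => x ->.
  have e1 : \int[leb]_(t in `[0, T]) \int[torus d]_x weak_integrand phi v t x =
      (2 * pi) ^+ d * \int[leb]_(t in `[0, T]) avg (fun x => dt phi (t, x) * v t x +
        st_laplacian (st_laplacian phi) (t, x) / (1 + v t x) ^+ 3).
    have c0 (t : R) : \int[torus d]_x weak_integrand phi v t x = (2 * pi) ^+ d *
        avg (fun x => dt phi (t, x) * v t x + st_laplacian (st_laplacian phi) (t, x) / (1 + v t x) ^+ 3).
      rewrite /avg mulrA mulfV ?gt_eqF// mul1r.
      by apply: eq_Rintegral => x _; exact: weak_integrandE.
    under eq_Rintegral do rewrite c0.
    pose g t := avg (fun x => dt phi (clamp T t, x) * v t x +
      st_laplacian (st_laplacian phi) (clamp T t, x) / (1 + v t x) ^+ 3).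
    have bg : bm (g : measurableTypeR R -> R).
      exact/bmZ/(bm_Rint1 (interval_measure 0 T) (torus d) (bm_weak_integrand tphi)).
    have gE t : t \in `[0, T]%classic -> avg (fun x => dt phi (t, x) * v t x +
        st_laplacian (st_laplacian phi) (t, x) / (1 + v t x) ^+ 3) = g t.
      by rewrite inE/= in_itv/= => tT; rewrite /g clampE.
    rewrite (@eq_Rintegral _ _ _ leb `[0, T] (fun t => (2 * pi) ^+ d * g t)); last first.
      by move=> t tT; rewrite gE.
    rewrite [X in _ = _ * X](@eq_Rintegral _ _ _ leb `[0, T] g); last by move=> t tT; exact: gE.
    rewrite -!Rint_interval; [|by case: bg|by case: (bmZ ((2 * pi) ^+ d) bg)].
    by rewrite RintZ//; exact: bm_itg bg.
  by rewrite e0 e1 H; ring.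
Qed.

End weak.

Lemma Lfun2_solution t : (fun x => 1 + v t x) \in Lfun (torus d) 2%:E.
Proof.
have bv : bm (fun x => 1 + v t x) by exact: (bmD (bm_cst _ 1) (wien_bm (admissible_wien pA Ar t))).
rewrite inE; apply/andP; split; rewrite inE/=; first by case: bv.
rewrite /finite_norm; apply: le_lt_trans (L2_norm_le (M := 1 + 16^-1) _ _) (ltry _).
  by case: bv.
by move=> x; apply: le_trans (ler_normD _ _) _; rewrite normr1 lerD2l.
Qed.

(** The sup norm of a difference is at most the sum of the moduli of the differences of
    coefficients, which tends to 0 by Tannery's theorem; the torus has finite volume. *)
Lemma solution_C_L2 T : C_L2 T (fun t x => (density t x)^-1).
Proof.
rewrite inv_densityE => s _; split; first exact: Lfun2_solution.
have -> : (fun t => Lnorm (torus d) 2%:E (EFin \o ((fun x => 1 + v t x) \- (fun x => 1 + v s x)))) =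
    (fun t => Lnorm (torus d) 2%:E (EFin \o (v t \- v s))).
  apply/funext => t; congr (Lnorm _ _ _).
  by apply/funext => x; exact: (congr1 EFin (addl_subK _ _ _)).
suff key : (fun t => Lnorm (torus d) 2%:E (EFin \o (v t \- v s))) @ s --> 0%E.
  exact: cvg_within_filter key.
pose D t := gsum (fun k => nrm2 ((p t k).1 - (p s k).1) ((p t k).2 - (p s k).2)).
have Db t k : nrm2 ((p t k).1 - (p s k).1) ((p t k).2 - (p s k).2) <= 2 * fine (A k).
  apply: le_trans (nrm2D _ _ _ _) _; rewrite nrm2N mulr_natl mulr2n.
  by apply: lerD; exact: (admissible_bound pA Ar).
have sA2 : gsummable (fun k => 2 * fine (A k)) := gsummableZ 2 (admissible_gsummable pA Ar).
have Dc : D t @[t --> s] --> (0 : R).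
  have -> : (0 : R) = gsum (fun _ : G => 0 * 0 : R).
    rewrite gsumZ ?mul0r//.
    by apply: le_gsummable (gsummable_single (0 : G) (0 : R)) => l; rewrite normr0.
  apply: (@gsum_cvg R G R (nbhs s) _
    (fun k t => nrm2 ((p t k).1 - (p s k).1) ((p t k).2 - (p s k).2)) _ _ sA2).
    by move=> k t; rewrite ger0_norm ?nrm2_ge0.
  move=> k.
  have -> : (0 : R) * 0 = nrm2 ((p s k).1 - (p s k).1) ((p s k).2 - (p s k).2).
    by rewrite !subrr nrm2_00 mul0r.
  have [c1 c2 _ _] := pA.
  by apply: nrm2_cvg; apply: cvgB; [exact: c1|exact: cvg_cst|exact: c2|exact: cvg_cst].
have vD t x : `|(v t \- v s) x| <= D t.
  have wd := wienB (admissible_wien pA Ar t) (admissible_wien pA Ar s).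
  apply: le_trans (wien_norm_le x wd) _; rewrite le_eqVlt; apply/orP; left; apply/eqP.
  apply: eq_gsum => k; apply: EFin_inj.
  exact: (eamp_subE (wien_itg (admissible_wien pA Ar t)) (wien_itg (admissible_wien pA Ar s))
    (ccoef_field pA Ar t k) (scoef_field pA Ar t k) (ccoef_field pA Ar s k) (scoef_field pA Ar s k)).
apply: (@squeeze_cvge _ (nbhs s) _ R (fun=> 0%:E) _
  (fun t => (D t * Num.sqrt ((2 * pi) ^+ d))%:E)).
- apply: nearW => t; rewrite Lnorm_ge0 L2_norm_le//.
  by case: (wien_bm (wienB (admissible_wien pA Ar t) (admissible_wien pA Ar s))).
- exact: cvg_cst.
- apply: cvg_EFin; first exact: nearW.
  rewrite -[X in _ --> X](mul0r (Num.sqrt ((2 * pi) ^+ d))) /comp /=.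
  by apply: cvgM; [exact: Dc|exact: cvg_cst].
Qed.

(** It makes the square of a coefficient at most the coefficient itself, so the squared H^2 norm is
    at most |v|_4. *)
Lemma amp_le1 t k : amp (v t) k <= 1.
Proof.
apply: le_trans (amp_bound pA Ar k t) _; rewrite -lee_fin -(admissible_fine pA Ar).
apply: (@le_trans _ _ (16^-1)%:E); last by rewrite lee_fin; lra.
by apply: le_trans Ar; apply: esum_ge; exists [set k]; [split|rewrite fsbig_set1].
Qed.

(** Adding 1 changes only the mode 0, which the weight |k|^4 removes. *)
Lemma sobolev_solution t : sobolev_norm2 2 (fun x => 1 + v t x) =
  (\esum_(k in [set: G]) (int_norm k ^+ 4 * amp (v t) k ^+ 2)%:E)%E.
Proof.
apply: eq_esum => k _; rewrite normc_fourier_coef.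
rewrite (_ : 2 * 2 = 4%:R) -?natrM// powR_mulrn ?int_norm_ge0//.
have [->|k0] := eqVneq k 0; first by rewrite int_norm0 expr0n !mul0r.
have iv := wien_itg (admissible_wien pA Ar t); have i1 := bm_itg (torus d) (bm_cst _ (1 : R)).
have c1 : ccoef (fun _ : 'rV[R]_d => 1 : R) k = 0.
  by rewrite /ccoef; under eq_avg do rewrite mul1r; rewrite (avg_trig k).1 (negbTE k0).
have s1 : scoef (fun _ : 'rV[R]_d => 1 : R) k = 0.
  by rewrite /scoef; under eq_avg do rewrite mul1r; rewrite (avg_trig k).2.
have e1 := ccoefD k i1 iv; have e2 := scoefD k i1 iv.
have -> : amp (fun x => 1 + v t x) k = amp (v t) k.
  by rewrite /amp (etrans e1 (congr1 (fun y => y + _) c1)) (etrans e2 (congr1 (fun y => y + _) s1)) !add0r.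
by [].
Qed.

Let term k (t : R) : \bar R := (int_norm k ^+ 4 * amp (v t) k ^+ 2)%:E.

Let term_ge0 k t : (0 <= term k t)%E.
Proof. by rewrite lee_fin mulr_ge0 ?exprn_ge0 ?int_norm_ge0 ?amp_ge0. Qed.

Let term_meas k : measurable_fun [set: measurableTypeR R] (term k).
Proof.
apply/measurable_EFinP/measurable_funM => //; apply: measurable_funX.
exact: (continuous_measurable (@amp_continuous _ _ _ _ pA Ar k)).
Qed.

Let sobolevE t : sobolev_norm2 2 (fun x => 1 + v t x) =
  (\sum_(n <oo) oapp (term^~ t) 0 (pickle_inv n))%E.
Proof. by rewrite sobolev_solution; exact: (esum_enum (fun k => term_ge0 k t)). Qed.

Let oterm_ge0 n t : (0 <= oapp (term^~ t) 0 (pickle_inv n))%E.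
Proof. by case: pickle_inv => //= k. Qed.

Let oterm_meas n : measurable_fun [set: measurableTypeR R]
  (fun t => oapp (term^~ t) 0%E (pickle_inv n)).
Proof. by case: pickle_inv => //= k; exact: term_meas. Qed.

Lemma solution_sobolev_measurable :
  measurable_fun [set: measurableTypeR R] (fun t => sobolev_norm2 2 (fun x => 1 + v t x)).
Proof.
under eq_fun do rewrite sobolevE.
by apply: ge0_emeasurable_sum => // n _.
Qed.

Lemma solution_sobolev_finite T : 0 < T ->
  (\int[leb]_(t in `]0%R, T[) sobolev_norm2 2 (fun x => (1 + v t x)%R) < +oo)%E.
Proof.
move=> T0; have [C HC] := dissipation_bound v0_wien v0_mean pA Ar p_fixed z_small delta_gt0.
apply: le_lt_trans (ltry C); under eq_integral do rewrite sobolevE.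
rewrite integral_nneseries//; last by move=> n; exact: measurable_funTS.
have E n : (\int[leb]_(t in `]0%R, T[) oapp (term^~ t) 0%E (pickle_inv n) =
    oapp (fun k => \int[leb]_(t in `]0%R, T[) term k t) 0%E (pickle_inv n))%E.
  by case: pickle_inv => //=; rewrite integral0.
rewrite (eq_eseriesr (fun n _ => E n)) -esum_enum; last by move=> k; exact: integral_ge0.
(* It is enough to bound finite sets of modes, which [dissipation_bound] does uniformly. *)
apply: ge_ereal_sup => _ [X [fX _]] <-; rewrite fsbig_finite//=.
have le1 k : (\int[leb]_(t in `]0%R, T[) term k t <=
    (int_norm k ^+ 4 * \int[leb]_(s in `[0%R, T]) amp (v s) k)%R%:E)%E.
  have ca := @amp_continuous _ _ _ _ pA Ar k.
  have ia := continuous_itv_integrable 0 T ca.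
  rewrite EFinM /Rintegral fineK; last exact: integrable_fin_num.
  rewrite -integralZl//.
  apply: (@le_trans _ _ (\int[leb]_(t in `[0%R, T]) term k t)%E).
    apply: ge0_subset_integral => //; first exact: measurable_funTS.
    exact: subset_itv_oo_cc.
  apply: ge0_le_integral => //.
  - exact: measurable_funTS.
  - apply: emeasurable_funM => //; apply/measurable_EFinP.
    exact: measurable_funTS (continuous_measurable ca).
  - move=> t _; rewrite /term -EFinM lee_fin ler_wpM2l ?exprn_ge0 ?int_norm_ge0//.
    by rewrite expr2 ler_piMl ?amp_ge0 ?amp_le1.
have le2 : (\sum_(k <- finmap.enum_fset (fset_set X)) (int_norm k ^+ 4 * \int[leb]_(s in `[0%R, T]) amp (v s) k)%R%:E
    <= C%:E)%E.
  by rewrite sumEFin lee_fin; apply: HC; [exact: ltW|exact: finmap.fset_uniq].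
exact: le_trans (lee_sum _ (fun k _ => le1 k)) le2.
Qed.

Lemma solution_L2_sobolev T : 0 < T -> L2_sobolev 2 T (fun t x => (density t x)^-1).
Proof.
rewrite inv_densityE => T0; have fin := solution_sobolev_finite T0; split=> //.
  by apply: measurable_funTS; apply: measurable_funD => //; exact: measurable_solution.
have ms : measurable_fun `]0, T[ (fun t => sobolev_norm2 2 (fun x => 1 + v t x)).
  exact: measurable_funTS solution_sobolev_measurable.
have s0 t : (0 <= sobolev_norm2 2 (fun x => (1 + v t x)%R))%E by rewrite sobolev_solution; apply: esum_ge0 => k _; exact: (term_ge0 k t).
have si : leb.-integrable `]0, T[ (fun t => sobolev_norm2 2 (fun x => 1 + v t x)).
  apply/integrableP; split; first exact: ms.
  apply: le_lt_trans fin; rewrite le_eqVlt; apply/orP; left; apply/eqP.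
  by apply: eq_integral => t _; exact: gee0_abs.
have := integrable_ae _ si; move=> /(_ (measurable_itv _)); apply: filterS => t h t0T.
split; first exact: Lfun2_solution.
have : sobolev_norm2 2 (fun x => 1 + v t x) \is a fin_num by apply: h; rewrite /= in_itv.
by rewrite ge0_fin_numE.
Qed.

Let z := gsum (amp v0).

Lemma density_bounds t x : 0 <= t ->
  1 - expR (- (delta z * t)) <= `|density t x| <= 1 + expR (- (delta z * t)).
Proof.
move=> t0; have h := solution_decay x t0; rewrite -/z in h.
set e := expR _ in h *; have e0 : 0 < e := expR_gt0 _.
(* The factor 1/2, available since z < 1/32, leaves room for taking the inverse of 1 + v. *)
have {}h : `|v t x| <= e / 2.
  apply: le_trans h _; rewrite mulrC ler_pM2l//; apply: ltW.
  by apply: lt_trans z_small _; rewrite ltf_pV2 ?posrE// ltr_nat.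
have v1 := v1_gt0 t x; rewrite /density ger0_norm ?invr_ge0 ?(ltW v1)//.
move: h; have := v_le t x; rewrite !ler_norml => /andP[h1 h2] /andP[h3 h4].
rewrite -[(1 + v t x)^-1]mul1r ler_pdivlMr// ler_pdivrMr//.
have m1 : 0 <= e * (16^-1 + v t x) by rewrite mulr_ge0 ?(ltW e0)//; lra.
by apply/andP; split; move: m1 h1 h2 h3 h4 e0; move: (v t x) e => y e *; nra.
Qed.

(** For large times |u| lies between 1 - eps and 1 + eps at every point. The lower half uses that
    every neighbourhood of infinity contains such a time. *)
Lemma density_limsup : limf_esup (fun t => Linfty_norm (density t)) (pinfty_nbhs R) = 1%E.
Proof.
have small (eps : R) : 0 < eps -> \forall t \near pinfty_nbhs R,
    0 <= t /\ expR (- (delta z * t)) <= eps.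
  (* Past this time delta z t exceeds 1 / eps, and e^x >= 1 + x gives the bound. *)
  move=> e0; exists (delta z * eps)^-1; split; first exact: num_real.
  move=> t ht; have de : 0 < delta z * eps by rewrite mulr_gt0.
  have t0 : 0 <= t by apply: ltW; apply: lt_trans ht; rewrite invr_gt0.
  split=> //; rewrite expRN invf_ple ?posrE ?expR_gt0//.
  apply: le_trans (expR_ge1Dx _); apply: ler_wpDl => //.
  rewrite -ler_pdivrMl//; apply: le_trans (ltW ht).
  by rewrite invfM.
have PF : ProperFilter (pinfty_nbhs R) by exact: proper_pinfty_nbhs.
rewrite limf_esupE; apply/eqP; rewrite eq_le; apply/andP; split.
  apply/lee_addgt0Pr => eps e0.
  apply: le_trans.
    by apply: ereal_inf_lbound; eexists; first exact: (small eps e0).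
  apply: ge_ereal_sup => _ [t [t0 te] <-].
  apply: le_trans (Linfty_norm_le (M := 1 + eps) _) _; last by rewrite EFinD.
  move=> x; have /andP[_ h2] := density_bounds x t0; apply: le_trans h2 _.
  by rewrite lerD2l.
apply: le_ereal_inf_tmp => _ [V FV <-].
apply/lee_subgt0Pr => eps e0.
have [t [Vt [t0 te]]] := @filter_ex _ _ PF _ (filterI FV (small eps e0)).
apply: le_trans (ereal_sup_ubound _); last by exists t.
rewrite -EFinB; apply: Linfty_norm_ge => x.
have /andP[h1 _] := density_bounds x t0; apply: le_trans _ h1.
by rewrite lerD2l lerN2.
Qed.

End solution.

Theorem theorem2p10 (R : realType) (d : nat) (hd : d = 1%N \/ d = 2%N)
    (u0 : 'rV[R]_d -> R)
    (u0_ge0 : {ae torus d, forall x, 0 <= u0 x})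
    (u0_A0 : wiener 0 u0)
    (u0_mean :
      (((2 * pi) ^- d)%:E * (\int[torus d]_x ((u0 x)%:E)^-1) = 1)%E)
    (u0_small : (wiener_norm 0 (inv_sub1 u0) < 1)%E)
    (delta_gt0 : 0 < delta (fine (wiener_norm 0 (inv_sub1 u0)))) :
  {ae torus d, forall x, 1 / 2 < u0 x} /\
  exists u : R -> 'rV[R]_d -> R,
    [/\ global_weak_solution u0 u,
        forall T, 0 < T ->
          C_L2 T (fun t x => (u t x)^-1) /\
          L2_sobolev 2 T (fun t x => (u t x)^-1),
        forall t, 0 <= t ->
          (Linfty_norm (inv_sub1 (u t)) <=
           wiener_norm 0 (inv_sub1 u0) *
           (expR (- (delta (fine (wiener_norm 0 (inv_sub1 u0))) * t)))%:E)%E &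
        limf_esup (fun t => Linfty_norm (u t)) (pinfty_nbhs R) = 1%E].
Proof.
have u0_meas : measurable_fun setT u0.
  by have := u0_A0.1; rewrite inE => /andP[]; rewrite inE.
split; first exact: u0_gt_half.
set v0 := inv_sub1_series u0.
have v0_wien : wien v0 by exact: inv_sub1_series_wien.
have v0_mean : amp v0 0 = 0 by exact: amp_series0.
have zE : gsum (amp (inv_sub1 u0)) = gsum (amp v0).
  by apply: eq_gsum => k; rewrite -(amp_series u0_ge0 u0_meas u0_mean u0_small).
have norm_inv : wiener_norm 0 (inv_sub1 u0) = (gsum (amp v0))%:E.
  by rewrite -zE; exact: wiener_norm_inv.
move: (u0_small) delta_gt0; rewrite norm_inv lte_fin /= => z1 dz.
have z_small : gsum (amp v0) < 32^-1.
  by apply: delta_gt0_small dz; rewrite z1 andbT; exact: le_trans (wien_norm_le 0 v0_wien).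
have pA := picard_limit_admissible v0_wien z_small.
have Ar := picard_majorant_norm v0_wien z_small.
have p_fixed := picard_limit_fixed v0_wien z_small.
exists (density (picard_limit v0)); split.
- move=> T T0; apply: (weak_solution_density v0_wien pA Ar p_fixed T0).
    exact: inv_sub1_itg u0_ge0 u0_meas u0_mean.
  exact: inv_sub1_series_ae u0_ge0 u0_meas u0_mean u0_small.
- move=> T T0; split; first exact: (solution_C_L2 pA Ar).
  exact: (solution_L2_sobolev v0_wien v0_mean pA Ar p_fixed z_small dz T0).
- move=> t t0; rewrite -EFinM.
  exact: (solution_Linfty v0_wien v0_mean pA Ar p_fixed z_small dz t0).
- exact: (density_limsup v0_wien v0_mean pA Ar p_fixed z_small dz).
Qed.
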